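(* Let $G$ be a plane graph and let $e = v_1v_2$ be a boundary edge of $G$. Then there is an orientation $D$ of $G - e$ such that: (i) $|EE(D)| \neq |OE(D)|$; (ii) $d_D^+(v_1) = d_D^+(v_2) = 0$, $d_D^+(v) \le 2$ for every boundary vertex $v \notin \{v_1,v_2\}$, and $d_D^+(v) \le 4$ for every interior vertex $v$.
   Context: A plane graph is a finite simple graph embedded in the plane. Boundary vertices and boundary edges are those lying on the outer (unbounded) face; all other vertices are interior vertices. For a digraph $D$, $d_D^+(v)$ denotes the out-degree of $v$. A spanning sub-digraph $H$ of $D$ (same vertex set, any subset of arcs) is Eulerian if $d_H^+(v) = d_H^-(v)$ for every vertex $v$. $EE(D)$ (respectively $OE(D)$) denotes the set of spanning Eulerian sub-digraphs of $D$ with an even (respectively odd) number of arcs. *)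

(* Defs.v *)
From HB Require Import structures.
From mathcomp Require Import all_boot all_order all_algebra.
From mathcomp Require Import all_classical all_reals all_analysis.

Set Implicit Arguments.
Unset Strict Implicit.
Unset Printing Implicit Defensive.

Import Order.TTheory GRing.Theory Num.Theory.
Import numFieldNormedType.Exports.

Record sgraph := SGraph {
  vert :> finType;
  adj : rel vert;
  adj_sym : symmetric adj;
  adj_irr : irreflexive adj }.

Section DeleteEdge.
Variables (G : sgraph) (u v : G).

Definition del_edge_adj : rel G :=
  fun x y => adj x y && ([set x; y] != [set u; v])%SET.

Lemma del_edge_sym : symmetric del_edge_adj.
Proof. by move=> x y; rewrite /del_edge_adj adj_sym finset.setUC. Qed.

Lemma del_edge_irr : irreflexive del_edge_adj.
Proof. by move=> x; rewrite /del_edge_adj adj_irr. Qed.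

Definition del_edge : sgraph := SGraph del_edge_sym del_edge_irr.

End DeleteEdge.

(* A digraph on the vertex set T is given by its arc set; the arc (x, y) goes
   from x to y. Spanning sub-digraphs of D are then the subsets of D. *)
Section Digraph.
Variable T : finType.
Implicit Types D H : {set T * T}.

Definition outdeg D (v : T) : nat := #|[set a in D | a.1 == v]%SET|.
Definition indeg D (v : T) : nat := #|[set a in D | a.2 == v]%SET|.

Definition eulerian D : bool := [forall v, outdeg D v == indeg D v].

Definition EE D : {set {set T * T}} :=
  [set H : {set T * T} | [&& H \subset D, eulerian H & ~~ odd #|H|]]%SET.
Definition OE D : {set {set T * T}} :=
  [set H : {set T * T} | [&& H \subset D, eulerian H & odd #|H|]]%SET.

End Digraph.

Definition orientation (G : sgraph) (D : {set G * G}) : Prop :=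
  (forall x y, (x, y) \in D -> adj x y) /\
  (forall x y : G, adj x y -> ((x, y) \in D) (+) ((y, x) \in D)).

Local Open Scope classical_set_scope.
Local Open Scope ring_scope.

Definition is_arc (R : realType) (p q : R * R) (A : set (R * R)) : Prop :=
  exists f : R -> R * R,
    [/\ {within `[0, 1], continuous f},
        {in `[0, 1] &, injective f},
        f 0 = p, f 1 = q & A = f @` `[0, 1]].

Definition frontier (T : topologicalType) (A : set T) : set T :=
  closure A `\` interior A.

(* edge_arc is only meaningful on adjacent pairs; edge_arc u v and
   edge_arc v u are the same subset of the plane. *)
Record plane_graph (R : realType) := PlaneGraph {
  pgraph :> sgraph;
  pt : pgraph -> R * R;
  edge_arc : pgraph -> pgraph -> set (R * R);
  pt_inj : injective pt;
  edge_arcC : forall u v, adj u v -> edge_arc u v = edge_arc v u;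
  edge_arcP : forall u v, adj u v -> is_arc (pt u) (pt v) (edge_arc u v);
  edge_arc_pt : forall u v w, adj u v ->
    ~ (edge_arc u v `\` [set pt u; pt v]) (pt w);
  edge_arc_disj : forall u v x y, adj u v -> adj x y ->
    ([set u; v] != [set x; y])%SET ->
    (edge_arc u v `\` [set pt u; pt v]) `&` edge_arc x y = set0 }.

Section Boundary.
Variables (R : realType) (G : plane_graph R).

Definition drawing : set (R * R) :=
  range (@pt R G) `|`
  [set p | exists u v : G, adj u v /\ edge_arc u v p].

(* The complement of the drawing has exactly one unbounded component, so this
   set is that component. *)
Definition outer_face : set (R * R) :=
  [set p | (~` drawing) p /\
           ~ bounded_set (connected_component (~` drawing) p)].

Definition boundary_vertex (v : G) : Prop := frontier outer_face (pt v).

Definition interior_vertex (v : G) : Prop := ~ boundary_vertex v.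

Definition boundary_edge (u v : G) : Prop :=
  adj u v /\ edge_arc u v `<=` frontier outer_face.

End Boundary.

(* Main.v *)
Require Import Defs.
From mathcomp Require Import all_boot all_order all_algebra.
From mathcomp Require Import boolp zify.

(** By Alon and Tarsi, [|EE D| - |OE D|] is up to sign the coefficient of the monomial with
    exponents [outdeg D] in the graph polynomial, so it suffices to find a suitable monomial
    with nonzero coefficient, and adding edges or vertices only makes this harder.

    A fine grid turns the drawing into a partition of the triangular lattice into connected
    regions: one for each vertex (a star of arc thirds), one region [z] for the outer face, and
    singletons. Adjacent vertices get adjacent regions and boundary vertices get regions adjacent
    to [z]. Such adjacency graphs are stable under contraction of connected sets, and the
    parity of crossings of a closed lattice walk with rays shows: along an interface between two
    regions [u] and [v] with ends in regions [p] and [q], every cycle through the edge [u v]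
    avoiding [p] and [q] separates [p] from [q].

    These two facts replace plane topology in the induction of Thomassen and Zhu: a chord of the
    neighbourhood of [z] splits the graph and the monomials multiply; without chords a boundary
    neighbour [v] of [v1] is absorbed into [z]. *)

Set Implicit Arguments.
Unset Strict Implicit.
Unset Printing Implicit Defensive.
Import Order.TTheory GRing.Theory Num.Theory.
Local Open Scope ring_scope.

(** * Coefficients of the graph polynomial *)

(** The regions fill the lattice, so a vertex cannot simply be deleted: it has to be contracted into
    a neighbour. The sets to be removed are therefore always attached so that this creates no new
    adjacency, for instance along a clique such as a triangle [z], [v], [b]. In return no
    triangulation is ever needed: at most three regions meet in a lattice triangle, and an edge
    whose ends have no common neighbour is a bridge.

    The bounds 2 and 4 come from absorbing [v]. Its inner neighbours become boundary vertices, with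
    exponent at most 2. When [v] returns, each of them pays for its edge to [v]; the edge from [v]
    to its second boundary neighbour [w] should be paid by [v], but the coefficient obtained in this
    way may cancel. Cancellation then yields another monomial, in which one inner neighbour gains
    one more unit and [w] loses the unit with which it pays. Hence 4 inside, while [v] never pays
    for more than its two boundary edges. *)

Section GraphPolynomial.
Variable W : finType.
Implicit Types (L : seq (W * W)) (d m : {ffun W -> int}) (e : rel W) (x y u v : W).

Definition delta x : {ffun W -> int} := [ffun y => (y == x)%:Z].

Lemma deltaE x y : delta x y = (y == x)%:Z.
Proof. by rewrite ffunE. Qed.

Lemma monB d d' x : (d - d') x = d x - d' x. Proof. by rewrite !ffunE. Qed.
Lemma monD d d' x : (d + d') x = d x + d' x. Proof. by rewrite ffunE. Qed.
Lemma monMn d n x : (d *+ n) x = d x *+ n. Proof. by rewrite ffunMnE. Qed.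
Lemma mon0 x : (0 : {ffun W -> int}) x = 0. Proof. by rewrite ffunE. Qed.

Definition monE := (monB, monD, monMn, mon0, deltaE).

(* The coefficient of the monomial with exponent vector [d] in the product of the
   [x_u - x_v] over [L]. Exponents range over [int] so that the recursion needs no side
   condition; the coefficient vanishes as soon as an exponent is negative. *)
Fixpoint coef L d : int :=
  if L is (u, v) :: L' then coef L' (d - delta u) - coef L' (d - delta v)
  else (d == 0)%:R.

Lemma coef_ge0 L d x : coef L d != 0 -> 0 <= d x.
Proof.
elim: L d => [|[u v] L IH] d /=.
  by case: (eqVneq d 0) => [-> _|_]; rewrite ?monE ?eqxx.
case: (eqVneq (coef L (d - delta u)) 0) => [->|/IH + _].
  rewrite sub0r oppr_eq0 => /IH; rewrite !monE; lia.
rewrite !monE; lia.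
Qed.

Lemma coef_lt0 L d x : d x < 0 -> coef L d = 0.
Proof. by move=> dx; apply/eqP; apply: contraTT dx => /coef_ge0 h; rewrite -leNgt. Qed.

Lemma coef_support L d x :
  coef L d != 0 -> (forall a, a \in L -> (a.1 != x) && (a.2 != x)) -> d x = 0.
Proof.
elim: L d => [|[u v] L IH] d /=.
  by case: (eqVneq d 0) => [-> _|_]; rewrite ?monE ?eqxx.
move=> h0 hL; have /= /andP[hu hv] := hL (u, v) (mem_head _ _).
have hL' a : a \in L -> (a.1 != x) && (a.2 != x).
  by move=> aL; apply: hL; rewrite inE aL orbT.
move: h0; case: (eqVneq (coef L (d - delta u)) 0) => [->|/IH + _].
  rewrite sub0r oppr_eq0 => /IH /(_ hL'); rewrite !monE eq_sym (negPf hv); lia.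
move=> /(_ hL'); rewrite !monE eq_sym (negPf hu); lia.
Qed.

Lemma sum_delta (Q : {set W}) x : \sum_(y in Q) delta x y = (x \in Q)%:Z.
Proof.
under eq_bigr do rewrite deltaE.
case: (boolP (x \in Q)) => xQ.
  by rewrite (bigD1 x) //= eqxx big1 ?addr0 // => y /andP[_ /negPf ->].
by rewrite big1 // => y yQ; case: eqP => // yx; rewrite -yx yQ in xQ.
Qed.

Lemma coef_degree L d : coef L d != 0 -> \sum_x d x = (size L)%:Z.
Proof.
elim: L d => [|[u v] L IH] d /=.
  case: (eqVneq d 0) => [-> _|_]; last by rewrite eqxx.
  by rewrite big1 // => x _; rewrite ffunE.
have E w : \sum_x (d - delta w) x = \sum_x d x - 1.
  under eq_bigr do rewrite monB.
  rewrite big_split /= sumrN; congr (_ - _).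
  have := sum_delta setT w; rewrite in_setT /= => E1; rewrite -[1]/(Posz true) -E1.
  by apply: eq_bigl => y; rewrite in_setT.
case: (eqVneq (coef L (d - delta u)) 0) => [->|/IH + _].
  rewrite sub0r oppr_eq0 => /IH; rewrite E => /eqP; rewrite subr_eq => /eqP ->.
  by rewrite -addn1 PoszD.
by rewrite E => /eqP; rewrite subr_eq => /eqP ->; rewrite -addn1 PoszD.
Qed.

Lemma coef_perm L1 L2 d : perm_eq L1 L2 -> coef L1 d = coef L2 d.
Proof.
have swap L : forall a L' d, coef (a :: L ++ L') d = coef (L ++ a :: L') d.
  elim: L => [//|[u v] L IH] [x y] L' d'.
  rewrite !cat_cons /=; rewrite -!(IH (x, y)) /=.
  rewrite ![d' - delta x - _]addrAC ![d' - delta y - _]addrAC.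
  rewrite !opprB addrACA [RHS]addrACA; congr (_ + _); exact: addrC.
elim: L1 L2 d => [|a L1 IH] L2 d.
  by move/perm_size => /= /esym/eqP/nilP ->.
move=> hp; have /path.splitPr aL2 : a \in L2 by rewrite -(perm_mem hp) mem_head.
case: aL2 hp => L3 L4; rewrite -swap => hp.
have {hp} : perm_eq L1 (L3 ++ L4).
  rewrite -(perm_cons a); apply: perm_trans hp _.
  by rewrite -[a :: L4]cat1s -[a :: _]cat1s; rewrite perm_catCA.
by case: a => u v hp /=; rewrite !(IH _ _ hp).
Qed.

(** Each edge is listed once, in one of its two directions. On the diagonal the left-hand side is
    even, so only irreflexive relations have an edge list. *)
Definition edge_list L e :=
  forall x y, (count_mem (x, y) L + count_mem (y, x) L)%N = e x y.

(** The lists differ by a permutation and by reversals of pairs; each reversal changes the sign. *)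
Lemma edge_list_sign L L' e :
  edge_list L e -> edge_list L' e ->
  exists b : bool, forall d, coef L d = (-1) ^+ b * coef L' d.
Proof.
move=> h1 h2.
have {h1 h2} : forall x y, (count_mem (x, y) L + count_mem (y, x) L =
   count_mem (x, y) L' + count_mem (y, x) L')%N by move=> x y; rewrite h1 h2.
elim: L L' => [|[u v] L IH] L' h.
  have -> : L' = [::] by case: L' h => // -[x y] L' /(_ x y); rewrite /= eqxx; lia.
  by exists false => d; rewrite expr0 mul1r.
have main (b : W * W) : b = (u, v) \/ b = (v, u) -> b \in L' ->
    exists s : bool, forall d, coef ((u, v) :: L) d = (-1) ^+ s * coef L' d.
  move=> hb bL; have hp := perm_to_rem bL.
  have [|s Hs] := IH (rem b L').
    move=> x y; have := h x y; rewrite !(permP hp) /=.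
    by case: hb => ->; rewrite !xpair_eqE; lia.
  case: hb => hb; rewrite hb in hp Hs.
    exists s; move=> d; by rewrite (coef_perm d hp) /= !Hs mulrBr.
  exists (~~ s); move=> d; by rewrite (coef_perm d hp) /= !Hs signrN mulNr -mulrN opprB mulrBr.
have : ((u, v) \in L') || ((v, u) \in L').
  rewrite -!has_pred1 !has_count; have := h u v; rewrite /= eqxx; lia.
by case/orP; [apply: main; left|apply: main; right].
Qed.

(* The monomial [m] occurs in the graph polynomial of [e]; up to sign the coefficient does
   not depend on the edge list. *)
Definition nz e m := exists2 L, edge_list L e & coef L m != 0.

Lemma nzE L e m : edge_list L e -> nz e m -> coef L m != 0.
Proof.
move=> h [L' h']; have [b ->] := edge_list_sign h h'.
by rewrite mulf_eq0 signr_eq0.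
Qed.

Lemma eq_nz e e' m : e =2 e' -> nz e m -> nz e' m.
Proof. by move=> ee [L hL hc]; exists L => // x y; rewrite hL ee. Qed.

Lemma edge_list_mem L e a : edge_list L e -> a \in L -> e a.1 a.2.
Proof.
move=> hL; rewrite -has_pred1 has_count => ha; have := hL a.1 a.2.
by case: a ha => x y /=; case: (e x y) => //; lia.
Qed.

Lemma edge_list_sym L e : edge_list L e -> symmetric e.
Proof. by move=> hL x y; have := hL x y; have := hL y x; case: (e x y); case: (e y x); lia. Qed.

Lemma nz_ge0 e m x : nz e m -> 0 <= m x.
Proof. by case=> L _ /coef_ge0. Qed.

Lemma nz_support e m x : nz e m -> (forall y, ~~ e x y) -> m x = 0.
Proof.
move=> [L hL hc] hx; apply: coef_support hc _ => -[a b] aL /=.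
have eab := edge_list_mem hL aL; have eba := eab; rewrite /= (edge_list_sym hL) in eba.
apply/andP; split; apply: contraTneq isT => E; [move: eab|move: eba];
  by rewrite /= E (negPf (hx _)).
Qed.

Lemma edge_list_exists e : symmetric e -> irreflexive e -> exists L, edge_list L e.
Proof.
move=> es ei.
pose L := [seq a <- index_enum (W * W)%type | e a.1 a.2 && (enum_rank a.1 < enum_rank a.2)%N].
have uL : uniq L by rewrite filter_uniq // index_enum_uniq.
exists L => x y; rewrite !count_uniq_mem // !mem_filter /= !mem_index_enum !andbT (es y x).
case: (boolP (e x y)) => //= exy.
have : x != y by apply: contraTneq exy => ->; rewrite ei.
by rewrite -(inj_eq enum_rank_inj) -val_eqE /=; case: ltngtP.
Qed.

Lemma nz0 e : (forall x y, ~~ e x y) -> nz e 0.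
Proof. by move=> he; exists [::] => [x y|] /=; rewrite ?(negPf (he _ _)) ?eqxx. Qed.

(** * Subgraphs and products of monomials *)

Lemma coef_cat_sub L1 L2 d : coef (L1 ++ L2) d != 0 ->
  exists2 d', coef L2 d' != 0 & forall x, d' x <= d x.
Proof.
elim: L1 d => [|[u v] L IH] d /=; first by exists d.
case: (eqVneq (coef (L ++ L2) (d - delta u)) 0) => [->|/IH[d' h1 h2] _].
  rewrite sub0r oppr_eq0 => /IH[d' h1 h2]; exists d' => // x.
  by have := h2 x; rewrite !monE; lia.
by exists d' => // x; have := h2 x; rewrite !monE; lia.
Qed.

(** The factors of the missing edges can only lower exponents. This lets the lattice graph have more
    edges than the plane graph it comes from. *)
Lemma nz_sub e e' m : symmetric e' -> subrel e' e -> nz e m ->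
  exists2 m', nz e' m' & forall x, m' x <= m x.
Proof.
move=> es sub [L hL hc].
have hp : perm_eq L ([seq a <- L | ~~ e' a.1 a.2] ++ [seq a <- L | e' a.1 a.2]).
  by rewrite perm_sym perm_catC; apply/permPl/perm_filterC.
move: hc; rewrite (coef_perm m hp) => /coef_cat_sub[m' hm' le].
exists m' => //; exists [seq a <- L | e' a.1 a.2] => // x y.
have cnt a : count_mem a [seq a <- L | e' a.1 a.2] = (e' a.1 a.2 * count_mem a L)%N.
  rewrite count_filter; case: (boolP (e' a.1 a.2)) => ha.
    rewrite mul1n; apply: eq_count => b /=; case: eqP => // ->; by rewrite ha.
  rewrite mul0n -(count_pred0 L); apply: eq_count => b /=; case: eqP => // ->; by rewrite (negPf ha).
rewrite !cnt /= (es y x); have := hL x y; have := sub x y.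
by case: (e' x y) => [/(_ isT) ->|_]; rewrite ?mul1n ?mul0n.
Qed.

Definition restr (Q : {set W}) d : {ffun W -> int} := [ffun x => if x \in Q then d x else 0].

Lemma restrE Q d x : restr Q d x = if x \in Q then d x else 0.
Proof. by rewrite ffunE. Qed.

(** The edges of [L1] miss [Q], so [L2] must supply the whole degree of [d] on [Q], at most one unit
    per edge. In case of equality every edge of [L2] picks an end in [Q] and the coefficient
    factors. The inequality is the form that survives the induction: an edge that picks an end
    outside [Q] makes it strict, and the coefficient vanishes. *)
Lemma coef_glue (Q : {set W}) L1 L2 d :
  (forall a, a \in L1 -> (a.1 \notin Q) && (a.2 \notin Q)) ->
  (size L2)%:Z <= \sum_(x in Q) d x ->
  coef (L2 ++ L1) d =
    if (size L2)%:Z == \sum_(x in Q) d x then coef L2 (restr Q d) * coef L1 (restr (~: Q) d)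
    else 0.
Proof.
move=> hQ; elim: L2 d => [|[u v] L IH] d /=.
  have h0 x : x \in Q -> coef L1 d != 0 -> d x = 0.
    move=> xQ hc; apply: coef_support hc _ => a /hQ /andP[a1 a2].
    by apply/andP; split; [apply: contraNneq a1|apply: contraNneq a2] => ->.
  move=> le; case: eqP => E; last first.
    apply/eqP; apply: contra_notT E => hc; rewrite big1 // => x xQ; exact: h0.
  case: (eqVneq (restr Q d) 0) => [E0|/eqP ne].
    rewrite mul1r; congr coef; apply/ffunP => x; rewrite !(restrE,monE) inE.
    by case: (boolP (x \in Q)) => //= xQ; move/ffunP: E0 => /(_ x); rewrite !(restrE,monE) xQ.
  rewrite mul0r; apply/eqP; apply: contra_notT ne => hc; apply/ffunP => x; rewrite !(restrE,monE).
  by case: ifP => // xQ; apply: h0.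
set s := \sum_(x in Q) d x.
have S w : \sum_(x in Q) (d - delta w) x = s - (w \in Q)%:Z.
  under eq_bigr do rewrite monB.
  rewrite big_split /= sumrN; congr (_ - _).
  exact: sum_delta.
move=> le.
have key w : coef (L ++ L1) (d - delta w) =
  if (size L).+1%:Z == s then
   coef L (restr Q d - delta w) * coef L1 (restr (~: Q) d) else 0.
  rewrite IH S; last by case: (w \in Q); lia.
  case: (boolP (w \in Q)) => wQ.
    have -> : ((size L)%:Z == s - 1%:Z) = ((size L).+1%:Z == s) by lia.
    case: ifP => // _; congr (coef _ _ * coef _ _); apply/ffunP => x; rewrite !(restrE,monE) ?inE.
      by case: ifP => // xQ; rewrite (_ : (x == w) = false) ?subr0 //; apply: contraFF xQ => /eqP ->.
    case: ifP => //= xQ; rewrite (_ : (x == w) = false) ?subr0 //; apply: contraTF xQ => /eqP ->.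
    by rewrite wQ.
  rewrite subr0 ifF; last by lia.
  case: ifP => // _; rewrite (@coef_lt0 _ (restr Q d - _) w) ?mul0r //.
  by rewrite !(restrE,monE) (negPf wQ) eqxx.
by rewrite !key; case: ifP => //; rewrite ?subr0 // mulrBl.
Qed.

(** Vertices shared by the two parts have exponent 0 in [m2], so all edges of [e2] are paid for
    inside [Q] and [coef_glue] applies with equality. *)
Lemma nz_glue (Q : {set W}) e e1 e2 m1 m2 :
  (forall x y, e x y = e1 x y + e2 x y :> nat)%N ->
  (forall x y, e1 x y -> x \notin Q) ->
  (forall x, x \notin Q -> m2 x = 0) ->
  nz e1 m1 -> nz e2 m2 -> nz e (m1 + m2).
Proof.
move=> he h1 hm2 n1 n2.
have hm1 x : x \in Q -> m1 x = 0.
  move=> xQ; apply: nz_support n1 _ => y; apply: contraL xQ; exact: h1.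
case: n1 n2 => L1 hL1 c1 [L2 hL2 c2]; exists (L2 ++ L1).
  by move=> x y; rewrite !count_cat he -hL1 -hL2; lia.
have hd : (size L2)%:Z = \sum_(x in Q) (m1 + m2) x.
  rewrite -(coef_degree c2) (bigID (mem Q)) /= [X in _ + X]big1 ?addr0 => [|x /hm2 //].
  by apply: eq_bigr => x xQ; rewrite ffunE hm1 ?add0r.
rewrite (@coef_glue Q) ?hd ?eqxx //; last first.
  move=> a aL; have ha := edge_list_mem hL1 aL.
  by rewrite (h1 _ _ ha); rewrite (edge_list_sym hL1) in ha; rewrite (h1 _ _ ha).
rewrite mulf_neq0 //.
  rewrite (_ : restr _ _ = m2) //; apply/ffunP => x; rewrite !(restrE,monE).
  by case: ifPn => xQ; [rewrite hm1 ?add0r|rewrite hm2].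
rewrite (_ : restr _ _ = m1) //; apply/ffunP => x; rewrite !(restrE,monE) inE.
by case: ifPn; rewrite ?negbK => xQ; [rewrite hm2 // addr0|rewrite hm1].
Qed.

(** A vertex of exponent 0 (a root) can be picked by no edge, so the other end is forced. *)
Lemma coef_root u r L d : d r = 0 -> coef ((u, r) :: L) d = coef L (d - delta u).
Proof. by move=> dr /=; rewrite (@coef_lt0 _ (d - delta r) r) ?subr0 // !monE dr eqxx. Qed.

Definition rmE e a b : rel W :=
  fun x y => e x y && ~~ ((x == a) && (y == b) || (x == b) && (y == a)).
Definition rmV e z : rel W := fun x y => [&& e x y, x != z & y != z].

Lemma nz_root e u r m : symmetric e -> u != r -> e u r -> nz (rmE e u r) m -> m r = 0 ->
  nz e (m + delta u).
Proof.
move=> es ne eur [L hL hc] mr; exists ((u, r) :: L).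
  move=> x y; have := hL x y; rewrite /= /rmE !xpair_eqE.
  rewrite ![u == _]eq_sym ![r == _]eq_sym.
  case: (eqVneq x u) => [->|xu]; case: (eqVneq y u) => [->|yu];
   case: (eqVneq x r) => [xr|xr]; case: (eqVneq y r) => [yr|yr];
   rewrite ?xr ?yr ?eqxx ?(negPf ne) ?(negPf xu) ?(negPf yu) ?eur ?(es r u) ?eur /= ?andbT ?andbF; try lia;
   by rewrite ?xr ?yr -?es ?eur in xu yu ne *; rewrite ?eqxx in xu yu ne.
by rewrite coef_root ?addrK // !monE mr eq_sym (negPf ne).
Qed.

(** * Putting a vertex back with all its edges *)

Definition star v (N : seq W) : seq (W * W) := [seq (v, x) | x <- N].

Lemma edge_list_star e v N L : symmetric e -> irreflexive e ->
  uniq N -> N =i e v -> edge_list L (rmV e v) -> edge_list (star v N ++ L) e.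
Proof.
move=> es ei uN hN hL x y; have := hL x y; rewrite !count_cat /rmV.
have cnt a b : count_mem (a, b) (star v N) = (v == a) && e v b.
  rewrite count_map; case: (eqVneq v a) => [<-|/negPf va] /=.
    rewrite (eq_count (a2 := pred1 b)).
      by rewrite count_uniq_mem // hN.
    by move=> c /=; rewrite xpair_eqE eqxx.
  by rewrite -(count_pred0 N); apply: eq_count => c /=; rewrite xpair_eqE va.
rewrite !cnt ![v == _]eq_sym.
case: (eqVneq x v) => [->|xv]; case: (eqVneq y v) => [->|yv] /=;
  rewrite ?ei ?(es v) ?andbF ?andbT /=; lia.
Qed.

Definition dsum (U : seq W) : {ffun W -> int} := \sum_(x <- U) delta x.

Lemma dsumE (U : seq W) x : uniq U -> dsum U x = (x \in U)%:Z.
Proof.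
rewrite /dsum; elim: U => [_|y U IH /= /andP[yU uU]]; first by rewrite big_nil mon0.
rewrite big_cons monD deltaE IH // inE; case: eqVneq => [->|] /=; rewrite ?(negPf yU) ?addr0 ?add0r //.
Qed.

(* With exponent 0 at the centre every edge of the star must pick its leaf. *)
Lemma coef_star0 v U L d : v \notin U -> d v = 0 ->
  coef (star v U ++ L) d = (-1) ^+ size U * coef L (d - dsum U).
Proof.
rewrite /dsum; elim: U d => [|y U IH] d; first by rewrite big_nil subr0 mul1r.
rewrite inE negb_or => /andP[vy vU] dv /=.
rewrite (@coef_lt0 _ (d - delta v) v) ?sub0r; last by rewrite !monE dv eqxx.
rewrite IH //; last by rewrite !monE dv (negPf vy).
by rewrite big_cons opprD addrA exprS mulN1r mulNr.
Qed.

(** Exactly one edge of the star picks [v]. The coefficient is a signed sum over the leaf [u] of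
    that edge, so one term is nonzero. *)
Lemma coef_star1 v U L d : v \notin U -> d v = 1 -> coef (star v U ++ L) d != 0 ->
  (forall a, a \in L -> (a.1 != v) && (a.2 != v)) ->
  exists2 u, u \in U & coef L (d - delta v - dsum U + delta u) != 0.
Proof.
rewrite /dsum; elim: U d => [|y U IH] d.
  by move=> _ dv hc /(coef_support hc); rewrite dv.
rewrite inE negb_or => /andP[vy vU] dv /= hc hL.
case: (eqVneq (coef (star v U ++ L) (d - delta y)) 0) hc => [->|h _].
  rewrite subr0 coef_star0 //; last by rewrite !monE dv eqxx.
  rewrite mulf_eq0 signr_eq0 /= => hc; exists y; first exact: mem_head.
  by rewrite big_cons opprD !addrA addrAC [_ - delta y + _]subrK in hc *.
have [||u uU hc] := IH (d - delta y) _ _ h hL => //; first by rewrite !monE dv (negPf vy).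
exists u; first by rewrite inE uU orbT.
by rewrite big_cons opprD !addrA [d - delta v - delta y]addrAC.
Qed.

Lemma rmV_notin e v L : edge_list L (rmV e v) ->
  forall a, a \in L -> (a.1 != v) && (a.2 != v).
Proof. by move=> hL a /(edge_list_mem hL) /and3P[_ -> ->]. Qed.

(** The edges to the roots must pick [v]; this uses up the exponent of [v], so the other edges must
    pick their leaves. No choice is left and nothing cancels. *)
Lemma nz_star_roots e v m (Rt U : seq W) :
  symmetric e -> irreflexive e -> uniq (Rt ++ U) -> Rt ++ U =i e v ->
  nz (rmV e v) m -> (forall r, r \in Rt -> m r = 0) ->
  nz e (m + dsum U + delta v *+ size Rt).
Proof.
move=> es ei uN hN nm hr.
have mv : m v = 0 by apply: nz_support nm _ => y; rewrite /rmV eqxx andbF.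
have vN : v \notin Rt ++ U by rewrite hN unfold_in ei.
case: nm => L hL hc; exists (star v (Rt ++ U) ++ L); first exact: edge_list_star.
move: vN uN; rewrite mem_cat negb_or cat_uniq => /andP[vR vU] /and3P[_ hdis uU].
rewrite /star map_cat -catA -/(star v U).
have hrU r : r \in Rt -> r \notin U.
  by move=> rR; apply: contra hdis => rU; apply/hasP; exists r.
elim: Rt vR hr hrU {hdis hN} => [|r Rt IH] /=.
  move=> _ _ _; rewrite mulr0n addr0 coef_star0 //; last first.
    by rewrite !monE mv dsumE // (negPf vU).
  by rewrite addrK mulf_neq0 // signr_eq0.
rewrite inE negb_or => /andP[vr vR] hr hrU.
rewrite -/(coef ((v, r) :: ([seq (v, x) | x <- Rt] ++ star v U ++ L)) _) coef_root.
  rewrite mulrS [delta v + _]addrC addrA addrK; apply: IH => // x xR.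
    by apply: hr; rewrite inE xR orbT.
  by apply: hrU; rewrite inE xR orbT.
rewrite !monE hr ?mem_head // dsumE // (negPf (hrU r (mem_head _ _))).
by rewrite ?monE [r == v]eq_sym (negPf vr) ?mul0rn.
Qed.

(* If the natural exponent vector fails, cancellation forces another monomial in which
   some [u] gains and [w] loses one; then [w] can afford to be oriented towards [v]. *)
Lemma nz_star_switch e v m r w (U : seq W) :
  symmetric e -> irreflexive e -> uniq [:: r, w & U] -> [:: r, w & U] =i e v ->
  nz (rmV e v) m -> m r = 0 ->
  nz e (m + dsum U + delta v *+ 2) \/
  exists2 u, u \in U & nz e (m + dsum U + delta u + delta v).
Proof.
move=> es ei uN hN nm mr.
have mv : m v = 0 by apply: nz_support nm _ => y; rewrite /rmV eqxx andbF.
have vN : v \notin [:: r, w & U] by rewrite hN unfold_in ei.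
case: nm => L hL hc.
have hE := edge_list_star es ei uN hN hL.
move: vN uN => /=; rewrite !inE !negb_or => /and3P[vr vw vU] /andP[/andP[rw rU] /andP[wU uU]].
have dU x : dsum U x = (x \in U)%:Z by apply: dsumE.
(* The edge to [r] is forced; the two terms are the two choices of the edge to [w]. *)
have val0 : coef (star v [:: r, w & U] ++ L) (m + dsum U + delta v *+ 2) =
  (-1) ^+ size U * coef L m - coef (star v U ++ L) (m + dsum U + delta v - delta w).
  rewrite /star /= -/(star v U) -/(coef ((v, r) :: ((v, w) :: star v U ++ L)) _) coef_root.
    rewrite mulr2n addrA addrK /= addrK coef_star0 //; last by rewrite !monE dU mv (negPf vU).
    by rewrite addrK.
  by rewrite !monE dU mr (negPf rU) ?monE [r == v]eq_sym (negPf vr) ?mul0rn.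
case: (eqVneq (coef (star v [:: r, w & U] ++ L) (m + dsum U + delta v *+ 2)) 0); last first.
  by move=> h; left; exists (star v [:: r, w & U] ++ L).
rewrite val0 => /eqP; rewrite subr_eq0 => /eqP E; right.
have h1 : coef (star v U ++ L) (m + dsum U + delta v - delta w) != 0.
  by rewrite -E mulf_neq0 // signr_eq0.
have [|u uU' hu] := coef_star1 vU _ h1 (rmV_notin hL).
  by rewrite !monE dU mv (negPf vU) eqxx (negPf vw).
exists u => //; exists (star v [:: r, w & U] ++ L) => //.
(* Here [v] has exponent 1, spent on the edge to [r], so the remaining edges are forced to [w] and
   to the leaves. *)
rewrite /star /= -/(star v U) -/(coef ((v, r) :: ((v, w) :: star v U ++ L)) _) coef_root; last first.
  rewrite !monE dU mr (negPf rU) [r == v]eq_sym (negPf vr).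
  by case: eqP => // ru; rewrite -ru (negPf rU) in uU'.
rewrite addrK /= (@coef_lt0 _ (_ - delta v) v); last first.
  rewrite !monE dU mv (negPf vU) eqxx.
  by case: eqP => // ru; rewrite -ru (negPf vU) in uU'.
rewrite sub0r oppr_eq0 coef_star0 //; last first.
  rewrite !monE dU mv (negPf vU) (negPf vw).
  by case: eqP => // ru; rewrite -ru (negPf vU) in uU'.
rewrite mulf_neq0 ?signr_eq0 //.
apply: contraNneq hu => <-; apply/eqP; congr coef; apply/ffunP => x; rewrite !monE; lia.
Qed.

End GraphPolynomial.

(** * The Alon-Tarsi formula *)

Section Orient.
Variable T : finType.
Implicit Types (L : seq (T * T)) (H D : {set T * T}) (e : rel T).

Definition bal H : {ffun T -> int} := \sum_(a in H) (delta a.1 - delta a.2).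

Lemma sum_delta_card (P : pred (T * T)) (f : T * T -> T) v :
  (\sum_(a | P a) delta (f a)) v = #|[set a | P a && (f a == v)]|%:Z.
Proof.
have -> : (\sum_(a | P a) delta (f a)) v = \sum_(a | P a) delta (f a) v.
  by rewrite sum_ffunE.
under eq_bigr do rewrite deltaE.
rewrite -sum1_card (big_morph Posz (id1 := 0) (op1 := +%R)) //.
under [RHS]eq_bigl do rewrite inE.
rewrite big_mkcondr /=; apply: eq_bigr => a _; rewrite eq_sym.
by case: eqP.
Qed.

Lemma bal_eulerian H : (bal H == 0) = eulerian H.
Proof.
have balE v : bal H v = (outdeg H v)%:Z - (indeg H v)%:Z.
  rewrite /bal sumrB monB !sum_delta_card /outdeg /indeg.
  by congr (Posz #|pred_of_set _| - Posz #|pred_of_set _|); apply/setP => a; rewrite !inE.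
apply/eqP/forallP => [b0 v|h].
  have := balE v; rewrite b0 mon0; lia.
apply/ffunP => v; rewrite balE mon0; have /eqP -> := h v; exact: subrr.
Qed.

Lemma sum_subsetU1 (a : T * T) D (F : {set T * T} -> int) : a \notin D ->
  \sum_(H : {set T * T} | H \subset a |: D) F H =
  \sum_(H : {set T * T} | H \subset D) F H + \sum_(H : {set T * T} | H \subset D) F (a |: H).
Proof.
move=> aD; rewrite (bigID (fun H : {set T * T} => a \in H)) /= addrC; congr (_ + _).
  apply: eq_bigl => H; apply/andP/idP => [[s aH]|s].
    by rewrite -(setU1K aD) subsetD1 s aH.
  split; first exact: subset_trans s (subsetUr _ _).
  by apply: contra aD; apply: (subsetP s).
rewrite (reindex_onto (fun H : {set T * T} => a |: H) (fun H => H :\ a)) /=; last first.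
  by move=> H /andP[_ aH]; rewrite setD1K.
apply: eq_bigl => H; rewrite setU11 andbT.
apply/andP/idP => [[s /eqP E]|s].
  by rewrite -E -(setU1K aD) setSD.
split; first exact: setUS.
by rewrite setU1K //; apply: contra aD; apply: (subsetP s).
Qed.

(** [H] is the set of arcs that pick their head instead of their tail: each contributes a sign and
    the shift [delta a.1 - delta a.2]. The offset [k] accumulates the shifts of the arcs already
    treated. *)
Lemma coef_expand L k : uniq L ->
  coef L (\sum_(a <- L) delta a.1 + k) =
  \sum_(H : {set T * T} | H \subset [set a in L]) (-1) ^+ #|H| * (k + bal H == 0)%:R.
Proof.
elim: L k => [|a L IH] k /=.
  move=> _; rewrite (big_pred1 set0); last by move=> H; rewrite (_ : [set a in [::]] = set0) ?subset0 //; apply/setP => x; rewrite !inE.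
  by rewrite cards0 expr0 mul1r big_nil add0r /bal big_set0 addr0.
case: a => u v /andP[aL uL].
rewrite set_cons sum_subsetU1 ?inE //= big_cons /=.
have -> : delta u + \sum_(j <- L) delta j.1 + k - delta u = \sum_(j <- L) delta j.1 + k.
  by rewrite addrAC [delta u + _]addrC addrK.
have -> : delta u + \sum_(j <- L) delta j.1 + k - delta v =
          \sum_(j <- L) delta j.1 + (k + (delta u - delta v)).
  by rewrite [delta u + _]addrC -!addrA; congr (_ + _); rewrite addrCA.
rewrite !IH //; congr (_ + _); rewrite -sumrN; apply: eq_bigr => H s.
have aH : (u, v) \notin H.
  by apply: contra aL => /(subsetP s); rewrite inE.
by rewrite cardsU1 aH add1n exprS mulN1r mulNr /bal big_setU1 //= -[k + (delta u - delta v) + _]addrA.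
Qed.

Lemma coef_EE_OE D :
  coef (enum D) (\sum_(a <- enum D) delta a.1) = #|EE D|%:Z - #|OE D|%:Z.
Proof.
rewrite -[X in coef _ X]addr0 coef_expand ?enum_uniq //.
have -> : [set a in enum D] = D by apply/setP => a; rewrite inE mem_enum.
under eq_bigr do rewrite add0r bal_eulerian.
rewrite -!sum1_card !(big_morph Posz (id1 := 0) (op1 := +%R)) // -sumrN.
rewrite (bigID (fun H : {set T * T} => odd #|H|)) /= addrC; congr (_ + _).
  rewrite [RHS](eq_bigl (fun H : {set T * T} => ((H \subset D) && ~~ odd #|H|) && eulerian H)); last first.
    by move=> H; rewrite inE; case: (_ \subset _); case: (eulerian H); case: (odd _).
  rewrite [RHS]big_mkcondr /=; apply: eq_bigr => H /andP[_ h].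
  by rewrite -signr_odd (negPf h); case: (eulerian H).
rewrite [RHS](eq_bigl (fun H : {set T * T} => ((H \subset D) && odd #|H|) && eulerian H)); last first.
  by move=> H; rewrite inE; case: (_ \subset _); case: (eulerian H); case: (odd _).
rewrite [RHS]big_mkcondr /=; apply: eq_bigr => H /andP[_ h].
by rewrite -signr_odd h; case: (eulerian H).
Qed.

(** Some term of the expansion survives; each edge is directed out of the end picked there. *)
Lemma coef_orient L m : coef L m != 0 ->
  exists2 L', m = \sum_(a <- L') delta a.1 &
   forall x y, (count_mem (x, y) L' + count_mem (y, x) L' =
                count_mem (x, y) L + count_mem (y, x) L)%N.
Proof.
elim: L m => [|[u v] L IH] m /=.
  by case: (eqVneq m 0) => [-> _|_]; rewrite ?eqxx //; exists [::]; rewrite ?big_nil.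
case: (eqVneq (coef L (m - delta u)) 0) => [->|/IH[L' E h] _].
  rewrite sub0r oppr_eq0 => /IH[L' E h]; exists ((v, u) :: L').
    by rewrite big_cons /= -E addrC subrK.
  by move=> x y; have := h x y; rewrite /= !xpair_eqE; lia.
exists ((u, v) :: L'); first by rewrite big_cons /= -E addrC subrK.
by move=> x y; have := h x y; rewrite /= !xpair_eqE; lia.
Qed.

Lemma nz_orientation e (m : {ffun T -> int}) : nz e m ->
  exists D : {set T * T},
  [/\ forall x y, (x, y) \in D -> e x y,
      forall x y, e x y -> ((x, y) \in D) (+) ((y, x) \in D),
      #|EE D| <> #|OE D| & forall v, (outdeg D v)%:Z = m v].
Proof.
move=> nm; have [L hL hc] := nm; have [L' E h] := coef_orient hc.
have hL' : edge_list L' e by move=> x y; rewrite h hL.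
have cnt x y : (count_mem (x, y) L' = ((x, y) \in L')).
  have := hL' x y; have := has_pred1 (x, y) L'; rewrite has_count => <-.
  by case: (count _ _) => [|[|n]] //; case: (e x y).
have uL' : uniq L' by apply: count_mem_uniq => -[x y]; apply: cnt.
pose D := [set a in L'].
have pD : perm_eq (enum D) L'.
  by apply: uniq_perm; rewrite ?enum_uniq // => a; rewrite mem_enum inE.
exists D; split.
- by move=> x y; rewrite inE => /(edge_list_mem hL').
- move=> x y exy; rewrite !inE; have := hL' x y; rewrite !cnt exy.
  by case: (_ \in _); case: (_ \in _).
- have : coef (enum D) m != 0 by rewrite (coef_perm m pD); apply: nzE nm.
  by rewrite E -(perm_big _ pD) coef_EE_OE => + EO; rewrite EO subrr eqxx.
- move=> v; rewrite E -(perm_big _ pD) big_enum /= sum_delta_card.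
  by congr (Posz #|pred_of_set _|); apply/setP => a; rewrite !inE.
Qed.
End Orient.

(** The way back from regions to vertices of the plane graph: [e'] lives on the image of [i], so [m]
    vanishes off that image and edge lists can be mapped along [i]. *)
Lemma nz_transfer (V W : finType) (i : V -> W) (e : rel V) (e' : rel W) (m : {ffun W -> int}) :
  injective i -> symmetric e -> irreflexive e ->
  (forall x y, e' (i x) (i y) = e x y) ->
  (forall x y, e' x y -> (exists x', x = i x') /\ exists y', y = i y') ->
  nz e' m -> nz e [ffun x => m (i x)].
Proof.
move=> ii es ei ee ex nm.
have [L hL] := edge_list_exists es ei.
pose L' := [seq (i a.1, i a.2) | a <- L].
have pi : injective (fun a : V * V => (i a.1, i a.2)).
  by move=> [a b] [c d] [] /ii -> /ii ->.
have hL' : edge_list L' e'.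
  have cnt a b : count_mem (i a, i b) L' = count_mem (a, b) L.
    by rewrite count_map; apply: eq_count => c /=; exact: (inj_eq pi c (a, b)).
  move=> x y; case: (boolP (e' x y)) => [exy|nexy].
    by have [[x' xE] [y' yE]] := ex _ _ exy; rewrite xE yE !cnt hL -ee -xE -yE exy.
  have n0 a b : ~~ e' a b -> ~~ e' b a -> count_mem (a, b) L' = 0%N.
    move=> nab nba; apply/count_memPn; apply: contra nab => /mapP[[c d] cL [-> ->]].
    by rewrite ee; apply: (edge_list_mem hL cL).
  have nexy' : ~~ e' y x.
    by apply: contra nexy => eyx; have [[y' yE] [x' xE]] := ex _ _ eyx; move: eyx; rewrite xE yE !ee es.
  by rewrite !n0.
have hc := nzE hL' nm; exists L => //.
have m0 x : (forall x', x != i x') -> m x = 0.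
  move=> hx; apply: nz_support nm _ => y; apply/negP => /ex[[x' xE] _].
  by have := hx x'; rewrite xE eqxx.
move: hc; rewrite (_ : coef L' m = coef L [ffun x => m (i x)]) //.
rewrite /L'; elim: L m m0 {nm hL L' hL'} => [|[u v] L IH] m m0 /=.
  congr (_ %:R); congr nat_of_bool; apply/eqP/eqP => [->|/ffunP E].
    by apply/ffunP => x; rewrite !ffunE.
  apply/ffunP => x; rewrite mon0; case: (pickP (fun x' => x == i x')) => [x' /eqP ->|nx].
    by have := E x'; rewrite !ffunE.
  by apply: m0 => x'; rewrite nx.
have key w : coef [seq (i a.1, i a.2) | a <- L] (m - delta (i w)) =
             coef L ([ffun x => m (i x)] - delta w).
  rewrite IH.
    by congr coef; apply/ffunP => x; rewrite !ffunE (inj_eq ii).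
  by move=> x nx; rewrite monB deltaE m0 // (negPf (nx w)).
by rewrite !key.
Qed.

(** * The triangular lattice *)

Definition cell := (int * int)%type.

Section Lattice.
Implicit Types (c d a b x y : cell).

(* The triangular lattice: neighbours differ by [(1,0)], [(0,1)] or [(1,1)] up to sign. *)
Definition adjT c d : bool :=
  [&& c != d & ((c.1 <= d.1 <= c.1 + 1) && (c.2 <= d.2 <= c.2 + 1)
            || (d.1 <= c.1 <= d.1 + 1) && (d.2 <= c.2 <= d.2 + 1))].

(* The common neighbour of [c] and [d] on the left of the directed edge [(c, d)]. *)
Definition left c d : cell :=
  (c.1 + (d.1 - c.1) - (d.2 - c.2), c.2 + (d.1 - c.1)).

Lemma adjT_sym : symmetric adjT.
Proof. by move=> c d; rewrite /adjT eq_sym orbC. Qed.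

Lemma adjTE c d : adjT c d ->
  [\/ d = (c.1 + 1, c.2), d = (c.1 + 1, c.2 + 1) | d = (c.1, c.2 + 1)] \/
  [\/ d = (c.1 - 1, c.2), d = (c.1 - 1, c.2 - 1) | d = (c.1, c.2 - 1)].
Proof.
case: c d => [c1 c2] [d1 d2]; rewrite /adjT xpair_eqE /= => h.
have [|[|[|[|[|]]]]] : (d1 == c1 + 1) && (d2 == c2) \/ (d1 == c1 + 1) && (d2 == c2 + 1) \/
  (d1 == c1) && (d2 == c2 + 1) \/ (d1 == c1 - 1) && (d2 == c2) \/
  (d1 == c1 - 1) && (d2 == c2 - 1) \/ (d1 == c1) && (d2 == c2 - 1) by lia.
- by case/andP=> /eqP -> /eqP ->; left; constructor 1.
- by case/andP=> /eqP -> /eqP ->; left; constructor 2.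
- by case/andP=> /eqP -> /eqP ->; left; constructor 3.
- by case/andP=> /eqP -> /eqP ->; right; constructor 1.
- by case/andP=> /eqP -> /eqP ->; right; constructor 2.
- by case/andP=> /eqP -> /eqP ->; right; constructor 3.
Qed.

(* The lattice triangles are [Up(i,j) = {(i,j), (i+1,j), (i+1,j+1)}] and
   [Down(i,j) = {(i,j), (i,j+1), (i+1,j+1)}]; [up] and [down] tell whether the step from
   [a] to [b] crosses the horizontal ray going right from that triangle. *)
Definition up (i j : int) a b : bool :=
  (a.2 == j) && (b.2 == j + 1) && (i + 1 <= a.1) ||
  (b.2 == j) && (a.2 == j + 1) && (i + 1 <= b.1).
Definition down (i j : int) a b : bool :=
  (a.2 == j) && (b.2 == j + 1) && (i + 1 <= b.1) ||
  (b.2 == j) && (a.2 == j + 1) && (i + 1 <= a.1).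

(* Crossing of the ray from the triangle on the left of the directed edge [(c, d)]. *)
Definition cross c d a b : bool :=
  if d.1 == c.1 + 1 then (if d.2 == c.2 then up c.1 c.2 a b else down c.1 c.2 a b)
  else if d.1 == c.1 then
    (if d.2 == c.2 + 1 then up (c.1 - 1) c.2 a b else down c.1 (c.2 - 1) a b)
  else (if d.2 == c.2 then down (c.1 - 1) (c.2 - 1) a b else up (c.1 - 1) (c.2 - 1) a b).

Definition same_edge c d a b : bool := (a == c) && (b == d) || (a == d) && (b == c).

(** The two triangles share the edge on the right, and their rays are crossed by the same steps
    apart from that edge. *)
Lemma up_down i j a b : adjT a b ->
  up i j a b (+) down i j a b = same_edge (i, j) (i + 1, j + 1) a b.
Proof.
case: a => a1 a2; rewrite /up /down /same_edge.
by case/adjTE => [[]->|[]->]; rewrite !xpair_eqE /=; lia.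
Qed.

Lemma down_up i j a b : adjT a b ->
  down i j a b (+) up (i - 1) j a b = same_edge (i, j) (i, j + 1) a b.
Proof.
case: a => a1 a2; rewrite /up /down /same_edge.
by case/adjTE => [[]->|[]->]; rewrite !xpair_eqE /=; lia.
Qed.

Definition beyond i j x : bool := (x.2 == j) && (i + 1 <= x.1).

(** These two rays run on either side of row [j]. A step between a cell of [beyond] and another row
    crosses exactly one of them; inside the row nothing is crossed, and [beyond] changes only along
    the shared edge. The [beyond] terms cancel on closed walks. *)
Lemma up_down_shift i j a b : adjT a b ->
  up i j a b (+) down i (j - 1) a b =
  same_edge (i, j) (i + 1, j) a b (+) (beyond i j a (+) beyond i j b).
Proof.
case: a => a1 a2; rewrite /up /down /same_edge /beyond.
have [->|ne] := eqVneq a2 j; case/adjTE => [[]->|[]->]; rewrite !xpair_eqE /= ?eqxx ?(negPf ne) /=; lia.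
Qed.

Lemma crossE i j :
  [/\ cross (i, j) (i + 1, j) =2 up i j, cross (i, j) (i + 1, j + 1) =2 down i j
    & cross (i, j) (i, j + 1) =2 up (i - 1) j] /\
  [/\ cross (i, j) (i - 1, j) =2 down (i - 1) (j - 1),
      cross (i, j) (i - 1, j - 1) =2 up (i - 1) (j - 1)
    & cross (i, j) (i, j - 1) =2 down i (j - 1)].
Proof.
have n1 k : (k == k + 1 :> int) = false by lia.
have n2 k : (k - 1 == k + 1 :> int) = false by lia.
have n3 k : (k - 1 == k :> int) = false by lia.
have n4 k : (k + 1 == k :> int) = false by lia.
by rewrite /cross /= ?eqxx ?(n1, n2, n3, n4); split; split => a b.
Qed.

Lemma cross_left c d a b : adjT c d -> cross c d a b = cross d (left c d) a b.
Proof.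
case: c => i j.
have L (x y x' y' : int) : x = x' -> y = y' -> (x, y) = (x', y') :> cell by move=> -> ->.
have [[E0 E1 E2] [E3 E4 E5]] := crossE i j.
case/adjTE => [[]->|[]->] /=.
- have -> : left (i, j) (i + 1, j) = (i + 1, j + 1) by rewrite /left /=; apply: L; lia.
  by have [[_ _ ->] _] := crossE (i + 1) j; rewrite E0 addrK.
- have -> : left (i, j) (i + 1, j + 1) = (i + 1 - 1, j + 1) by rewrite /left /=; apply: L; lia.
  by have [_ [-> _ _]] := crossE (i + 1) (j + 1); rewrite E1 !addrK.
- have -> : left (i, j) (i, j + 1) = (i - 1, j + 1 - 1) by rewrite /left /=; apply: L; lia.
  by have [_ [_ -> _]] := crossE i (j + 1); rewrite E2 addrK.
- have -> : left (i, j) (i - 1, j) = (i - 1, j - 1) by rewrite /left /=; apply: L; lia.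
  by have [_ [_ _ ->]] := crossE (i - 1) j; rewrite E3.
- have -> : left (i, j) (i - 1, j - 1) = (i - 1 + 1, j - 1) by rewrite /left /=; apply: L; lia.
  by have [[-> _ _] _] := crossE (i - 1) (j - 1); rewrite E4.
- have -> : left (i, j) (i, j - 1) = (i + 1, j - 1 + 1) by rewrite /left /=; apply: L; lia.
  by have [[_ -> _] _] := crossE i (j - 1); rewrite E5.
Qed.

Lemma same_edgeC c d a b : same_edge c d a b = same_edge d c a b.
Proof. by rewrite /same_edge orbC. Qed.

Lemma cross_flip c d : adjT c d -> exists g : cell -> bool, forall a b, adjT a b ->
  cross c d a b (+) cross d c a b = same_edge c d a b (+) (g a (+) g b).
Proof.
wlog: c d / [\/ d = (c.1 + 1, c.2), d = (c.1 + 1, c.2 + 1) | d = (c.1, c.2 + 1)].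
  move=> th cd; case: (adjTE cd) => [|h]; first by move/th; apply.
  have [||g hg] := th d c; last 1 first.
  - by exists g => a b ab; rewrite addbC same_edgeC hg.
  - case: h => -> /=; [constructor 1|constructor 2|constructor 3]; rewrite !subrK -?surjective_pairing //.
  - by rewrite adjT_sym.
case: c => i j /= h _; have [[E0 E1 E2] _] := crossE i j; case: h => ->.
- exists (beyond i j) => a b ab; rewrite -up_down_shift // E0.
  by have [_ [+ _ _]] := crossE (i + 1) j; rewrite addrK => ->.
- exists (fun=> false) => a b ab; rewrite -up_down // E1 !addbF addbC.
  by have [_ [_ + _]] := crossE (i + 1) (j + 1); rewrite !addrK => ->.
- exists (fun=> false) => a b ab; rewrite -down_up // E2 !addbF addbC.
  by have [_ [_ _ +]] := crossE i (j + 1); rewrite !addrK => ->.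
Qed.

Lemma adjT_left c d : adjT c d -> adjT c (left c d) && adjT d (left c d).
Proof.
case: c => c1 c2.
by case/adjTE => [[]->|[]->]; rewrite /left /adjT !xpair_eqE /=; lia.
Qed.

Lemma left_left c d : left d (left c d) = c.
Proof. by case: c d => [c1 c2] [d1 d2]; rewrite /left /=; congr pair; lia. Qed.

Lemma left_rot c d : left (left c d) c = d.
Proof. by rewrite -{2}(left_left c d) left_left. Qed.

Fixpoint walkx (f : cell -> cell -> bool) x (s : seq cell) : bool :=
  if s is y :: s' then f x y (+) walkx f y s' else false.

Lemma eq_walkx (r : rel cell) f g x s : path r x s ->
  (forall a b, r a b -> f a b = g a b) -> walkx f x s = walkx g x s.
Proof.
move=> + h; elim: s x => //= y s IH x /andP[rxy ps]; by rewrite h // IH.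
Qed.

Lemma walkx_false x s : walkx (fun _ _ => false) x s = false.
Proof. by elim: s x => //= y s IH x; rewrite IH. Qed.

Lemma walkxD f g x s : walkx (fun a b => f a b (+) g a b) x s = walkx f x s (+) walkx g x s.
Proof. by elim: s x => //= y s IH x; rewrite IH addbACA. Qed.

Lemma walkx_telescope (g : cell -> bool) x s :
  walkx (fun a b => g a (+) g b) x s = g x (+) g (last x s).
Proof.
elim: s x => [|y s IH] x /=; first by rewrite addbb.
by rewrite IH -addbA addKb.
Qed.

(* [X c d] is the side of the closed walk on which the triangle left of [(c, d)] lies. *)
Definition sides (X : cell -> cell -> bool) : Prop :=
  forall c d, adjT c d -> X c d = X d (left c d).

(** [X] is the crossing parity of the ray. The potentials of [cross_flip] telescope to zero along a
    closed walk, so two triangles sharing an edge differ by the parity with which the walk uses that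
    edge. *)
Lemma closed_walk_sides x s : path adjT x s -> last x s = x ->
  exists2 X, sides X &
    forall c d, adjT c d -> X c d (+) X d c = walkx (same_edge c d) x s.
Proof.
move=> ps ls; exists (fun c d => walkx (cross c d) x s).
  by move=> c d cd; apply: eq_walkx ps _ => a b _; apply: cross_left.
move=> c d cd; have [g hg] := cross_flip cd.
by rewrite -walkxD (eq_walkx ps hg) walkxD walkx_telescope ls addbb addbF.
Qed.

Lemma walkx_out c d x s : c \notin x :: s -> walkx (same_edge c d) x s = false.
Proof.
elim: s x => //= y s IH x; rewrite inE negb_or => /andP[cx cys].
rewrite IH // addbF /same_edge [x == c]eq_sym (negPf cx) /=.
by move: cys; rewrite inE negb_or [y == c]eq_sym => /andP[/negPf -> _]; rewrite andbF.
Qed.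

(** * Walking along the interface of two regions *)

Section Interface.
Variables (W : eqType) (l : cell -> W) (u v : W).
Hypothesis uv : u != v.

Definition uvstep c d := (l c == u) && (l d == v) || (l c == v) && (l d == u).
Definition state := (cell * cell)%type.
Definition isst (p : state) := [&& adjT p.1 p.2, l p.1 == u & l p.2 == v].
Definition stop (p : state) := (l (left p.1 p.2) != u) && (l (left p.1 p.2) != v).
(* Walk along the interface between the labels [u] and [v] until a third label shows up on the left. *)
Definition next (p : state) : state :=
  if stop p then p
  else if l (left p.1 p.2) == u then (left p.1 p.2, p.2) else (p.1, left p.1 p.2).
Definition prev (p : state) : state :=
  if l (left p.2 p.1) == u then (left p.2 p.1, p.2) else (p.1, left p.2 p.1).

Lemma isst_next p : isst p -> isst (next p).
Proof.
rewrite /isst /next /stop; case: p => c d /= /and3P[cd lc ld].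
have /andP[cl dl] := adjT_left cd.
case: (eqVneq (l (left c d)) u) => /= [->|nu]; first by rewrite adjT_sym dl eqxx ld.
by case: (eqVneq (l (left c d)) v) => /= [->|nv]; rewrite ?cd ?cl ?lc ?ld ?eqxx.
Qed.

Lemma prev_next p : isst p -> ~~ stop p -> prev (next p) = p.
Proof.
rewrite /isst /next /prev => /and3P[cd /eqP lc /eqP ld] ns; rewrite (negPf ns).
case: p cd lc ld {ns} => c d /= cd lc ld.
case hu: (l (left c d) == u) => /=; first by rewrite left_left lc eqxx.
by rewrite left_rot ld eq_sym (negPf uv).
Qed.

Definition transparent (X : cell -> cell -> bool) (p : state) :=
  forall c d, adjT c d -> l c = u -> l d = v -> (c, d) != p -> X c d = X d c.

(** The triangle left of [p] is the triangle right of its successor. *)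
Lemma next_side X p q : sides X -> isst p -> ~~ stop p -> q = next p -> X q.2 q.1 = X p.1 p.2.
Proof.
move=> sX /and3P[cd lc ld] ns -> ; rewrite /next (negPf ns).
case: p cd lc ld {ns} => c d /= cd lc ld.
have /andP[cl dl] := adjT_left cd.
case: ifP => _ /=; first by rewrite -sX.
by rewrite (sX c d) // (sX d (left c d)) // left_left.
Qed.

(** By finiteness and injectivity the walk from [p] stops or returns to [p]. The interface edges it
    passes in between are transparent, so the side is constant; a walk that returns arrives from the
    right of [p], and the two sides of [p] agree. *)
Lemma interface_end (p : state) (s : seq state) : isst p -> (forall q, isst q -> q \in s) ->
  (exists2 q, isst q /\ stop q & forall X, sides X -> transparent X p -> X q.1 q.2 = X p.1 p.2)
  \/ (forall X, sides X -> transparent X p -> X p.1 p.2 = X p.2 p.1).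
Proof.
move=> stp fin; pose t n := iter n next p.
have stt n : isst (t n) by elim: n => //= n; apply: isst_next.
have walk n X : sides X -> transparent X p ->
    (forall i, (i < n)%N -> ~~ stop (t i)) -> (forall i, (0 < i <= n)%N -> t i != p) ->
    X (t n).1 (t n).2 = X p.1 p.2.
  move=> sX tX; elim: n => [//|n IH] hs hp.
  rewrite -IH => [|i hi|i hi]; [|by apply: hs; lia|by apply: hp; lia].
  rewrite -(next_side sX (stt n) (hs n (ltnSn n)) (erefl (t n.+1))).
  have /and3P[h1 /eqP h2 /eqP h3] := stt n.+1; apply: tX => //.
  by rewrite -surjective_pairing; apply: hp; lia.
pose ret n := (0 < n)%N && (t n == p) && [forall i : 'I_n, ~~ stop (t i)].
have [[n hn]|nret] := pselect (exists n, ret n).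
  have [k /andP[/andP[k0 /eqP tk] /forallP sk] mink] := find_ex_minn (ex_intro (fun n => ret n) n hn).
  right => X sX tX; case: k k0 tk sk mink => // k _ tk sk mink.
  have ns i : (i < k.+1)%N -> ~~ stop (t i) by move=> hi; apply: (sk (Ordinal hi)).
  rewrite -(walk k X) //; last 2 first.
  - by move=> i hi; apply: ns; lia.
  - move=> i hi; apply: contraT; rewrite negbK => ti.
    suff : (k < i)%N by lia.
    apply: mink; rewrite /ret ti; have -> /= : (0 < i)%N by lia.
    by apply/forallP => j; apply: ns; have := ltn_ord j; lia.
  by rewrite -(next_side sX (stt k) (ns k (ltnSn k)) (erefl (t k.+1))) tk.
left; have [[n hn]|ns] := pselect (exists n, stop (t n)).
  have [k sk mink] := find_ex_minn (ex_intro (fun n => stop (t n)) n hn).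
  have nsk i : (i < k)%N -> ~~ stop (t i).
    by move=> hi; apply: contraTN hi => /mink; rewrite -leqNgt.
  exists (t k); first by split.
  move=> X sX tX; apply: walk => // i hi; apply/negP => ti; apply: nret; exists i.
  rewrite /ret ti; have -> /= : (0 < i)%N by lia.
  by apply/forallP => j; apply: nsk; have := ltn_ord j; lia.
exfalso.
have {}ns n : ~~ stop (t n) by apply/negP => h; apply: ns; exists n.
have inj i j : t (i + j)%N = t j -> t i = p.
  elim: j => [|j IH]; first by rewrite addn0.
  rewrite addnS => E; apply: IH.
  by rewrite -(prev_next (stt (i + j)%N) (ns _)) -[RHS](prev_next (stt j) (ns _)) -[next (t (i + j)%N)]/(t (i + j).+1) E.
(* Pigeonhole: one more iterate than [s] has entries. *)
have /(uniqPn p) : ~~ uniq [seq t i | i <- iota 0 (size s).+1].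
  apply/negP => uq; have := @uniq_leq_size _ _ s uq; rewrite size_map size_iota => h.
  suff : (size s < size s)%N by rewrite ltnn.
  by apply: h => q /mapP[i _ ->]; apply: fin.
move=> [i [j [ij]]]; rewrite size_map size_iota => js.
rewrite !(nth_map 0%N) ?size_iota ?nth_iota ?add0n; try lia.
move=> E; have := inj (j - i)%N i; rewrite subnK ?(ltnW ij) // => /(_ (esym E)) ti.
apply: nret; exists (j - i)%N; rewrite /ret ti eqxx subn_gt0 ij /=.
by apply/forallP.
Qed.

End Interface.

(* Connectedness of a set of cells: a predicate stable under adjacency inside [A] that
   holds somewhere on [A] holds on all of [A]. *)
Definition connT (A : cell -> Prop) : Prop :=
  forall P : cell -> Prop, (forall a b, A a -> A b -> adjT a b -> P a -> P b) ->
  forall a b, A a -> A b -> P a -> P b.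

Lemma connT_path (A : cell -> Prop) a b : connT A -> A a -> A b ->
  exists s, [/\ path adjT a s, last a s = b & forall c, c \in a :: s -> A c].
Proof.
move=> cA Aa Ab.
apply: (cA (fun b => exists s, [/\ path adjT a s, last a s = b & forall c, c \in a :: s -> A c]) _ a b) => //.
- move=> x y Ax Ay xy [s [ps ls hs]]; exists (rcons s y); split.
  + by rewrite rcons_path ps ls.
  + by rewrite last_rcons.
  + by move=> c; rewrite -rcons_cons mem_rcons inE => /predU1P[->|/hs].
- by exists [::]; split => // c; rewrite inE => /eqP ->.
Qed.

(* Off the walk, the side of a triangle only depends on any of its cells. *)
Lemma side_const X x0 s : sides X ->
  (forall c d, adjT c d -> X c d (+) X d c = walkx (same_edge c d) x0 s) ->
  (forall c d d', c \notin x0 :: s -> adjT c d -> adjT c d' -> X c d = X c d').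
Proof.
move=> sX hX c d d' cs.
have flip e : adjT c e -> X c e = X e c.
  by move=> ce; apply/eqP; rewrite -negb_add hX // walkx_out.
have stepL e : adjT c e -> X c e = X c (left c e).
  move=> ce; have /andP[h1 h2] := adjT_left ce.
  by rewrite (sX c e) // (sX e (left c e)) // left_left flip.
have H e : adjT c e -> X c e = X c (c.1 + 1, c.2).
  case: c {cs flip} stepL => i j stepL /=.
  have L (x y x' y' : int) : x = x' -> y = y' -> (x, y) = (x', y') :> cell by move=> -> ->.
  have a0 : adjT (i, j) (i + 1, j) by rewrite /adjT xpair_eqE /=; lia.
  have a1 : adjT (i, j) (i + 1, j + 1) by rewrite /adjT xpair_eqE /=; lia.
  have a2 : adjT (i, j) (i, j + 1) by rewrite /adjT xpair_eqE /=; lia.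
  have a3 : adjT (i, j) (i - 1, j) by rewrite /adjT xpair_eqE /=; lia.
  have a4 : adjT (i, j) (i - 1, j - 1) by rewrite /adjT xpair_eqE /=; lia.
  have E0 : X (i, j) (i + 1, j) = X (i, j) (i + 1, j + 1).
    by rewrite stepL //; congr X; rewrite /left /=; apply: L; lia.
  have E1 : X (i, j) (i + 1, j + 1) = X (i, j) (i, j + 1).
    by rewrite stepL //; congr X; rewrite /left /=; apply: L; lia.
  have E2 : X (i, j) (i, j + 1) = X (i, j) (i - 1, j).
    by rewrite stepL //; congr X; rewrite /left /=; apply: L; lia.
  have E3 : X (i, j) (i - 1, j) = X (i, j) (i - 1, j - 1).
    by rewrite stepL //; congr X; rewrite /left /=; apply: L; lia.
  have E4 : X (i, j) (i - 1, j - 1) = X (i, j) (i, j - 1).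
    by rewrite stepL //; congr X; rewrite /left /=; apply: L; lia.
  by case/adjTE => [[]->|[]->] //=; rewrite -?E4 -?E3 -?E2 -?E1 -?E0.
by move=> h h'; rewrite (H _ h) (H _ h').
Qed.

(** * Cycles through an edge separate the ends of its interface *)

Section Jordan.
Variables (W : eqType) (l : cell -> W) (u v : W) (st1 st2 : seq state).
Hypothesis uv : u != v.
Hypothesis fin1 : forall q, isst l u v q -> q \in st1.
Hypothesis fin2 : forall q, isst l v u q -> q \in st2.

Definition uvfree a b := adjT a b && ~~ uvstep l u v a b.
Definition common a :=
  (exists2 b, adjT a b & l b = u) /\ (exists2 b, adjT a b & l b = v) /\ l a != u /\ l a != v.

Lemma stop_common p : isst l u v p -> stop l u v p -> common (left p.1 p.2).
Proof.
case: p => c d /= /and3P[cd /eqP lc /eqP ld] /andP[nu nv].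
have /andP[h1 h2] := adjT_left cd.
by split; [exists c|split; [exists d|]] => //; rewrite adjT_sym.
Qed.

(* A closed walk using the edge [(c0, d0)] once separates the two ends of the interface
   between the regions of labels [u] and [v] that contains this edge. *)
Lemma interface_separated c0 d0 : adjT c0 d0 -> l c0 = u -> l d0 = v ->
  (forall s, path uvfree d0 s -> last d0 s <> c0) \/
  exists x y, [/\ common x, common y & forall s, path uvfree d0 s -> last d0 s = c0 ->
    forall A : cell -> Prop, connT A -> (forall a, A a -> a \notin d0 :: s) -> A x -> ~ A y].
Proof.
move=> cd lc ld.
have dc : adjT d0 c0 by rewrite adjT_sym.
have i1 : isst l u v (c0, d0) by rewrite /isst /= cd lc ld !eqxx.
have i2 : isst l v u (d0, c0) by rewrite /isst /= dc lc ld !eqxx.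
have uv' : v != u by rewrite eq_sym.
(* Closed up by the edge from [c0] to [d0], the walk uses this interface edge once and no other. So
   the others are transparent and the two sides of this one differ. *)
have closed s : path uvfree d0 s -> last d0 s = c0 ->
  exists X, [/\ sides X, transparent l u v X (c0, d0), transparent l v u X (d0, c0),
    X c0 d0 != X d0 c0 & forall c d d', c \notin d0 :: s -> adjT c d -> adjT c d' ->
       X c d = X c d' /\ X c d = X d c].
  move=> ps ls.
  have ps' : path adjT c0 (d0 :: s) by rewrite /= cd (sub_path _ ps) // => a b /andP[].
  have ls' : last c0 (d0 :: s) = c0 by [].
  have [X sX hX] := closed_walk_sides ps' ls'.
  have par c d : uvstep l u v c d -> walkx (same_edge c d) c0 (d0 :: s) = same_edge c d c0 d0.
    move=> hcd /=; rewrite (eq_walkx ps (g := fun _ _ => false)).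
      by rewrite walkx_false addbF.
    move=> a b /andP[_ /negP nab]; apply/negP => /orP[]/andP[/eqP aE /eqP bE]; apply: nab.
      by rewrite aE bE.
    by move: hcd; rewrite /uvstep aE bE orbC ![(l d == _) && _]andbC.
  have mem0 a : a \notin d0 :: s -> a \notin c0 :: d0 :: s.
    by move=> ha; rewrite inE negb_or ha andbT; apply: contraNneq ha => ->; rewrite -ls mem_last.
  exists X; split => //.
  - move=> c d cd' lc' ld' ne; apply/eqP; rewrite -negb_add hX // par ?/uvstep ?lc' ?ld' ?eqxx //.
    rewrite /same_edge; apply/norP; split.
      by apply: contra ne => /andP[/eqP <- /eqP <-].
    by apply: contra uv => /andP[/eqP E _]; rewrite -ld' -E lc.
  - move=> c d cd' lc' ld' ne; apply/eqP; rewrite -negb_add hX // par ?/uvstep ?lc' ?ld' ?eqxx ?orbT //.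
    rewrite /same_edge; apply/norP; split.
      by apply: contra uv => /andP[/eqP E _]; rewrite -lc' -E lc.
    by apply: contra ne => /andP[/eqP <- /eqP <-].
  - by rewrite -negb_add negbK hX // par ?/uvstep ?lc ?ld ?eqxx // /same_edge !eqxx.
  - move=> c d d' cs h h'; split; first exact: (side_const sX hX (mem0 _ cs)).
    by apply/eqP; rewrite -negb_add hX // walkx_out // mem0.
have [[q1 [iq1 sq1] hq1]|loop] := interface_end uv i1 fin1; last first.
  left => s ps ls; have [X [sX t1 _ /eqP ne _]] := closed s ps ls.
  by apply: ne; apply: (loop X).
have [[q2 [iq2 sq2] hq2]|loop] := interface_end uv' i2 fin2; last first.
  left => s ps ls; have [X [sX _ t2 /eqP ne _]] := closed s ps ls.
  by apply: ne; rewrite (loop X).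
right; exists (left q1.1 q1.2), (left q2.1 q2.2); split.
- exact: stop_common.
- case: q2 iq2 sq2 {hq2} => c d /= /and3P[cd' /eqP lc' /eqP ld'] /andP[nv nu].
  have /andP[h1 h2] := adjT_left cd'.
  by split; [exists d|split; [exists c|]] => //; rewrite adjT_sym.
move=> s ps ls A cA As Ax Ay.
have [X [sX t1 t2 /eqP ne off]] := closed s ps ls; apply: ne.
rewrite -[X c0 d0](hq1 X) // -[X d0 c0](hq2 X) //.
have lft c d : adjT c d -> X c d = X (left c d) c /\ adjT (left c d) c.
  move=> h; have /andP[h1 h2] := adjT_left h.
  by rewrite (sX c d) // (sX d _) // left_left adjT_sym h1.
have /and3P[/lft[-> a1] _ _] := iq1; have /and3P[/lft[-> a2] _ _] := iq2.
(* Along a connected set off the walk all triangles lie on one side, whereas [hq1] and [hq2] put the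
   two ends on different sides. *)
pose val x (t : bool) := forall y, adjT x y -> X x y = t.
have -> // : val (left q2.1 q2.2) (X (left q1.1 q1.2) q1.1).
apply: (cA (fun x => val x (X (left q1.1 q1.2) q1.1)) _ _ _ Ax Ay).
- move=> a b Aa Ab ab va y bay.
  have ba : adjT b a by rewrite adjT_sym.
  have [-> _] := off b y a (As _ Ab) bay ba.
  by have [_ ->] := off b a a (As _ Ab) ba ba; apply: va.
- by move=> y hy; have [-> _] := off _ y q1.1 (As _ Ax) hy a1.
Qed.
End Jordan.
End Lattice.

(** * Adjacency graphs of lattice partitions *)

Lemma row_move (A P : cell -> Prop) j : (forall a b, A a -> A b -> adjT a b -> P a -> P b) ->
  (forall i, A (i, j)) -> forall i i', P (i, j) -> P (i', j).
Proof.
move=> hP hA.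
have step i (n : nat) : P (i, j) -> P (i + n%:Z, j) /\ P (i - n%:Z, j).
  move=> p; elim: n => [|n [IH1 IH2]]; first by rewrite !addr0.
  by split; [apply: (hP (i + n%:Z, j))|apply: (hP (i - n%:Z, j))] => //;
    rewrite /adjT xpair_eqE /=; lia.
move=> i i' p; have [h1 h2] := step i `|(i' - i)%R|%N p; case: (leP i i') => h.
  by have -> : i' = i + `|(i' - i)%R|%N%:Z by lia.
by have -> : i' = i - `|(i' - i)%R|%N%:Z by lia.
Qed.

Lemma col_move (A P : cell -> Prop) i : (forall a b, A a -> A b -> adjT a b -> P a -> P b) ->
  (forall j, A (i, j)) -> forall j j', P (i, j) -> P (i, j').
Proof.
move=> hP hA.
have step j (n : nat) : P (i, j) -> P (i, j + n%:Z) /\ P (i, j - n%:Z).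
  move=> p; elim: n => [|n [IH1 IH2]]; first by rewrite !addr0.
  by split; [apply: (hP (i, j + n%:Z))|apply: (hP (i, j - n%:Z))] => //;
    rewrite /adjT xpair_eqE /=; lia.
move=> j j' p; have [h1 h2] := step j `|(j' - j)%R|%N p; case: (leP j j') => h.
  by have -> : j' = j + `|(j' - j)%R|%N%:Z by lia.
by have -> : j' = j - `|(j' - j)%R|%N%:Z by lia.
Qed.

Lemma connT_all : connT (fun=> True).
Proof.
move=> P hP [a1 a2] [b1 b2] _ _.
move=> pa; apply: (@col_move (fun=> True) P b1 hP _ a2 b2) => //.
exact: (@row_move (fun=> True) P a2 hP _ a1 b1).
Qed.

Definition nbT (c : cell) : seq cell :=
  [:: (c.1 + 1, c.2); (c.1 + 1, c.2 + 1); (c.1, c.2 + 1);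
      (c.1 - 1, c.2); (c.1 - 1, c.2 - 1); (c.1, c.2 - 1)].

Lemma nbTP c d : adjT c d -> d \in nbT c.
Proof. by case/adjTE => [[]->|[]->]; rewrite !inE eqxx ?orbT. Qed.

Section Planar.
Variable W : finType.
Implicit Types (S U : {set W}) (e r : rel W) (x y z u v w : W).

Definition touch (l : cell -> W) x y := exists c d, [/\ adjT c d, l c = x & l d = y].

(* [e] is the adjacency graph of a partition of the lattice into finitely many connected
   regions indexed by [S], all but one of them finite. *)
Definition planar S e := exists l : cell -> W,
  [/\ forall x, connT (fun c => l c = x),
      forall x, x \in S <-> exists c, l c = x,
      forall x y, e x y <-> x != y /\ touch l x y &
      exists z0 (b : seq cell), forall c, c \notin b -> l c = z0].

Lemma planar_eq S e S' e' : S = S' -> e =2 e' -> planar S e -> planar S' e'.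
Proof.
by move=> <- ee [l [h1 h2 h3 h4]]; exists l; split => // x y; rewrite -ee; apply: h3.
Qed.

Lemma planar_sym S e : planar S e -> symmetric e.
Proof.
move=> [l [_ _ h _]] x y; apply/idP/idP => /h[ne [c [d [cd lc ld]]]]; apply/h;
  by split; [rewrite eq_sym|exists d, c; rewrite adjT_sym].
Qed.

Lemma planar_irr S e : planar S e -> irreflexive e.
Proof. by move=> [l [_ _ h _]] x; apply/negP => /h[]; rewrite eqxx. Qed.

Lemma planar_mem S e x y : planar S e -> e x y -> x \in S.
Proof. by move=> [l [_ h2 h _]] /h[_ [c [d [cd lc ld]]]]; apply/h2; exists c. Qed.

Lemma planar_connect S e x y : planar S e -> x \in S -> y \in S -> connect e x y.
Proof.
move=> [l [_ h2 h _]] /h2[c <-] /h2[d <-].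
apply: (connT_all (P := fun d => connect e (l c) (l d)) _ (a := c)) => // a b _ _ ab ca.
apply: connect_trans ca _; case: (eqVneq (l a) (l b)) => [->|ne]; first exact: connect0.
by apply: connect1; apply/h; split => //; exists a, b.
Qed.

Section Label.
Variables (l : cell -> W) (S : {set W}) (e : rel W).
Hypothesis cl : forall x, connT (fun c => l c = x).
Hypothesis Sl : forall x, x \in S <-> exists c, l c = x.
Hypothesis el : forall x y, e x y <-> x != y /\ touch l x y.

(** Inside each region walk to a contact with the next region. *)
Lemma lift_path r x s c d : subrel r e -> path r x s -> l c = x -> l d = last x s ->
  exists t, [/\ path (fun a b => adjT a b && ((l a == l b) || r (l a) (l b))) c t,
     last c t = d & forall a, a \in c :: t -> l a \in x :: s].
Proof.
move=> sub; elim: s x c => [|y s IH] x c /= ps lc ld.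
  have [t [pt lt ht]] := connT_path (@cl x) lc ld.
  exists t; split => //; last by move=> a /ht ->; rewrite mem_head.
  elim: t c pt ht {lt lc} => //= b t IHt c /andP[cb pt] ht; rewrite cb /=.
  rewrite (ht c) ?mem_head // (ht b) ?eqxx ?inE ?eqxx ?orbT //=.
  by apply: IHt => // a ha; apply: ht; rewrite inE ha orbT.
case/andP: ps => rxy ps; have /el[ne [a [b [ab la lb]]]] := sub _ _ rxy.
have [t [pt lt ht]] := connT_path (@cl x) lc la.
have [t' [pt' lt' ht']] := IH y b ps lb ld.
exists (t ++ b :: t'); split.
- rewrite cat_path /= lt ab la lb rxy orbT /= pt' andbT.
  elim: t c pt ht {lt lc} => //= b' t IHt c /andP[cb pt] ht; rewrite cb /=.
  rewrite (ht c) ?mem_head // (ht b') ?eqxx ?inE ?eqxx ?orbT //=.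
  by apply: IHt => // a' ha; apply: ht; rewrite inE ha orbT.
- by rewrite last_cat.
- move=> a'; rewrite -cat_cons mem_cat => /orP[/ht ->|/ht' h]; first exact: mem_head.
  by rewrite inE h orbT.
Qed.

Lemma connT_union r (A : W -> Prop) : subrel r e -> (forall x y, r x y -> A x -> A y) ->
  (forall x y, x \in S -> y \in S -> A x -> A y -> connect r x y) -> connT (fun c => A (l c)).
Proof.
move=> sub rA cA P hP a b Aa Ab Pa.
have /connectP[s ps ls] : connect r (l a) (l b) by apply: cA => //; apply/Sl; [exists a|exists b].
have fib c d : l c = l d -> A (l c) -> P c -> P d.
  move=> cd Ac Pc.
  apply: (@cl (l c) P _ c d) => // c' d' lc ld cd' Pc'.
  by apply: (hP c' d') => //; rewrite ?lc ?ld.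
suff H : forall x c, l c = x -> A x -> P c -> path r x s -> l b = last x s -> P b.
  exact: (H (l a) a).
elim: s {ps ls} => [|y s IH] x c lc Ax Pc /=.
  by move=> _ lb; apply: (fib c b) => //; rewrite lc.
case/andP=> rxy ps ls; have /el[ne [a' [b' [ab la lb]]]] := sub _ _ rxy.
have Pa' : P a' by apply: (fib c); rewrite ?lc.
have Ay : A y by apply: rA rxy _.
by apply: (IH y b') => //; apply: (hP a' b') => //; rewrite ?la ?lb.
Qed.
End Label.

(** The path [s] closes a cycle through [u v], which separates [p] from [q]. The two may coincide; a
    singleton [A] then shows that every such cycle passes through [p]. *)
Lemma planar_interface S e u v : planar S e -> e u v ->
  (~~ connect (rmE e u v) v u) \/
  exists p q, [/\ e u p && e v p, e u q && e v q &
    forall s, path (rmE e u v) v s -> last v s = u -> forall r (A : pred W), subrel r e ->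
      (forall x y, r x y -> A x -> A y) -> (forall x y, A x -> A y -> connect r x y) ->
      (forall x, A x -> x \notin v :: s) -> A p -> ~ A q].
Proof.
move=> pl euv; have es := planar_sym pl.
case: pl => l [cl Sl el [z0 [b hb]]].
have [ne [c0 [d0 [cd lc ld]]]] := (el u v).1 euv.
(* Outside [b] there is a single label, so each contact of two regions has one cell in [b] and the
   other in [b']; this makes the states finite in number. *)
pose b' := b ++ flatten (map nbT b).
pose st := [seq (c, d) | c <- b', d <- b'].
have fin u' v' : u' != v' -> forall q, isst l u' v' q -> q \in st.
  move=> ne' [c d] /and3P[/= cd' /eqP lc' /eqP ld'].
  have nb a a' : adjT a a' -> a \in b -> (a \in b') && (a' \in b').
    move=> aa ab; rewrite !mem_cat ab /=; apply/orP; right.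
    by apply/flatten_mapP; exists a => //; apply: nbTP.
  have : (c \in b) || (d \in b).
    apply: contraR ne' => /norP[/hb hc /hb hd]; by rewrite -lc' -ld' hc hd.
  have dc' : adjT d c by rewrite adjT_sym.
  by case/orP => [/(nb _ _ cd')|/(nb _ _ dc')] /andP[h1 h2]; apply: allpairs_f.
have ne' : v != u by rewrite eq_sym.
have lift s : path (rmE e u v) v s -> last v s = u ->
    exists t, [/\ path (uvfree l u v) d0 t, last d0 t = c0 & forall a, a \in d0 :: t -> l a \in v :: s].
  move=> ps ls; have sub : subrel (rmE e u v) e by move=> x y /andP[].
  have [t [pt lt ht]] := lift_path cl el sub ps ld (etrans lc (esym ls)).
  exists t; split => //; apply: sub_path pt => a a' /andP[aa h]; rewrite /uvfree aa /=.
  case/orP: h => [/eqP E|/andP[_ h]]; rewrite /uvstep.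
    by rewrite E; apply/negP => /orP[]/andP[/eqP h1 /eqP h2]; move: ne; rewrite -h1 -h2 eqxx.
  by apply: contra h => /orP[]/andP[-> ->]; rewrite ?orbT.
have [loop|[x [y [cx cy sep]]]] := interface_separated ne (fin _ _ ne) (fin _ _ ne') cd lc ld.
  left; apply/negP => /connectP[s ps ls].
  by have [t [pt lt _]] := lift s ps (esym ls); apply: (loop t pt).
have com (z : cell) : common l u v z -> e u (l z) && e v (l z).
  move=> [[a az la] [[a' az' la'] [nu nv]]]; apply/andP; split; apply/el; split;
   rewrite 1?eq_sym //; [exists a, z|exists a', z]; by rewrite adjT_sym.
right; exists (l x), (l y); split; rewrite ?com // => s ps ls r A sub rA cA As Ax Ay.
have [t [pt lt ht]] := lift s ps ls.
apply: (sep t pt lt (fun c => A (l c))) => //.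
  by apply: (connT_union (r := r) cl Sl el (A := fun x => A x)) => // x' y' _ _; apply: cA.
by move=> a /As; apply: contra => /ht.
Qed.

(** * Separating triangles, and contraction *)

Definition avoid (K : {set W}) e : rel W := fun x y => [&& e x y, x \notin K & y \notin K].

Lemma avoid_sym K e : symmetric e -> symmetric (avoid K e).
Proof. by move=> es x y; rewrite /avoid es [(y \notin K) && _]andbC. Qed.

Lemma connect_avoid K e x y : connect (avoid K e) x y -> x \notin K -> y \notin K.
Proof.
by case/connectP; elim/last_ind => [|s z _]; [move=> _ -> | rewrite rcons_path last_rcons => /andP[_ /and3P[_ _ zK]] -> ].
Qed.

(* [p] and [q] are the two ends of the interface between the regions [u] and [v]. *)
Lemma planar_chord S e u v b0 : planar S e -> e u v -> e u b0 -> e v b0 ->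
  exists p q, [/\ e u p && e v p, e u q && e v q & forall b, e u b -> e v b ->
    b != p -> b != q -> ~~ connect (avoid [set u; v; b] e) p q].
Proof.
move=> pl euv eub0 evb0; have es := planar_sym pl; have ei := planar_irr pl.
have ene x y : e x y -> x != y by apply: contraTneq => ->; rewrite ei.
have ps b : e u b -> e v b -> path (rmE e u v) v [:: b; u].
  move=> eub evb; have nub := ene _ _ eub; have nvb := ene _ _ evb; have nuv := ene _ _ euv.
  rewrite /= /rmE evb [e b u]es eub ![b == _]eq_sym (negPf nub) (negPf nvb).
  by rewrite ?andbF ?andbT.
have [/negP h|[p [q [hp hq sep]]]] := planar_interface pl euv.
  by case: h; apply/connectP; exists [:: b0; u]; rewrite ?ps.
exists p, q; split => // b eub evb bp bq; apply/negP => pq.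
have csym := sym_connect_sym (avoid_sym [set u; v; b] es).
apply: (sep [:: b; u] (ps b eub evb) (erefl _) (avoid [set u; v; b] e) (connect (avoid [set u; v; b] e) p)) => //.
- by move=> x y /and3P[].
- by move=> x y xy px; apply: connect_trans px (connect1 xy).
- by move=> x y px py; apply: connect_trans py; rewrite csym.
- move=> x /connect_avoid; rewrite !inE !negb_or => h.
  case/andP: hp => /ene up /ene vp.
  have /andP[/andP[xu xv] xb] : (x != u) && (x != v) && (x != b).
    by apply: h; rewrite ![p == _]eq_sym up vp bp.
  by rewrite xu xv xb.
Qed.

Definition com e u v : {set W} := [set x | e u x && e v x].

(** Unless [u v] is a bridge, both ends of its interface are the unique common neighbour, and a path
    avoiding it would separate it from itself. *)
Lemma planar_split S e u v : planar S e -> e u v -> (#|com e u v| <= 1)%N ->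
  ~~ connect (avoid (com e u v) (rmE e u v)) v u.
Proof.
move=> pl euv c1; have es := planar_sym pl; have ei := planar_irr pl.
have vC : v \notin com e u v by rewrite inE ei andbF.
have [h|[p [q [hp hq sep]]]] := planar_interface pl euv.
  apply: contra h; apply: connect_sub => x y /and3P[h _ _]; exact: connect1.
apply/negP => /connectP[s ps ls].
have {}hp : p \in com e u v by rewrite inE.
have {}hq : q \in com e u v by rewrite inE.
have pq : p = q by move/card_le1_eqP: c1; apply.
rewrite -pq in sep.
apply: (sep s _ (esym ls) (fun _ _ => false) (pred1 p)) => //=.
- by apply: sub_path ps => x y /and3P[].
- by move=> x y /eqP -> /eqP ->; apply: connect0.
- move=> x /eqP ->; rewrite inE negb_or; apply/andP; split.
    by apply: contraTneq hp => ->.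
  apply: contraL hp => ps'.
  have H t : path (avoid (com e u v) (rmE e u v)) t s -> p \in s -> p \notin com e u v.
    elim: (s) t => //= y s' IH t /andP[/and3P[_ _ yC] ps''].
    by rewrite inE => /predU1P[->|]; [|apply: IH ps''].
  exact: H ps ps'.
Qed.

Definition quot (f : W -> W) e : rel W :=
  fun a b => (a != b) && [exists x, exists y, [&& e x y, f x == a & f y == b]].

(** Merging regions whose union is connected gives again a partition into connected regions. *)
Lemma planar_quot S e (f : W -> W) : planar S e ->
  (forall x y, x \in S -> y \in S -> f x = f y ->
     connect (fun a b => [&& e a b, f a == f x & f b == f x]) x y) ->
  planar (f @: S) (quot f e).
Proof.
move=> [l [cl Sl el [z0 [b hb]]]] hf; exists (fun c => f (l c)); split.
- move=> t.
  apply: (connT_union (r := fun a b => [&& e a b, f a == t & f b == t]) cl Sl el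
    (A := fun x => f x = t)).
  + by move=> x y /and3P[].
  + by move=> x y /and3P[_ _ /eqP].
  + by move=> x y xS yS fx fy; rewrite -fx; apply: hf => //; rewrite fx fy.
- move=> t; split => [/imsetP[x /Sl[c lc] ->]|[c <-]]; first by exists c; rewrite lc.
  by apply: imset_f; apply/Sl; exists c.
- move=> a a'; split.
    case/andP => ne /existsP[x /existsP[y /and3P[/el[_ [c [d [cd lc ld]]]] /eqP fx /eqP fy]]].
    by split => //; exists c, d; rewrite lc ld.
  move=> [ne [c [d [cd lc ld]]]]; rewrite /quot ne /=.
  apply/existsP; exists (l c); apply/existsP; exists (l d); rewrite lc ld !eqxx !andbT.
  apply/el; split; last by exists c, d.
  by apply: contraNneq ne => E; rewrite -lc -ld E.
- by exists (f z0), b => c /hb ->.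
Qed.

(* Contracting [U] along [f] without creating new adjacencies. *)
Lemma planar_retract S e U (f : W -> W) : planar S e ->
  (forall x, x \notin U -> f x = x) ->
  (forall x, x \in U -> x \in S -> [/\ f x \notin U, f x \in S &
     connect (fun a b => [&& e a b, f a == f x & f b == f x]) x (f x)]) ->
  (forall x y, e x y -> f x != f y -> e (f x) (f y)) ->
  planar (S :\: U) (avoid U e).
Proof.
move=> pl f1 f2 f3; have es := planar_sym pl.
have fin x : x \in S -> (f x \notin U) && (f x \in S) /\
     connect (fun a b => [&& e a b, f a == f x & f b == f x]) x (f x).
  move=> xS; case: (boolP (x \in U)) => xU; first by have [-> -> ->] := f2 x xU xS.
  by rewrite f1 // xU xS; split => //; rewrite f1 // connect0.
apply: (planar_eq (S := f @: S) (e := quot f e)); last first.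
- apply: planar_quot => // x y xS yS fxy.
  have [_ h1] := fin x xS; have [_ h2] := fin y yS.
  apply: connect_trans h1 _.
  rewrite (sym_connect_sym (e := fun a b => [&& e a b, f a == f x & f b == f x])).
    by rewrite fxy.
  by move=> a b; rewrite es; congr andb; rewrite andbC.
- move=> a b; apply/andP/and3P.
    move=> [ne /existsP[x /existsP[y /and3P[exy /eqP fx /eqP fy]]]].
    have [/andP[aU _] _] := fin x (planar_mem pl exy).
    have eyx : e y x by rewrite es.
    have [/andP[bU _] _] := fin y (planar_mem pl eyx).
    by rewrite -fx -fy; split => //; apply: f3 => //; rewrite fx fy.
  move=> [eab aU bU]; split; first by apply: contraTneq eab => ->; rewrite (planar_irr pl).
  by apply/existsP; exists a; apply/existsP; exists b; rewrite eab !f1 ?eqxx.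
- apply/setP => x; rewrite inE; apply/imsetP/andP => [[y yS ->]|[xU xS]].
    by have [/andP[]] := fin y yS.
  by exists x; rewrite ?f1.
Qed.

Lemma planar_contract S e U t : planar S e -> t \in S -> t \notin U ->
  (forall x, x \in U -> x \in S -> connect (fun a b => [&& e a b, (a \in U) || (a == t) & (b \in U) || (b == t)]) x t) ->
  (forall x y, x \in U -> y \notin U -> y != t -> e x y -> e t y) ->
  planar (S :\: U) (avoid U e).
Proof.
move=> pl tS tU h1 h2.
pose f x := if x \in U then t else x.
have fE a : (f a == t) = (a \in U) || (a == t) by rewrite /f; case: ifP => //=; rewrite eqxx.
apply: (planar_retract (f := f)) => //.
- by move=> x /negPf xU; rewrite /f xU.
- move=> x xU xS; have fx : f x = t by rewrite /f xU.
  rewrite fx; split => //.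
  apply: (connect_sub _ (h1 x xU xS)) => a b /and3P[ab ha hb]; apply: connect1.
  by rewrite ab !fE ha hb.
- move=> x y exy; rewrite /f; case: ifPn => xU; case: ifPn => yU //; rewrite ?eqxx //.
    by move=> ty; apply: h2 exy => //; rewrite eq_sym.
  by move=> xt; rewrite (planar_sym pl); apply: (h2 y x) => //; rewrite (planar_sym pl).
Qed.
End Planar.

(** * The induction *)

Section Induction.
Variable W : finType.
Implicit Types (S U K : {set W}) (e r : rel W) (x y z u v w t : W) (m : {ffun W -> int}).

Lemma rmE_sym e a b : symmetric e -> symmetric (rmE e a b).
Proof.
by move=> es x y; rewrite /rmE es orbC ![(y == _) && _]andbC.
Qed.
Lemma rmV_sym e z : symmetric e -> symmetric (rmV e z).
Proof. by move=> es x y; rewrite /rmV es [(y != _) && _]andbC. Qed.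
Lemma rmE_irr e a b : irreflexive e -> irreflexive (rmE e a b).
Proof. by move=> ei x; rewrite /rmE ei. Qed.
Lemma rmV_irr e z : irreflexive e -> irreflexive (rmV e z).
Proof. by move=> ei x; rewrite /rmV ei. Qed.
Lemma rmEC e a b : rmE e a b =2 rmE e b a.
Proof. by move=> x y; rewrite /rmE orbC. Qed.

(** A path from [U] to [t] can be cut short where it leaves [U], since its last vertex in [U] is
    adjacent to [t]. So [U] contracts into [t], and the neighbours thus gained were neighbours of
    [t] already. *)
Lemma planar_absorb S e U t : planar S e -> t \in S -> t \notin U ->
  (forall x y, x \in U -> y \notin U -> y != t -> e x y -> e x t && e t y) ->
  planar (S :\: U) (avoid U e).
Proof.
move=> pl tS tU h; apply: (planar_contract pl tS tU); last first.
  by move=> x y xU yU yt /(h x y xU yU yt) /andP[].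
move=> x xU xS; have /connectP[s ps ls] := planar_connect pl xS tS.
elim: s x xU {xS} ps ls => [|y s IH] x xU /=.
  by move=> _ E; rewrite E xU in tU.
case/andP=> exy ps ls.
have [yt|yt] := eqVneq y t; first by apply: connect1; rewrite -yt exy xU eqxx orbT.
case: (boolP (y \in U)) => yU.
  by apply: connect_trans (IH y yU ps ls); apply: connect1; rewrite exy xU yU.
by have /andP[ext _] := h x y xU yU yt exy; apply: connect1; rewrite ext xU eqxx orbT.
Qed.

(** The components of [U] go one by one: each is contracted into some adjacent [t] in [K], and its
    other outside neighbours lie in [K], hence are adjacent to [t] already. *)
Lemma planar_clique S e U K : planar S e -> K \subset S -> K != set0 ->
  {in K &, forall a b, a != b -> e a b} -> [disjoint U & K] ->
  (forall x y, x \in U -> y \notin U -> e x y -> y \in K) ->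
  planar (S :\: U) (avoid U e).
Proof.
move: {2}(#|U|) (leqnn #|U|) => n; elim: n S e U => [|n IH] S e U hn pl KS K0 Kc dis cl.
  have U0 : U = set0 by apply/eqP; rewrite -cards_eq0 -leqn0.
  apply: (planar_eq _ _ pl); first by rewrite U0 setD0.
  by move=> x y; rewrite /avoid U0 !inE !andbT.
have es := planar_sym pl.
case: (set_0Vmem (U :&: S)) => [US0|[x0]].
  apply: (planar_eq _ _ pl).
    by apply/setP => x; have /setP/(_ x) := US0; rewrite !inE; case: (x \in U); case: (x \in S).
  move=> x y; rewrite /avoid; case: (boolP (e x y)) => //= exy.
  have xS := planar_mem pl exy; rewrite es in exy; have yS := planar_mem pl exy.
  by have /setP/(_ x) := US0; have /setP/(_ y) := US0; rewrite !inE xS yS !andbT => -> ->.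
rewrite inE => /andP[x0U x0S].
have [k kK] := set0Pn _ K0; have kS := subsetP KS _ kK.
have [x [t [xU tK ext]]] : exists x t, [/\ x \in U, t \in K & e x t].
  have /connectP[s ps ls] := planar_connect pl x0S kS.
  elim: s x0 x0U {x0S} ps ls => [|y s IHs] x xU /=.
    by move=> _ E; move: dis; rewrite disjoint_subset => /subsetP/(_ _ xU); rewrite inE -E kK.
  case/andP=> exy ps ls; case: (boolP (y \in U)) => yU; first exact: IHs ps ls.
  by exists x, y; split => //; apply: cl exy.
have tU : t \notin U by move: dis; rewrite disjoint_sym disjoint_subset => /subsetP/(_ _ tK); rewrite inE.
have tS := subsetP KS _ tK.
pose r := avoid (~: U) e.
have rs : symmetric r := avoid_sym (~: U) es.
pose U' := [set y | connect r x y].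
have U'U : U' \subset U.
  by apply/subsetP => y; rewrite inE => /connect_avoid; rewrite !inE !negbK; apply.
have xU' : x \in U' by rewrite inE connect0.
have cl' a b : a \in U' -> b \notin U' -> e a b -> b \in K.
  move=> aU' bU' eab; have aU := subsetP U'U _ aU'.
  apply: (cl a) => //; apply: contra bU' => bU.
  rewrite inE; rewrite inE in aU'; apply: connect_trans aU' _; apply: connect1.
  by rewrite /r /avoid eab !inE !negbK aU bU.
have pl' : planar (S :\: U') (avoid U' e).
  apply: (planar_contract pl tS).
  - by apply: contra tU => /(subsetP U'U).
  - move=> y; rewrite inE => xy yS.
    apply: (@connect_trans _ _ x); last by apply: connect1; rewrite ext xU' eqxx orbT.
    have := xy; rewrite (sym_connect_sym rs) => /connectP[s ps ls].
    apply/connectP; exists s => //.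
    elim: s y xy {ls yS} ps => //= b s IHs a xa /andP[rab ps].
    have xb : connect r x b by apply: connect_trans xa (connect1 rab).
    rewrite (IHs b) // andbT; case/and3P: rab => -> _ _.
    by rewrite !inE xa xb.
  - by move=> a b aU' bU' bt eab; apply: Kc => //; [apply: cl' eab|rewrite eq_sym].
have := IH (S :\: U') (avoid U' e) (U :\: U').
move=> /(_ _ pl' _ K0) H.
have {H} := H _ _ _ _ _; move=> H.
apply: (planar_eq _ _ (H _ _ _ _ _)).
- apply/setP => y; rewrite !inE; have := subsetP U'U y; rewrite !inE.
  by case: (connect r x y) => [/(_ isT) ->|_] //=.
- have sub y : connect r x y ==> (y \in U).
    by apply/implyP => h; apply: (subsetP U'U); rewrite inE.
  move=> a b; rewrite /avoid !inE; move: (sub a) (sub b).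
  by case: (connect r x a); case: (connect r x b); case: (a \in U); case: (b \in U); case: (e a b).
- have : (#|U :\: U'| < #|U|)%N.
    by apply: proper_card; apply/properP; split; [apply: subsetDl|exists x; rewrite ?inE // connect0].
  by move=> h; rewrite -ltnS; apply: leq_trans h hn.
- apply/subsetP => y yK; rewrite !inE (subsetP KS _ yK) andbT.
  apply: contraL yK => h.
  have : y \in U by apply: (subsetP U'U); rewrite inE.
  by move=> yU; move: dis; rewrite disjoint_subset => /subsetP/(_ _ yU).
- move=> a b aK bK ab; rewrite /avoid Kc //=.
  have out y : y \in K -> y \notin U'.
    move=> yK; apply: contraL yK => /(subsetP U'U) yU.
    by move: dis; rewrite disjoint_subset => /subsetP/(_ _ yU).
  by rewrite !out.
- by apply: disjointWl dis; apply: subsetDl.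
- move=> a b; rewrite !inE => /andP[na aU] nb /and3P[eab _ nb'].
  apply: (cl a) => //; apply: contra nb => bU; rewrite bU andbT.
  by rewrite inE in nb'.
Qed.

(** * The four statements proved by simultaneous induction *)

Definition nice_edge e := forall v1 v2, e v1 v2 ->
  exists m, [/\ nz (rmE e v1 v2) m, m v1 = 0, m v2 = 0 & forall x, m x <= 4].
Definition nice_root S e := forall v, v \in S ->
  exists m, [/\ nz e m, m v = 0 & forall x, m x <= 4].
(** The vertex [z] plays the outer face, so its neighbours are the boundary vertices; the [outer]
    statements below delete [z]. *)
Definition cap e z x : int := if e z x then 2 else 4.
Definition nice_outer_edge e := forall z v1 v2, e z v1 -> e z v2 -> e v1 v2 ->
  exists m, [/\ nz (rmE (rmV e z) v1 v2) m, m v1 = 0, m v2 = 0 & forall x, m x <= cap e z x].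
Definition nice_outer_root e := forall z v, e z v ->
  exists m, [/\ nz (rmV e z) m, m v = 0 & forall x, m x <= cap e z x].

Lemma nice_root_step S e : planar S e -> nice_edge e -> nice_root S e.
Proof.
move=> pl hA v vS; have es := planar_sym pl; have ei := planar_irr pl.
have [w evw|nov] := pickP (e v).
  have [m [nm mv mw m4]] := hA v w evw.
  have wv : w != v by apply: contraTneq evw => ->; rewrite ei.
  have ewv : e w v by rewrite es.
  exists (m + delta w); split.
  - exact: nz_root (eq_nz (rmEC e v w) nm) mv.
  - by rewrite monD deltaE mv eq_sym (negPf wv).
  - move=> x; rewrite monD deltaE; have := m4 x; case: eqP => [->|_]; rewrite ?mw; lia.
exists 0; split; rewrite ?mon0 //; last by move=> x; rewrite mon0.
apply: nz0 => x y; apply/negP => exy.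
have /connectP[[|y' s] /=] := planar_connect pl vS (planar_mem pl exy).
  by move=> _ E; rewrite E nov in exy.
by rewrite nov.
Qed.

(** By [planar_split] the edge is a bridge. Each side remains after the other one has been absorbed
    into the end of the bridge on the side that is kept. *)
Lemma bridge S e u v : planar S e -> e u v -> com e u v = set0 ->
  exists S1 : {set W}, [/\ u \in S1, v \notin S1, S1 \subset S,
    planar S1 (avoid (S :\: S1) e) /\ planar (S :\: S1) (avoid S1 e) &
    forall x y, e x y -> rmE e u v x y = ((x \in S1) == (y \in S1))].
Proof.
move=> pl euv c0; have es := planar_sym pl; have ei := planar_irr pl.
have evu : e v u by rewrite es.
have := planar_split pl euv; rewrite c0 cards0 => /(_ isT) ns.
have {}ns : ~~ connect (rmE e u v) v u.
  apply: contra ns; rewrite (eq_connect (e' := avoid set0 (rmE e u v))) // => x y.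
  by rewrite /avoid !inE !andbT.
have rs := rmE_sym u v es; have cs := sym_connect_sym rs.
pose S1 := [set x | connect (rmE e u v) u x].
have uS := planar_mem pl euv; have vS := planar_mem pl evu.
have uS1 : u \in S1 by rewrite inE connect0.
have vS1 : v \notin S1 by rewrite inE cs.
have S1S : S1 \subset S.
  apply/subsetP => x; rewrite inE cs => /connectP[[|y s] /=]; first by move=> _ <-.
  by case/andP => /andP[exy _] _ _; apply: planar_mem exy.
have E x y : e x y -> rmE e u v x y = ((x \in S1) == (y \in S1)).
  move=> exy; apply/idP/idP => [rxy|].
    apply/eqP; rewrite !inE; apply/idP/idP => h; apply: connect_trans h (connect1 _) => //.
    by rewrite rs.
  apply: contraLR; rewrite /rmE exy negbK /= => /orP[]/andP[/eqP -> /eqP ->];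
   by rewrite uS1 (negPf vS1).
have cross x y : e x y -> x \in S1 -> y \notin S1 -> x = u /\ y = v.
  move=> exy xS1 yS1; have := E x y exy; rewrite xS1 (negPf yS1) /rmE exy /= => /negbFE.
  by case/orP => /andP[/eqP -> /eqP yE] //; move: yS1; rewrite yE uS1.
exists S1; split => //; split; last first.
  apply: (planar_absorb pl vS vS1) => x y xS1 yS1 y2 exy.
  by have [_ yE] := cross _ _ exy xS1 yS1; rewrite yE eqxx in y2.
apply: (planar_eq (S := S :\: (S :\: S1)) (e := avoid (S :\: S1) e)) => //.
  by rewrite setDDr setDv set0U; apply/setIidPr.
apply: (planar_absorb pl uS); first by rewrite inE uS1.
move=> x y; rewrite !inE => /andP[xS1 xS] yS1 yu exy.
have eyx : e y x by rewrite es.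
rewrite (planar_mem pl eyx) andbT negbK in yS1.
have [| |yE _] := cross y x eyx; rewrite ?inE //; by rewrite yE eqxx in yu.
Qed.

Lemma card_setD S S1 x : x \in S -> x \in S1 -> (#|S :\: S1| < #|S|)%N.
Proof.
move=> xS xS1; apply: proper_card; apply/properP; split; first exact: subsetDl.
by exists x => //; rewrite inE xS1.
Qed.

(** A common neighbour [w] of [v1] and [v2] serves as outer face. Put back, it pays for its edges to
    the two roots, and every other neighbour pays for its own edge to [w], reaching at most 3.
    Without [w] the edge is a bridge, with one root on each side. *)
Lemma nice_edge_step S e : planar S e -> nice_outer_edge e ->
  (forall S' e', planar S' e' -> (#|S'| < #|S|)%N -> nice_root S' e') -> nice_edge e.
Proof.
move=> pl hB IH v1 v2 e12; have es := planar_sym pl; have ei := planar_irr pl.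
have e21 : e v2 v1 by rewrite es.
have n12 : v1 != v2 by apply: contraTneq e12 => ->; rewrite ei.
have [w /andP[e1w e2w]|noc] := pickP (fun w => e v1 w && e v2 w).
  have ew1 : e w v1 by rewrite es.
  have ew2 : e w v2 by rewrite es.
  have [m [nm m1 m2 mc]] := hB w v1 v2 ew1 ew2 e12.
  have nw1 : w != v1 by apply: contraTneq e1w => ->; rewrite ei.
  have nw2 : w != v2 by apply: contraTneq e2w => ->; rewrite ei.
  pose U := [seq x <- enum W | [&& e w x, x != v1 & x != v2]].
  have uU : uniq U by rewrite filter_uniq // enum_uniq.
  have Uin x : (x \in U) = [&& e w x, x != v1 & x != v2] by rewrite mem_filter mem_enum andbT.
  have mw : m w = 0 by apply: nz_support nm _ => y; rewrite /rmE /rmV eqxx andbF.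
  exists (m + dsum U + delta w *+ size [:: v1; v2]); split.
  - apply: nz_star_roots.
    + exact: rmE_sym.
    + exact: rmE_irr.
    + by rewrite /= !inE !Uin !eqxx !andbF orbF n12.
    + move=> x; rewrite !inE Uin /rmE [x \in _]unfold_in /= /rmE (negPf nw1) (negPf nw2) /= andbT.
      by have [->|n1] := eqVneq x v1; have [E|n2] := eqVneq x v2; rewrite ?E ?ew1 ?ew2 ?andbT.
    + apply: (eq_nz _ nm) => x y; rewrite /rmE /rmV; case: (e x y) => //=; exact: andbC.
    + by move=> x; rewrite !inE => /orP[/eqP ->|/eqP ->].
  - by rewrite !monE dsumE // Uin eqxx andbF m1 eq_sym (negPf nw1).
  - by rewrite !monE dsumE // Uin eqxx !andbF m2 eq_sym (negPf nw2).
  - move=> x; rewrite !monE dsumE // Uin; have := mc x; rewrite /cap.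
    by case: (eqVneq x w) => [->|_]; rewrite ?mw ?ei /=; case: (e w x) => /=; lia.
have c0 : com e v1 v2 = set0 by apply/setP => x; rewrite !inE noc.
have [S1 [v1S1 v2S1 S1S [plA plB] E]] := bridge pl e12 c0.
have v1S := planar_mem pl e12; have v2S := planar_mem pl e21.
have lt1 : (#|S1| < #|S|)%N.
  by apply: proper_card; apply/properP; split => //; exists v2.
have [m1 [n1 m10 m14]] := IH _ _ plA lt1 v1 v1S1.
have [|m2 [n2 m20 m24]] := IH _ _ plB (card_setD v1S v1S1) v2.
  by rewrite inE v2S1 v2S.
have m1S x : x \in S :\: S1 -> m1 x = 0.
  by move=> xS2; apply: nz_support n1 _ => y; rewrite /avoid xS2 andbF.
have m2S x : x \notin S :\: S1 -> m2 x = 0.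
  move=> xS2; apply: nz_support n2 _ => y; apply/negP => /and3P[exy xS1 _].
  by move: xS2; rewrite inE xS1 (planar_mem pl exy).
exists (m1 + m2); split.
- apply: (nz_glue (Q := S :\: S1) _ _ _ n1 n2) => //; last by move=> x y /and3P[].
  move=> x y; rewrite /avoid; case: (boolP (e x y)) => exy /=; last by rewrite /rmE (negPf exy).
  have eyx : e y x by rewrite es.
  rewrite E // !inE (planar_mem pl exy) (planar_mem pl eyx) !andbT !negbK.
  by case: (x \in S1); case: (y \in S1).
- by rewrite monD m10 m2S ?addr0 // inE v1S1.
- by rewrite monD m20 m1S ?addr0 // inE v2S1 v2S.
- move=> x; rewrite monD; case: (boolP (x \in S :\: S1)) => xS; first by rewrite m1S // add0r.
  by rewrite m2S // addr0.
Qed.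

(** With a common neighbour [b] of [z] and [v], root the edge [v b] and let [b] pay for it.
    Otherwise [z v] is a bridge; the part beyond it meets the boundary only in [v], so [nice_root]
    is enough there. *)
Lemma nice_outer_root_step S e : planar S e -> nice_outer_edge e ->
  (forall S' e', planar S' e' -> (#|S'| < #|S|)%N -> nice_root S' e' /\ nice_outer_root e') -> nice_outer_root e.
Proof.
move=> pl hB IH z v ezv; have es := planar_sym pl; have ei := planar_irr pl.
have evz : e v z by rewrite es.
have nzv : z != v by apply: contraTneq ezv => ->; rewrite ei.
have zS := planar_mem pl ezv; have vS := planar_mem pl evz.
(* In the bridge case [v'] is the root for the part that contains [z]. *)
have [v' /andP[ezv' nv']|onlyv] := pickP (fun x => e z x && (x != v)); last first.
  have oz x : e z x -> x = v by move=> ezx; have := onlyv x; rewrite ezx => /negbFE/eqP.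
  have pl' : planar (S :\: [set z]) (avoid [set z] e).
    apply: (planar_absorb pl vS); first by rewrite inE eq_sym.
    by move=> x y; rewrite inE => /eqP -> _ yv /oz E; rewrite E eqxx in yv.
  have lt : (#|S :\: [set z]| < #|S|)%N by apply: (card_setD zS); rewrite inE.
  have [h _] := IH _ _ pl' lt; have [|m [nm mv m4]] := h v; first by rewrite !inE eq_sym nzv.
  exists m; split => //.
    by apply: (eq_nz _ nm) => x y; rewrite /avoid /rmV !inE.
  by move=> x; rewrite /cap; case: ifP => [/oz ->|_]; rewrite ?mv.
have [b /andP[ezb evb]|noc] := pickP (fun w => e z w && e v w).
  have [m [nm mv mb mc]] := hB z v b ezv ezb evb.
  have bv : b != v by apply: contraTneq evb => ->; rewrite ei.
  exists (m + delta b); split.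
  - apply: (nz_root _ bv) mv; first exact: rmV_sym.
      have bz : b != z by apply: contraTneq ezb => ->; rewrite ei.
      by rewrite /rmV es evb bz eq_sym.
    exact: eq_nz (rmEC _ v b) nm.
  - by rewrite monD deltaE mv eq_sym (negPf bv).
  - move=> x; rewrite monD deltaE; have := mc x; case: eqP => [->|_]; rewrite ?mb /cap ?ezb //; lia.
have c0 : com e z v = set0 by apply/setP => x; rewrite !inE noc.
have [S1 [zS1 vS1 S1S [plA plB] E]] := bridge pl ezv c0.
have lt1 : (#|S1| < #|S|)%N.
  by apply: proper_card; apply/properP; split => //; exists v.
have out x : e z x -> x \notin S1 -> x = v.
  move=> ezx xS1; have := E z x ezx; rewrite zS1 (negPf xS1) /rmE ezx /= => /negbFE.
  by rewrite eqxx (negPf nzv) /= orbF => /eqP.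
have v'S1 : v' \in S1 by apply: contraT => /(out _ ezv') h; rewrite h eqxx in nv'.
have [_ hB1] := IH _ _ plA lt1; have [|m2 [n2 m20 m2c]] := hB1 z v'.
  by rewrite /avoid ezv' !inE zS1 v'S1.
have [hA1 _] := IH _ _ plB (card_setD zS zS1); have [|m1 [n1 m10 m14]] := hA1 v.
  by rewrite inE vS1 vS.
have m1S x : x \in S1 -> m1 x = 0.
  by move=> xS2; apply: nz_support n1 _ => y; rewrite /avoid xS2 andbF.
have m2S x : x \notin S1 -> m2 x = 0.
  move=> xS1; apply: nz_support n2 _ => y; apply/negP => /and3P[/and3P[exy + _] _ _].
  by rewrite inE xS1 (planar_mem pl exy).
exists (m1 + m2); split.
- apply: (nz_glue (Q := S1) _ _ _ n1 n2) => //; last by move=> x y /and3P[].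
  move=> x y; rewrite /avoid /rmV; case: (boolP (e x y)) => exy //=.
  have eyx : e y x by rewrite es.
  rewrite !inE (planar_mem pl exy) (planar_mem pl eyx) !andbT !negbK.
  have := E x y exy; rewrite /rmE exy /=.
  case: (eqVneq x z) => [->|xz]; case: (eqVneq y z) => [->|yz]; rewrite ?zS1 ?andbF ?andbT ?(negPf xz) ?(negPf yz) ?andbF //=.
  by case: (x \in S1); case: (y \in S1).
- by rewrite monD m10 m2S ?addr0.
- move=> x; rewrite monD; case: (boolP (x \in S1)) => xS1.
    by rewrite m1S // add0r; have := m2c x; rewrite /cap /avoid !inE zS1 xS1 !andbT.
  rewrite m2S // addr0 /cap; case: ifP => [ezx|_] //.
  by rewrite (out x) // m10.
Qed.

Definition absorb z v x : W := if x == v then z else x.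

Lemma absorb_quot e z v a b : a != z -> b != z -> a != b ->
  quot (absorb z v) e a b = [&& e a b, a != v & b != v].
Proof.
move=> az bz ab; rewrite /quot ab /=; apply/existsP/and3P.
  move=> [x /existsP[y /and3P[exy /eqP fx /eqP fy]]]; move: exy fx fy; rewrite /absorb.
  case: (eqVneq x v) => [_ _ E|xv]; first by rewrite E eqxx in az.
  case: (eqVneq y v) => [_ _ _ E|yv]; first by rewrite E eqxx in bz.
  by move=> exy <- <-.
move=> [eab av bv]; exists a; apply/existsP; exists b.
by rewrite eab /absorb (negPf av) (negPf bv) !eqxx.
Qed.

Lemma absorb_quotz e z v b : z != v -> b != z -> b != v ->
  quot (absorb z v) e z b = e z b || e v b.
Proof.
move=> zv bz bv; rewrite /quot eq_sym bz /=; apply/existsP/orP.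
  move=> [x /existsP[y /and3P[exy /eqP fx /eqP fy]]]; move: exy fx fy; rewrite /absorb.
  case: (eqVneq y v) => [_ _ _ E|yv]; first by rewrite E eqxx in bz.
  case: (eqVneq x v) => [-> evy _ <-|xv exy <- <-]; by [right|left].
case=> h; [exists z|exists v]; apply/existsP; exists b;
  by rewrite h /absorb ?eqxx ?(negPf zv) (negPf bv) ?eqxx.
Qed.

(** Since [v1] and [v2] are adjacent, some component [U2] off the triangle contains neither. The
    rest keeps the chord [v b] and is rooted at [v1 v2]; [U2] with the triangle drops the chord and
    is rooted at [v b], so gluing does not change the exponents of [v] and [b]. *)
Lemma nice_outer_edge_chord S e z v1 v2 v b p q : planar S e ->
  (forall S' e', planar S' e' -> (#|S'| < #|S|)%N -> nice_outer_edge e') ->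
  e z v1 -> e z v2 -> e v1 v2 -> e z v -> e z b -> e v b ->
  p \in S :\: [set z; v; b] -> q \in S :\: [set z; v; b] ->
  ~~ connect (avoid [set z; v; b] e) p q ->
  exists m, [/\ nz (rmE (rmV e z) v1 v2) m, m v1 = 0, m v2 = 0 & forall x, m x <= cap e z x].
Proof.
move=> pl IH ez1 ez2 e12 ezv ezb evb; set K := [set z; v; b] => pS qS npq.
have es := planar_sym pl; have ei := planar_irr pl.
have ene x y : e x y -> x != y by apply: contraTneq => ->; rewrite ei.
have e21 : e v2 v1 by rewrite es.
have rs := avoid_sym K es; have cs := sym_connect_sym rs.
have v12K x y : connect (avoid K e) x v1 -> connect (avoid K e) y v2 -> x \notin K -> y \notin K ->
    connect (avoid K e) x y.
  move=> xv yv xK yK; apply: (connect_trans xv).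
  apply: (@connect_trans _ _ v2); last by rewrite cs.
  by apply: connect1; rewrite /avoid e12 (connect_avoid xv xK) (connect_avoid yv yK).
have [p' [q' [[p'S q'S npq'] [h1 h2]]]] : exists p' q',
   [/\ p' \in S :\: K, q' \in S :\: K & ~~ connect (avoid K e) p' q'] /\
   (~~ connect (avoid K e) q' v1 /\ ~~ connect (avoid K e) q' v2).
  have [h|] := boolP (connect (avoid K e) q v1 || connect (avoid K e) q v2); last first.
    by rewrite negb_or => /andP[h1 h2]; exists p, q.
  exists q, p; split; first by split => //; rewrite cs.
  have pK : p \notin K by move: pS; rewrite inE => /andP[].
  have qK : q \notin K by move: qS; rewrite inE => /andP[].
  split; apply: contra npq => hp.
    case/orP: h => hq; last exact: v12K.
    by apply: connect_trans hp _; rewrite cs.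
  case/orP: h => hq; first by rewrite cs; apply: v12K.
  by apply: connect_trans hp _; rewrite cs.
move: p'S q'S; rewrite !in_setD => /andP[p'K p'S] /andP[q'K q'S].
pose U2 := [set x | connect (avoid K e) q' x]; pose U1 := S :\: (K :|: U2).
have U2K x : x \in U2 -> x \notin K by rewrite inE => /connect_avoid; apply.
have KU2 x : x \in K -> x \notin U2 by apply: contraL => /U2K.
have U2c x y : e x y -> x \in U2 -> y \notin K -> y \in U2.
  move=> exy xU yK; have xK := U2K _ xU; move: xU; rewrite !inE => xU.
  by apply: connect_trans xU (connect1 _); rewrite /avoid exy xK.
have eS x y : e x y -> x \in S /\ y \in S.
  by move=> exy; split; [apply: planar_mem exy|rewrite es in exy; apply: planar_mem exy].
have U1E x : x \in S -> (x \in U1) = (x \notin K) && (x \notin U2).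
  by move=> xS; rewrite in_setD in_setU xS andbT negb_or.
have zK : z \in K by rewrite !inE eqxx.
have vK : v \in K by rewrite !inE eqxx orbT.
have bK : b \in K by rewrite !inE eqxx orbT.
have U1K x : x \in K -> x \notin U1 by move=> xK; rewrite in_setD in_setU xK.
have KS : K \subset S.
  by apply/subsetP => x; rewrite !inE => /orP[/orP[]|] /eqP ->;
   [case: (eS _ _ ezv)|case: (eS _ _ evb)|case: (eS _ _ ezb)].
have K0 : K != set0 by apply/set0Pn; exists z.
have Kc : {in K &, forall a b : W, a != b -> e a b}.
  move=> a a'; rewrite !inE => /orP[/orP[]|] /eqP -> /orP[/orP[]|] /eqP ->;
   by rewrite ?eqxx // => _; rewrite // es.
have pl1 : planar (S :\: U2) (avoid U2 e).
  apply: (planar_clique pl KS K0 Kc).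
    by rewrite disjoint_subset; apply/subsetP => x /U2K.
  by move=> x y xU yU exy; apply: contraR yU; apply: U2c exy xU.
have pl2 : planar (S :\: U1) (avoid U1 e).
  apply: (planar_clique pl KS K0 Kc).
    by rewrite disjoint_subset; apply/subsetP => x; rewrite in_setD in_setU negb_or => /andP[/andP[]].
  move=> x y xU yU exy; have [xS yS] := eS _ _ exy.
  rewrite U1E // in xU; rewrite U1E // in yU; case/andP: xU => xK xU.
  apply: contraR yU => yK; rewrite yK /=; apply: contra xU => yU.
  by rewrite es in exy; apply: U2c exy yU xK.
have lt1 := card_setD q'S (_ : q' \in U2).
have lt2 := card_setD p'S (_ : p' \in U1).
have q'U : q' \in U2 by rewrite inE connect0.
have p'U : p' \in U1 by rewrite U1E // p'K inE cs.
have v1U : v1 \notin U2 by rewrite inE.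
have v2U : v2 \notin U2 by rewrite inE.
have [||| m1 [n1 m11 m12 m1c]] := IH _ _ pl1 (lt1 q'U) z v1 v2.
- by rewrite /avoid ez1 KU2.
- by rewrite /avoid ez2 KU2.
- by rewrite /avoid e12 v1U.
have [||| m2 [n2 m21 m22 m2c]] := IH _ _ pl2 (lt2 p'U) z v b.
- by rewrite /avoid ezv !U1K.
- by rewrite /avoid ezb !U1K.
- by rewrite /avoid evb !U1K.
have m1U x : x \in U2 -> m1 x = 0.
  by move=> xU; apply: nz_support n1 _ => y; rewrite /rmE /rmV /avoid xU !(andbF, andFb).
have m2U x : x \notin U2 -> m2 x = 0.
  move=> xU; have [xK|xK] := boolP (x \in K).
    move: xK; rewrite !inE => /orP[/orP[]|] /eqP -> //.
    by apply: nz_support n2 _ => y; rewrite /rmE /rmV eqxx /= andbF.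
  apply: nz_support n2 _ => y; apply/negP => /andP[/andP[/and3P[/eS[xS _] + _] _] _].
  by rewrite U1E // xK xU.
exists (m1 + m2); split.
- apply: (nz_glue (Q := U2) _ _ _ n1 n2) => //; last by move=> x y /andP[/andP[/and3P[]]].
  have half x y : e x y -> x \in U2 -> (rmE (rmV e z) v1 v2 x y =
    rmE (rmV (avoid U2 e) z) v1 v2 x y + rmE (rmV (avoid U1 e) z) v b x y :> nat)%N.
    move=> exy xU; have [xS yS] := eS _ _ exy; have xK := U2K _ xU.
    have yU1 : y \notin U1.
      by rewrite U1E //; apply/negP => /andP[yK]; rewrite (U2c _ _ exy xU yK).
    have xn k : k \in K -> (x == k) = false by move=> kK; apply: contraNF xK => /eqP ->.
    have xU1 : (x \in U1) = false by rewrite U1E // xU andbF.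
    rewrite /rmE /rmV /avoid exy xU xU1 (negPf yU1) (xn z) // (xn v) // (xn b) //= ?andbF ?andbT /=.
    rewrite (_ : (x == v1) = false); last by apply: contraTF xU => /eqP ->.
    rewrite (_ : (x == v2) = false) //=; last by apply: contraTF xU => /eqP ->.
    by rewrite ?andbT ?andbF ?orbF ?add0n.
  move=> x y; case: (boolP (e x y)) => exy; last by rewrite /rmE /rmV /avoid (negPf exy).
  have eyx : e y x by rewrite es.
  case: (boolP (x \in U2)) => xU; first exact: half.
  case: (boolP (y \in U2)) => yU.
    have := half y x eyx yU.
    have sa U a c : symmetric (rmE (rmV (avoid U e) z) a c) := rmE_sym _ _ (rmV_sym z (avoid_sym U es)).
    by rewrite (sa U2 v1 v2 y x) (sa U1 v b y x) (rmE_sym v1 v2 (rmV_sym z es) y x).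
  have [xS yS] := eS _ _ exy.
  rewrite /rmE /rmV /avoid exy xU yU !U1E // xU yU !andbT !negbK /=.
  set B := ~~ (_ || _); rewrite -[LHS]addn0; congr addn.
  apply/esym/eqP; rewrite eqb0; apply/negP => /andP[/andP[/andP[xK yK] /andP[xz yz]]].
  move: xK yK; rewrite !inE (negPf xz) (negPf yz) /= => /orP[] /eqP xE /orP[] /eqP yE; rewrite xE yE ?eqxx ?orbT //.
  + by move: exy; rewrite xE yE ei.
  + by move: exy; rewrite xE yE ei.
- by rewrite monD m11 m2U ?addr0.
- by rewrite monD m12 m2U ?addr0.
- move=> x; rewrite monD; case: (boolP (x \in U2)) => xU.
    rewrite m1U // add0r; have := m2c x; rewrite /cap /avoid U1K //=.
    case: (boolP (e z x)) => //= ezx; have [_ xS] := eS _ _ ezx.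
    by rewrite U1E // xU andbF.
  rewrite m2U // addr0; have := m1c x; by rewrite /cap /avoid KU2 // xU !andbT.
Qed.

Lemma nice_outer_edge_step S e : planar S e ->
  (forall S' e', planar S' e' -> (#|S'| < #|S|)%N -> [/\ nice_edge e', nice_outer_edge e' & nice_outer_root e']) -> nice_outer_edge e.
Proof.
move=> pl IH z v1 v2 ez1 ez2 e12; have es := planar_sym pl; have ei := planar_irr pl.
have ene x y : e x y -> x != y by apply: contraTneq => ->; rewrite ei.
have IHB S' e' : planar S' e' -> (#|S'| < #|S|)%N -> nice_outer_edge e' by move=> h h'; have [] := IH _ _ h h'.
have eS x y : e x y -> x \in S /\ y \in S.
  by move=> exy; split; [apply: planar_mem exy|rewrite es in exy; apply: planar_mem exy].
have [zS v1S] := eS _ _ ez1; have [_ v2S] := eS _ _ ez2.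
have e1z : e v1 z by rewrite es.
have e2z : e v2 z by rewrite es.
have n1z := ene _ _ e1z; have n2z := ene _ _ e2z.
have n12 := ene _ _ e12; have nz1 := ene _ _ ez1; have nz2 := ene _ _ ez2.
(* Thomassen's step: absorb a neighbour [v] of [v1] on the boundary into [z]. *)
have [v /and3P[ezv e1v nv2]|nov] := pickP (fun x => [&& e z x, e v1 x & x != v2]).
  have ev1 : e v v1 by rewrite es.
  have nv1 := ene _ _ ev1; have nzv := ene _ _ ezv.
  have [p [q [/andP[ezp evp] /andP[ezq evq] sep]]] := planar_chord pl ezv ez1 ev1.
  (* A third common neighbour of [z] and [v] gives a separating triangle. Otherwise [v] has at most
     two neighbours on the boundary: [v1] and possibly the [w] below. *)
  have [b /andP[/and3P[ezb evb bp] bq]|Cpq] := pickP (fun b => [&& e z b, e v b & b != p] && (b != q)).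
    apply: (nice_outer_edge_chord pl IHB ez1 ez2 e12 ezv ezb evb _ _ (sep b ezb evb bp bq)).
      have [_ pS] := eS _ _ ezp; rewrite !inE pS andbT !negb_or ![p == _]eq_sym bp andbT.
      by rewrite (ene _ _ ezp) (ene _ _ evp).
    have [_ qS] := eS _ _ ezq; rewrite !inE qS andbT !negb_or ![q == _]eq_sym bq andbT.
    by rewrite (ene _ _ ezq) (ene _ _ evq).
  have Cin x : e z x -> e v x -> (x == p) || (x == q).
    by move=> ezx evx; have := Cpq x; rewrite ezx evx /= => /negbT; rewrite negb_and !negbK.
  have vS := (eS _ _ ezv).2.
  have evz : e v z by rewrite es.
  have pl' : planar (absorb z v @: S) (quot (absorb z v) e).
    apply: (planar_quot pl) => x y xS yS; rewrite /absorb.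
    case: (eqVneq x v) => [->|xv]; case: (eqVneq y v) => [->|yv].
    - by move=> _; apply: connect0.
    - by move=> <-; apply: connect1; rewrite evz !eqxx (negPf nzv) eqxx.
    - by move=> ->; apply: connect1; rewrite ezv !eqxx (negPf nzv) eqxx.
    - by move=> ->; apply: connect0.
  have lt : (#|absorb z v @: S| < #|S|)%N.
    apply: proper_card; apply/properP; split.
      by apply/subsetP => _ /imsetP[x xS ->]; rewrite /absorb; case: ifP.
    exists v => //; apply/imsetP => -[x _]; rewrite /absorb; case: eqVneq => [_ E|xv E].
      by rewrite E eqxx in nzv.
    by rewrite E eqxx in xv.
  have nvz : v != z by rewrite eq_sym.
  have [||| m [nm m1 m2 mc]] := IHB _ _ pl' lt z v1 v2.
  - by rewrite absorb_quotz ?ez1 // eq_sym.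
  - by rewrite absorb_quotz ?ez2 // eq_sym.
  - by rewrite absorb_quot ?e12 //= 1?eq_sym // nv1 eq_sym nv2.
  pose e0 := rmE (rmV e z) v1 v2.
  have e0s : symmetric e0 := rmE_sym _ _ (rmV_sym z es).
  have e0i : irreflexive e0 := rmE_irr _ _ (rmV_irr z ei).
  have e0v x : e0 v x = e v x && (x != z).
    by rewrite /e0 /rmE /rmV nvz (negPf nv1) (negPf nv2) /= !andbT.
  have {}nm : nz (rmV e0 v) m.
    apply: (eq_nz _ nm) => x y; rewrite /e0 /rmE /rmV.
    case: (eqVneq x z) => [->|xz]; first by rewrite !andbF.
    case: (eqVneq y z) => [->|yz]; first by rewrite !andbF.
    case: (eqVneq x y) => [->|xy]; first by rewrite /quot eqxx ei.
    rewrite absorb_quot //=; case: (e x y) => //=; rewrite ?andbT andbC.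
    by case: (x != v); case: (y != v).
  have mv : m v = 0 by apply: nz_support nm _ => y; rewrite /rmV eqxx andbF.
  pose U := [seq x <- enum W | [&& e v x, x != z & ~~ e z x]].
  have uU : uniq U by rewrite filter_uniq // enum_uniq.
  have Uin x : (x \in U) = [&& e v x, x != z & ~~ e z x] by rewrite mem_filter mem_enum andbT.
  (* A vertex of [U] has cap 2 in the quotient and 4 in [e], hence two units to spare; [v] has
     exponent 0 in the quotient and cap 2 in [e]. *)
  have fin d : nz e0 d -> (forall x, d x <= m x + (x \in U)%:Z *+ 2 + (x == v)%:Z *+ 2) ->
      exists m, [/\ nz (rmE (rmV e z) v1 v2) m, m v1 = 0, m v2 = 0 & forall x, m x <= cap e z x].
    move=> nd hd; exists d; split => //.
    - have := nz_ge0 v1 nd; have := hd v1; rewrite m1 Uin ez1 !andbF eq_sym (negPf nv1) /=; clear; lia.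
    - have := nz_ge0 v2 nd; have := hd v2; rewrite m2 Uin ez2 !andbF eq_sym (negPf nv2) /=; clear; lia.
    - move=> x; have := hd x; have := mc x; rewrite Uin /cap.
      case: (eqVneq x v) => [->|xv]; first by rewrite mv ei ezv /=; clear; lia.
      case: (eqVneq x z) => [->|xz].
        by rewrite ei /= andbF; case: ifP => _; clear; lia.
      by rewrite absorb_quotz //; case: (e v x); case: (e z x) => /=; clear; lia.
  have vU : v \notin U by rewrite Uin ei.
  have [w /and3P[ezw evw nw1]|now] := pickP (fun w => [&& e z w, e v w & w != v1]); last first.
    have {}now x : e z x -> e v x -> x = v1.
      by move=> ezx evx; have := now x; rewrite ezx evx => /negbFE/eqP.
    apply: (fin (m + dsum U + delta v *+ size [:: v1])).
      apply: nz_star_roots => //.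
      + by rewrite /= uU Uin ez1 !andbF.
      + move=> x; rewrite -[RHS]/(e0 v x) e0v inE /= Uin.
        case: (eqVneq x v1) => [->|x1]; first by rewrite ev1 n1z.
        have := now x; case: (e v x) => //=; case: (e z x) => [/(_ isT isT) E|_]; last by rewrite andbT.
        by rewrite E eqxx in x1.
      + by move=> x; rewrite inE => /eqP ->.
    by move=> x; rewrite !monE dsumE //=; clear; lia.
  have C2 x : e z x -> e v x -> (x == v1) || (x == w).
    move=> ezx evx; have := Cin x ezx evx; have := Cin w ezw evw; have := Cin v1 ez1 ev1.
    case/orP => /eqP E1; case/orP => /eqP E2; case/orP => /eqP ->; rewrite ?E1 ?E2 ?eqxx ?orbT //;
      by rewrite E1 E2 eqxx in nw1.
  have C2i x : (x == v1) || ((x == w) || (x \in U)) = e0 v x.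
    rewrite e0v Uin; case: (eqVneq x v1) => [->|x1]; first by rewrite ev1 n1z.
    case: (eqVneq x w) => [->|xw]; first by rewrite evw; have := ene _ _ ezw; rewrite eq_sym => ->.
    have := C2 x; rewrite (negPf x1) (negPf xw) /=; case: (e v x) => //=.
    by case: (e z x) => [/(_ isT isT)|_] //; rewrite andbT.
  have uN : uniq [:: v1, w & U].
    by rewrite /= inE !Uin ez1 ezw !andbF uU; move: nw1; rewrite eq_sym => /negPf ->.
  have [w2|w2] := eqVneq w v2.
    apply: (fin (m + dsum U + delta v *+ size [:: v1; w])).
      apply: nz_star_roots => //.
      by move=> x; rewrite !inE => /orP[] /eqP -> //; rewrite w2.
    by move=> x; rewrite !monE dsumE //=; clear; lia.
  (* [w] is neither a root nor able to pay outright, as its exponent may already be 2. *)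
  have [|nd|[u uU' nd]] := nz_star_switch e0s e0i uN _ nm m1.
  - by move=> x; rewrite -[RHS]/(e0 v x) -C2i !inE.
  - by apply: (fin _ nd) => x; rewrite !monE dsumE //; clear; lia.
  - apply: (fin _ nd) => x; rewrite !monE dsumE //.
    by case: (eqVneq x u) => [->|_]; rewrite ?uU'; clear; lia.
(* Otherwise [v2] separates [v1] from [z] once the edge [z v1] is removed. *)
have C2 x : e z x -> e v1 x -> x = v2.
  by move=> ezx e1x; have := nov x; rewrite ezx e1x => /negbFE/eqP.
have comE : com e z v1 = [set v2].
  apply/setP => x; rewrite !inE; apply/andP/eqP => [[]|->]; [exact: C2|by []].
have := planar_split pl ez1; rewrite comE cards1 => /(_ isT) ns.
set r := avoid [set v2] (rmE e z v1) in ns.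
have rs : symmetric r := avoid_sym _ (rmE_sym _ _ es).
have cs := sym_connect_sym rs.
(* [S1] with [v2] is rooted at [v1 v2]; [S2] with [v2] contains [z] and is rooted at [v2]. The only
   edge between [S1] and [S2] is [z v1], which disappears with [z]. *)
pose S1 := [set x | connect r v1 x]; pose S2 := S :\: (v2 |: S1).
have v1S1 : v1 \in S1 by rewrite inE connect0.
have v2S1 : v2 \notin S1.
  by apply/negP; rewrite inE => /connect_avoid; rewrite !inE n12 eqxx => /(_ isT).
have zS1 : z \notin S1 by rewrite inE.
have rcl x y : r x y -> (x \in S1) = (y \in S1).
  move=> rxy; rewrite !inE; apply/idP/idP => h; apply: connect_trans h (connect1 _) => //.
  by rewrite rs.
have cross x y : e x y -> x \in S1 -> y \notin S1 -> y != v2 -> x = v1 /\ y = z.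
  move=> exy xS1 yS1 y2; have x2 : x != v2 by apply: contraTneq xS1 => ->.
  have := rcl x y; rewrite /r /avoid !in_set1 x2 y2 xS1 (negPf yS1) /rmE exy /= andbT.
  case: ((x == z) && (y == v1)) / andP => [[/eqP xz]|_ /=].
    by rewrite xz (negPf zS1) in xS1.
  by case: ((x == v1) && (y == z)) / andP => [[/eqP -> /eqP ->]|_] // /(_ isT).
have S1S : S1 \subset S.
  apply/subsetP => x; rewrite inE cs => /connectP[[|y s] /=]; first by move=> _ <-.
  by case/andP => /and3P[/andP[exy _] _ _] _ _; apply: planar_mem exy.
have S2E x : x \in S -> (x \in S2) = (x != v2) && (x \notin S1).
  by move=> xS; rewrite in_setD in_setU1 xS andbT negb_or.
have v2S2 : v2 \notin S2 by rewrite S2E // eqxx.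
have zS2 : z \in S2 by rewrite S2E // nz2.
have v1S2 : v1 \notin S2 by rewrite S2E // v1S1 andbF.
have plA : planar (S :\: S2) (avoid S2 e).
  apply: (planar_absorb pl v2S v2S2) => x y xS2 yS2 y2 exy; have [xS yS] := eS _ _ exy.
  rewrite S2E // in xS2; rewrite S2E // y2 /= negbK in yS2; case/andP: xS2 => x2 xS1.
  have eyx : e y x by rewrite es.
  by have [-> ->] := cross y x eyx yS2 xS1 x2; rewrite ez2 es e12.
have plB : planar (S :\: S1) (avoid S1 e).
  apply: (planar_absorb pl v2S v2S1) => x y xS1 yS1 y2 exy.
  by have [-> ->] := cross x y exy xS1 yS1 y2; rewrite e12 e2z.
have [hA _ _] := IH _ _ plA (card_setD zS zS2).
have [|m1 [n1 m11 m12 m14]] := hA v1 v2; first by rewrite /avoid e12 v1S2.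
have [_ _ hB] := IH _ _ plB (card_setD v1S v1S1).
have [|m2 [n2 m22 m2c]] := hB z v2; first by rewrite /avoid ez2 zS1.
have m1S x : x \in S2 -> m1 x = 0.
  by move=> xS2; apply: nz_support n1 _ => y; rewrite /rmE /avoid xS2 andbF.
have m2S x : x \notin S2 -> m2 x = 0.
  move=> xS2; have [->//|x2] := eqVneq x v2.
  apply: nz_support n2 _ => y; apply/negP => /and3P[/and3P[/eS[xS _] + _] _ _].
  by move=> xS1; rewrite S2E // x2 xS1 in xS2.
exists (m1 + m2); split.
- apply: (nz_glue (Q := S2) _ _ _ n1 n2) => //; last by move=> x y /andP[/and3P[]].
  move=> x y; case: (boolP (e x y)) => exy; last by rewrite /rmE /rmV /avoid (negPf exy).
  have [xS yS] := eS _ _ exy; have eyx : e y x by rewrite es.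
  have nedge a c : a \in S2 -> (((a == v1) && (c == v2) || (a == v2) && (c == v1)) = false) /\
                               (((c == v1) && (a == v2) || (c == v2) && (a == v1)) = false).
    move=> aS2; have -> : (a == v1) = false by apply: contraTF aS2 => /eqP ->.
    by have -> : (a == v2) = false by [apply: contraTF aS2 => /eqP ->]; rewrite !andbF.
  case: (boolP ((x \in S2) || (y \in S2))) => h.
    have -> : rmE (avoid S2 e) v1 v2 x y = false by rewrite /rmE /avoid exy -negb_or h.
    have ne : ((x == v1) && (y == v2) || (x == v2) && (y == v1)) = false.
      by case/orP: h => [/(nedge _ y)|/(nedge _ x)] [].
    rewrite add0n; congr nat_of_bool; rewrite /rmE /rmV /avoid exy ne /= andbT.
    have zz a c : e a c -> a \in S1 -> c \in S2 -> c = z.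
      move=> eac aS1 cS2; have [_ cS] := eS _ _ eac; move: cS2; rewrite S2E // => /andP[c2 cS1].
      by have [] := cross _ _ eac aS1 cS1 c2.
    have S12 a : a \in S1 -> a \notin S2.
      by move=> aS1; rewrite S2E ?aS1 ?andbF // (subsetP S1S).
    case: (boolP (x \in S1)) => xS1.
      by move: h; rewrite (negPf (S12 _ xS1)) /= => /(zz _ _ exy xS1) ->; rewrite eqxx !andbF.
    case: (boolP (y \in S1)) => yS1 //=.
    by move: h; rewrite (negPf (S12 _ yS1)) orbF => /(zz _ _ eyx yS1) ->; rewrite eqxx.
  have /norP[xS2 yS2] := h.
  have xz : x != z by apply: contraNneq xS2 => ->.
  have yz : y != z by apply: contraNneq yS2 => ->.
  rewrite /rmE /rmV /avoid exy xS2 yS2 xz yz /= andbT -[LHS]addn0; congr addn.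
  apply/esym/eqP; rewrite eqb0 negb_and !negbK.
  move: xS2 yS2; rewrite !S2E // !negb_and !negbK.
  case/orP => [/eqP x2|-> //]; case/orP => [/eqP y2|->]; last by rewrite orbT.
  by have := ene _ _ exy; rewrite x2 y2 eqxx.
- by rewrite monD m11 m2S ?addr0.
- by rewrite monD m12 m2S ?addr0.
- move=> x; rewrite monD; case: (boolP (x \in S2)) => xS2.
    rewrite m1S // add0r; have := m2c x; rewrite /cap /avoid zS1 /=.
    case: (boolP (e z x)) => //= ezx; have [_ xS] := eS _ _ ezx.
    by move: xS2; rewrite S2E // => /andP[_ ->].
  rewrite m2S // addr0 /cap; case: (boolP (e z x)) => // ezx.
  have [_ xS] := eS _ _ ezx; move: xS2; rewrite S2E // negb_and !negbK.
  case/orP => [/eqP ->|xS1]; first by rewrite m12.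
  by rewrite es in ezx; have [-> _] := cross _ _ ezx xS1 zS1 nz2; rewrite m11.
Qed.

(** The outer statements reach one vertex further because [z] is deleted. At equal size the inner
    statements use the outer ones, with [w] in the role of [z]; the outer ones call all four only on
    smaller sets. *)
Lemma nice_induction n :
  (forall S e, planar S e -> (#|S| <= n)%N -> nice_edge e /\ nice_root S e) /\
  (forall S e, planar S e -> (#|S| <= n.+1)%N -> nice_outer_edge e /\ nice_outer_root e).
Proof.
elim: n => [|n [IHA IHB]].
  split=> S e pl; first rewrite leqn0 cards_eq0 => /eqP S0.
    by split; [move=> v1 v2 /(planar_mem pl)|move=> v]; rewrite S0 inE.
  move=> /card_le1_eqP S1; have es := planar_sym pl; have ei := planar_irr pl.
  have no x y : e x y -> False.
    move=> exy; have xS := planar_mem pl exy; have := exy; rewrite es => /(planar_mem pl) yS.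
    by move: exy; rewrite (S1 x y) ?ei.
  by split=> z v; [move=> v2 /no|move=> /no].
have A S e : planar S e -> (#|S| <= n.+1)%N -> nice_edge e /\ nice_root S e.
  move=> pl hS; have [hB _] := IHB S e pl hS.
  have hA : nice_edge e.
    apply: (nice_edge_step pl hB) => S' e' pl' lt; have [] := IHA S' e' pl' => //.
    by rewrite -ltnS; apply: leq_trans lt hS.
  by split => //; apply: nice_root_step.
split=> // S e pl hS.
have lt S' : (#|S'| < #|S|)%N -> (#|S'| <= n.+1)%N by move=> h; rewrite -ltnS; apply: leq_trans h hS.
have hB : nice_outer_edge e.
  by apply: (nice_outer_edge_step pl) => S' e' pl' /lt h; have [? _] := A _ _ pl' h; have [? ?] := IHB _ _ pl' h.
split => //; apply: (nice_outer_root_step pl hB) => S' e' pl' /lt h.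
by have [_ ?] := A _ _ pl' h; have [_ ?] := IHB _ _ pl' h.
Qed.

Lemma planar_nice_outer_edge S e z v1 v2 : planar S e -> e z v1 -> e z v2 -> e v1 v2 ->
  exists m, [/\ nz (rmE (rmV e z) v1 v2) m, m v1 = 0, m v2 = 0 & forall x, m x <= cap e z x].
Proof.
by move=> pl; have [_ h] := nice_induction #|S|; have [hB _] := h S e pl (leqnSn _); apply: hB.
Qed.

End Induction.

(** * Building lattice partitions *)

Definition box (n : nat) : seq cell :=
  [seq (i%:Z - n%:Z, j%:Z - n%:Z) | i <- iota 0 (n + n).+1, j <- iota 0 (n + n).+1].

Lemma mem_box n (c : cell) :
  (c \in box n) = [&& - n%:Z <= c.1, c.1 <= n%:Z, - n%:Z <= c.2 & c.2 <= n%:Z].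
Proof.
apply/allpairsP/idP => [[[i j] [hi hj ->]]|].
  by move: hi hj; rewrite !mem_iota /=; lia.
move=> h; exists (`|(c.1 + n%:Z)%R|%N, `|(c.2 + n%:Z)%R|%N).
rewrite !mem_iota; split; [move: h => /=; lia|move: h => /=; lia|].
by case: c h => c1 c2 h; congr pair; move: h => /=; lia.
Qed.

Lemma connT_out n : connT (fun c => c \notin box n).
Proof.
move=> P hP.
have row j i i' : (n%:Z < j) || (j < - n%:Z) -> P (i, j) -> P (i', j).
  by move=> hj; apply: row_move hP _ i i' => k; rewrite mem_box /=; lia.
have col i j j' : (n%:Z < i) || (i < - n%:Z) -> P (i, j) -> P (i, j').
  by move=> hi; apply: col_move hP _ j j' => k; rewrite mem_box /=; lia.
have n1 : (n%:Z < n.+1%:Z) || (n.+1%:Z < - n%:Z) by lia.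
have out (c : cell) : c \notin box n ->
    (n%:Z < c.1) || (c.1 < - n%:Z) \/ (n%:Z < c.2) || (c.2 < - n%:Z).
  by rewrite mem_box; lia.
move=> [a1 a2] [b1 b2] /out /= ha /out /= hb p.
have {ha p} p : P (n.+1%:Z, n.+1%:Z).
  case: ha => h; first exact: (row _ a1 _ n1) (col _ a2 _ h p).
  exact: (col _ a2 _ n1) (row _ a1 _ h p).
case: hb => h; first exact: (col _ n.+1%:Z _ h) (row _ n.+1%:Z _ n1 p).
exact: (row _ n.+1%:Z _ h) (col _ n.+1%:Z _ n1 p).
Qed.

(** Meant for the outer region: the cells outside a box, with an arm towards each boundary
    vertex. *)
Lemma connT_hub (J : Type) (H : cell -> Prop) (B : J -> cell -> Prop) : connT H ->
  (forall i, connT (B i)) -> (forall i, exists2 c, H c & B i c) -> (exists c, H c) ->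
  connT (fun c => H c \/ exists i, B i c).
Proof.
move=> cH cB HB [h0 Hh0] P hP.
have P2 a a' : (H a \/ exists i, B i a) -> (H a' \/ exists i, B i a') -> adjT a a' -> (P a <-> P a').
  by move=> h h' aa; split; apply: hP => //; rewrite adjT_sym.
suff E c : (H c \/ exists i, B i c) -> (P c <-> P h0) by move=> a a' /E h /E h' /h /h'.
have EH c' : H c' -> (P c' <-> P h0).
  move=> Hc; apply: (cH (fun c => P c <-> P h0) _ h0) => // x y Hx Hy xy <-.
  by apply: iff_sym; apply: P2 => //; left.
case=> [/EH //|[i Bc]]; have [d Hd Bd] := HB i.
apply: (cB i (fun c => P c <-> P h0) _ d) => //; last exact: EH.
by move=> x y Bx By xy <-; apply: iff_sym; apply: P2 => //; right; exists i.
Qed.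

(** * From disjoint cores and connectors to a partition *)

Section Assemble.
Variables (I E : finType) (A : I -> cell -> Prop) (C : E -> cell -> Prop) (s t : E -> I).
Variables (i0 : I) (b : seq cell).
Hypothesis cA : forall i, connT (A i).
Hypothesis dA : forall i j c, A i c -> A j c -> i = j.
Hypothesis cC : forall k, connT (C k).
Hypothesis Cs : forall k, exists2 c, C k c & A (s k) c.
Hypothesis Ct : forall k, exists2 c, C k c & A (t k) c.
Hypothesis CA : forall k i c, C k c -> A i c -> i = s k \/ i = t k.
Hypothesis dC : forall k k' c, C k c -> C k' c -> k = k'.
Hypothesis nst : forall k, s k <> t k.
Hypothesis A0 : forall i, exists c, A i c.
Hypothesis Ab : forall c, c \notin b -> A i0 c.

(* The region of [s k] is extended along [C k] until it touches the region of [t k]. *)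
Let reach k c := forall P : cell -> Prop, (forall a, A (s k) a -> P a) ->
  (forall a a', P a -> C k a' -> ~ A (t k) a' -> adjT a a' -> P a') -> P c.
Let D k c := [/\ C k c, ~ A (s k) c, ~ A (t k) c & reach k c].
Let A' i c := A i c \/ exists2 k, s k = i & D k c.

Lemma reach_A k c : A (s k) c -> reach k c.
Proof. by move=> h P h1 _; apply: h1. Qed.

Lemma connT_extend i : connT (A' i).
Proof.
move=> P hP.
have P2 a a' : A' i a -> A' i a' -> adjT a a' -> (P a <-> P a').
  by move=> h h' aa; split; apply: hP => //; rewrite adjT_sym.
have [a0 Aa0] := A0 i.
suff H c : A' i c -> (P c <-> P a0) by move=> a a' /H h /H h' /h /h'.
have HA c' : A i c' -> (P c' <-> P a0).
  move=> Ac; apply: (cA (P := fun c => P c <-> P a0) _ Aa0 Ac) => // x y Ax Ay xy <-.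
  by rewrite (P2 x y) //; left.
case=> [/HA //|[k ki [Cc _ _ rc]]].
suff [_ _] : [/\ reach k c, A (s k) c \/ D k c & P c <-> P a0] by [].
apply: rc (fun c => [/\ reach k c, A (s k) c \/ D k c & P c <-> P a0]) _ _.
  by move=> a Aa; split; [exact: reach_A|left|apply: HA; rewrite -ki].
move=> a a' [ra ha pa] Ca nt aa.
have ra' : reach k a'.
  by move=> Q h1 h2; apply: (h2 a) => //; apply: ra.
have ha' : A (s k) a' \/ D k a' by have [h|h] := pselect (A (s k) a'); [left|right].
have up x : A (s k) x \/ D k x -> A' i x.
  by case=> h; [left; rewrite -ki|right; exists k].
by split => //; rewrite -pa; apply: iff_sym; apply: P2 => //; apply: up.
Qed.

Lemma extend_disjoint i j c : A' i c -> A' j c -> i = j.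
Proof.
have aux i' k : A i' c -> ~ D k c.
  by move=> Ac [Cc n1 n2 _]; have [E'|E'] := CA Cc Ac; rewrite E' in Ac.
case=> [Ai|[k <- Dk]] [Aj|[k' <- Dk']].
- exact: dA Ai Aj.
- by case: (aux _ _ Ai Dk').
- by case: (aux _ _ Aj Dk).
- by have [Ck _ _ _] := Dk; have [Ck' _ _ _] := Dk'; rewrite (dC Ck Ck').
Qed.

(** Without a contact the extension would spread over the connected [C k] up to a cell of [A (t k)],
    against disjointness. *)
Lemma extend_touch k : exists c d, [/\ adjT c d, A' (s k) c & A' (t k) d].
Proof.
apply: contrapT => nt.
have [c Cc Ac] := Cs k; have [d Cd Ad] := Ct k.
have : A (s k) d \/ D k d.
  apply: (cC (P := fun c => A (s k) c \/ D k c) _ Cc Cd); last by left.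
  move=> x y Cx Cy xy hx.
  have ny : ~ A (t k) y.
    move=> Ay; apply: nt; exists x, y; split => //; last by left.
    by case: hx => h; [left|right; exists k].
  have [h|h] := pselect (A (s k) y); [by left|right; split => //].
  move=> Q h1 h2; apply: (h2 x) => //.
  by case: hx => [|[_ _ _]]; [exact: h1|apply].
by case=> [h|[_ _ + _]] //; apply: (nst (k := k)); apply: dA h Ad.
Qed.

Lemma assemble : exists (W : finType) (S : {set W}) (e : rel W) (i : I -> W),
  [/\ injective i, planar S e & forall k, e (i (s k)) (i (t k))].
Proof.
(* Cells in no region become singletons; by [Ab] they all lie in [b]. *)
pose W := (I + seq_sub b)%type.
have lex c : exists w : W, match w with inl i => A' i c | inr x => ssval x = c /\ ~ exists i, A' i c end.
  have [[i Ai]|nA] := pselect (exists i, A' i c); first by exists (inl i).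
  have cb : c \in b by apply/negPn/negP => /Ab h; apply: nA; exists i0; left.
  by exists (inr (SeqSub cb)).
have [l hl] := choice lex.
have l1 c i : l c = inl i <-> A' i c.
  split; first by have := hl c; case: (l c) => // j h [<-].
  move=> Ai; have := hl c; case: (l c) => [j Aj|x [_ nA]].
    by rewrite (extend_disjoint Ai Aj).
  by case: nA; exists i.
have l2 c x : l c = inr x -> ssval x = c by have := hl c; case: (l c) => // y [h _] [<-].
pose e : rel W := fun x y => `[< x != y /\ touch l x y >].
pose S := [set x : W | `[< exists c, l c = x >]].
exists W, S, e, (fun i => inl i); split.
- by move=> i j [].
- exists l; split.
  + case=> [i|x].
      have -> : (fun c => l c = inl i) = A' i by apply/funext => c; apply/propext; exact: l1.
      exact: connT_extend.
    by move=> P _ a a' /l2 <- /l2 <-.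
  + by move=> x; rewrite inE; split => /asboolP.
  + by move=> x y; split => /asboolP.
  + by exists (inl i0), b => c /Ab h; apply/l1; left.
- move=> k; apply/asboolP; split.
    by apply/eqP => -[E']; apply: nst E'.
  have [c [d [cd h h']]] := extend_touch k.
  by exists c, d; split => //; apply/l1.
Qed.
End Assemble.

(** * Grids in the plane *)

From mathcomp Require Import all_classical all_reals all_analysis lra.
Import numFieldNormedType.Exports.
Local Open Scope classical_set_scope.
Local Open Scope ring_scope.

Lemma connected_locally_constant (T : topologicalType) (K : set T) (Q : T -> Prop) :
  connected K -> (forall x, K x -> \forall y \near x, K y -> (Q x <-> Q y)) ->
  forall x y, K x -> K y -> Q x -> Q y.
Proof.
move=> cK hQ x y Kx Ky Qx.
suff : K `&` Q = K by move=> E; have : (K `&` Q) y by [rewrite E]; case.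
apply: cK; first by exists x.
- exists (interior [set z | K z -> Q z]); first exact: open_interior.
  apply/seteqP; split => z [Kz hz]; split => //.
    by apply: filterS (hQ z Kz) => w hw /hw [] /(_ hz).
  exact: (interior_subset hz).
- exists (~` (interior [set z | K z -> ~ Q z])); first by apply: open_closedC; exact: open_interior.
  apply/seteqP; split => z [Kz hz]; split => //.
    by move=> /interior_subset /(_ Kz).
  apply: contrapT => nQ; apply: hz.
  by apply: filterS (hQ z Kz) => w hw /hw [_ h] Qw; apply: nQ; apply: h.
Qed.

Section Plane.
Variable R : realType.
Local Notation plane := (R * R)%type.
Implicit Types (x y a b : plane) (K L U : set plane).

Lemma compact_sep K L : compact K -> compact L -> K `&` L = set0 ->
  exists2 eps : R, 0 < eps & forall x y, K x -> L y -> eps <= `|x - y|.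
Proof.
move=> cK cL dis.
pose f (p : plane * plane) : R := `|p.1 - p.2|.
have cf : continuous f.
  move=> p; apply: cvg_norm; apply: cvgB; [exact: cvg_fst|exact: cvg_snd].
have cI : compact (f @` (K `*` L)).
  by apply: continuous_compact; [exact: continuous_subspaceT|exact: compact_setX].
have clI := compact_closed (@Rhausdorff R) cI.
have n0 : (~` (f @` (K `*` L))) 0.
  move=> [[x y] [/= Kx Ly]]; rewrite /f /= => /normr0_eq0/eqP; rewrite subr_eq0 => /eqP xy.
  by have : (K `&` L) x by [split => //; rewrite xy]; rewrite dis.
have /nbhs_ballP[e /= e0 he] : nbhs (0 : R) (~` (f @` (K `*` L))).
  by apply: open_nbhs_nbhs; split => //; apply: closed_openC.
exists e => // x y Kx Ly; rewrite leNgt; apply/negP => lt.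
apply: (he (f (x, y))); last by exists (x, y).
by rewrite /ball /= sub0r normrN normr_id.
Qed.

(* Index of the half-open grid square of side [h] containing [x]. *)
Definition phi (h : R) x : cell := (Num.floor (x.1 / h), Num.floor (x.2 / h)).

Lemma phi_dist h x y : 0 < h -> phi h x = phi h y -> `|x - y| < h.
Proof.
move=> h0 [e1 e2]; rewrite prod_normE gt_max /=.
have key (a b : R) : Num.floor (a / h) = Num.floor (b / h) -> `|a - b| < h.
  move=> E; have /andP[a1 a2] := floor_itv (a / h); have /andP[b1 b2] := floor_itv (b / h).
  rewrite E in a1 a2; rewrite intrD in a2 b2.
  have : `|a / h - b / h| < 1 by rewrite ltr_norml; apply/andP; split; lra.
  by rewrite -mulrBl normrM normfV (gtr0_norm h0) ltr_pdivrMr // mul1r.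
by rewrite !key.
Qed.

Lemma floor_near (t : R) : \forall s \near t, Num.floor s = Num.floor t \/ Num.floor s = Num.floor t - 1.
Proof.
have /andP[t1 t2] := floor_itv t; rewrite intrD in t2.
apply/nbhs_ballP; exists (Num.min 1 ((Num.floor t)%:~R + 1 - t)) => /=.
  by rewrite lt_min ltr01 /=; lra.
move=> s; rewrite /ball /= lt_min !ltr_norml => /andP[/andP[h1 h2] /andP[h3 h4]].
have l1 : Num.floor s < Num.floor t + 1 by rewrite floor_lt_int intrD; lra.
have l2 : Num.floor t - 1 <= Num.floor s by rewrite floor_ge_int intrB; lra.
by have [->|->] : Num.floor s = Num.floor t \/ Num.floor s = Num.floor t - 1 by [lia]; [left|right].
Qed.

(* Since squares are half-open, the squares of points close to [x] only differ from that
   of [x] by [(0,0)], [(1,0)], [(0,1)] or [(1,1)]: this is adjacency in the lattice. *)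
Lemma phi_near h x : \forall y \near x, phi h y = phi h x \/ adjT (phi h y) (phi h x).
Proof.
have c1 : (fun y : plane => y.1 / h) y @[y --> x] --> x.1 / h.
  by apply: cvgM; [exact: cvg_fst|exact: cvg_cst].
have c2 : (fun y : plane => y.2 / h) y @[y --> x] --> x.2 / h.
  by apply: cvgM; [exact: cvg_snd|exact: cvg_cst].
have n1 : \forall y \near x, Num.floor (y.1 / h) = Num.floor (x.1 / h) \/
    Num.floor (y.1 / h) = Num.floor (x.1 / h) - 1 := c1 _ (floor_near (x.1 / h)).
have n2 : \forall y \near x, Num.floor (y.2 / h) = Num.floor (x.2 / h) \/
    Num.floor (y.2 / h) = Num.floor (x.2 / h) - 1 := c2 _ (floor_near (x.2 / h)).
move: n1 n2; apply: filterS2 => y /= h1 h2; rewrite /phi /adjT.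
case: h1 h2 => [->|->] [->|->]; [by left|right|right|right]; rewrite xpair_eqE /=; lia.
Qed.

Lemma phi_connected h K : connected K -> connT (fun c => exists2 x, K x & phi h x = c).
Proof.
move=> cK P hP _ _ [x Kx <-] [y Ky <-].
apply: (connected_locally_constant (Q := fun x => P (phi h x)) cK _ Kx Ky) => z Kz.
apply: filterS (phi_near h z) => w hw Kw.
case: hw => [->//|adj]; have adj' := adj; rewrite adjT_sym in adj'.
by split; apply: hP => //; [exists z|exists w|exists w|exists z].
Qed.

Definition segm (a b : plane) : set plane := (fun t : R => a + t *: (b - a)) @` `[0, 1].

Lemma segm_continuous a b : continuous (fun t : R => a + t *: (b - a)).
Proof. by move=> t; apply: cvgD; [exact: cvg_cst|apply: cvgZr_tmp; exact: cvg_id]. Qed.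

Lemma segm_compact a b : compact (segm a b).
Proof.
by apply: continuous_compact; [exact/continuous_subspaceT/segm_continuous|exact: segment_compact].
Qed.

Lemma segm_connected a b : connected (segm a b).
Proof.
apply: connected_continuous_connected; first exact: segment_connected.
exact/continuous_subspaceT/segm_continuous.
Qed.

Lemma segm_l a b : segm a b a.
Proof. by exists 0; rewrite ?scale0r ?addr0 //= in_itv /= lexx ler01. Qed.

Lemma segm_r a b : segm a b b.
Proof. by exists 1; rewrite ?scale1r /= ?in_itv /= ?lexx ?ler01 // addrC subrK. Qed.

Lemma segm_norm a b x : segm a b x -> `|x - a| <= `|b - a|.
Proof.
move=> [t /=]; rewrite in_itv /= => /andP[t0 t1] <-.
by rewrite addrC addKr normrZ (ger0_norm t0) ler_piMl.
Qed.

(** The set [K], a finite union of segments, replaces a path; its compactness lets a fine grid keep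
    it apart from the drawing. *)
Lemma open_component_path U x y : open U -> connected_component U x y ->
  exists K, [/\ compact K, connected K, K `<=` U, K x & K y].
Proof.
move=> oU [C [Cx CU cC] Cy].
apply: (connected_locally_constant
  (Q := fun y => exists K, [/\ compact K, connected K, K `<=` U, K x & K y]) cC _ Cx Cy).
  move=> z Cz; have /nbhs_ballP[e /= e0 he] : nbhs z U.
    by apply: open_nbhs_nbhs; split => //; apply: CU.
  apply/nbhs_ballP; exists e => //= w zw Cw.
  have sU : segm z w `<=` U.
    move=> p /segm_norm hp; apply: he; rewrite -ball_normE /= distrC.
    by apply: le_lt_trans hp _; move: zw; rewrite -ball_normE /= distrC.
  have join a b : segm z w a -> segm z w b ->
     (exists K, [/\ compact K, connected K, K `<=` U, K x & K a]) ->
     exists K, [/\ compact K, connected K, K `<=` U, K x & K b].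
    move=> sa sb [K [h1 h2 h3 h4 h5]]; exists (K `|` segm z w); split.
    - by apply: compactU => //; exact: segm_compact.
    - by apply: connectedU => //; [exists a|exact: segm_connected].
    - by move=> p [/h3|/sU].
    - by left.
    - by right.
  by split; apply: join; [exact: segm_l|exact: segm_r|exact: segm_r|exact: segm_l].
exists [set x]; split => //.
- exact: compact_set1.
- exact: connected1.
- by move=> _ ->; apply: CU.
Qed.

End Plane.

(** * Discretizing a plane graph *)

(** Asking for all smaller [r] as well allows taking the minimum of the thresholds. *)
Lemma fin_small (R : realType) (I : finType) (P : I -> R -> Prop) :
  (forall i, exists2 e, 0 < e & forall r, 0 < r -> r <= e -> P i r) ->
  exists2 e, 0 < e & forall r, 0 < r -> r <= e -> forall i, P i r.
Proof.
move=> h.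
suff H (s : seq I) : exists2 e, 0 < e & forall r, 0 < r -> r <= e -> forall i, i \in s -> P i r.
  have [e e0 he] := H (enum I); exists e => // r r0 re i; apply: he => //; exact: mem_enum.
elim: s => [|i s [e e0 he]]; first by exists 1.
have [e' e'0 he'] := h i; exists (Num.min e e'); first by rewrite lt_min e0 e'0.
move=> r r0; rewrite le_min => /andP[re re'] j; rewrite inE => /predU1P[->|js]; first exact: he'.
exact: he.
Qed.

Lemma fin_bound (R : realType) (I : finType) (K : I -> set (R * R)) :
  (forall i, compact (K i)) -> exists M : R, forall i x, K i x -> `|x| <= M.
Proof.
move=> cK.
suff H (s : seq I) : exists M : R, forall i x, i \in s -> K i x -> `|x| <= M.
  by have [M hM] := H (enum I); exists M => i x; apply: hM; exact: mem_enum.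
elim: s => [|i s [M hM]]; first by exists 0.
have [M' [_ hM']] := compact_bounded (cK i).
exists (Num.max M (M' + 1)) => j x; rewrite inE le_max => /predU1P[->|js] Kx.
  by apply/orP; right; apply: (hM' (M' + 1)) => //; rewrite ltrDl.
by rewrite (hM j).
Qed.

Lemma not_bounded (R : realType) (C : set (R * R)) (M : R) : ~ bounded_set C ->
  exists2 y, C y & M < `|y|.
Proof.
move=> nb; apply: contrapT => h; apply: nb; exists M; split; first exact: num_real.
move=> M' MM' y Cy.
apply: le_trans (ltW MM'); rewrite leNgt; apply/negP => lt; apply: h; by exists y.
Qed.

Lemma compact_bigcup_fin (T : topologicalType) (I : finType) (F : I -> set T) :
  (forall i, compact (F i)) -> compact (\bigcup_(i in [set: I]) F i).
Proof.
move=> cF; have -> : \bigcup_(i in [set: I]) F i = \big[setU/set0]_(i <- enum I) F i.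
  rewrite -bigcup_seq; apply: eq_bigcupl; split => i //= _.
  exact: mem_enum.
exact: bigsetU_compact.
Qed.

Section PlaneGraph.
Variables (R : realType) (G : plane_graph R).
Local Notation plane := (R * R)%type.
Implicit Types (u v w a b c d : G) (x y : plane) (s t : R).

Definition arc_of (f : G -> G -> R -> plane) := forall u v, adj u v ->
  [/\ {within `[0, 1], continuous (f u v)}, {in `[0, 1] &, injective (f u v)},
      f u v 0 = pt u, f u v 1 = pt v & edge_arc u v = f u v @` `[0, 1]].

Lemma arc_exists : exists f, arc_of f.
Proof.
have h (p : G * G) : exists f : R -> plane, adj p.1 p.2 ->
  [/\ {within `[0, 1], continuous f}, {in `[0, 1] &, injective f},
      f 0 = pt p.1, f 1 = pt p.2 & edge_arc p.1 p.2 = f @` `[0, 1]].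
  have [uv|nuv] := boolP (adj p.1 p.2); last by exists (fun=> 0).
  by have [f hf] := edge_arcP uv; exists f.
by have [f hf] := choice h; exists (fun u v => f (u, v)) => u v; apply: (hf (u, v)).
Qed.

Variable f : G -> G -> R -> plane.
Hypothesis hf : arc_of f.

(** [f u v] and [f v u] may parametrise the same arc in unrelated ways; fixing a direction selects
    one of them. *)
Definition oedge a b : bool := adj a b && (enum_rank a < enum_rank b)%N.

Lemma oedge_or a b : adj a b -> oedge a b || oedge b a.
Proof.
move=> ab; rewrite /oedge [adj b a]adj_sym ab /=.
have : a != b by apply: contraTneq ab => ->; rewrite adj_irr.
by rewrite -(inj_eq enum_rank_inj) -val_eqE /=; case: ltngtP.
Qed.

Lemma itvP (s : R) : (s \in `[0, 1]) = (0 <= s <= 1).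
Proof. by rewrite in_itv. Qed.

Lemma arc_vertex a b w s : oedge a b -> 0 <= s <= 1 -> f a b s = pt w ->
  (w = a /\ s = 0) \/ (w = b /\ s = 1).
Proof.
move=> /andP[ab _] s01 fs; have [_ fi f0 f1 fE] := hf ab.
have w2 : w = a \/ w = b.
  apply: contrapT => nw; apply: (@edge_arc_pt _ G a b w ab); split.
    by rewrite fE; exists s => //=; rewrite itvP.
  by case=> /pt_inj h; apply: nw; [left|right].
case: w2 => wE; [left|right]; split => //; apply: fi; rewrite ?itvP ?lexx ?ler01 //.
  by rewrite fs f0 wE.
by rewrite fs f1 wE.
Qed.

Lemma arc_meet a b c d s t : oedge a b -> oedge c d -> 0 <= s <= 1 -> 0 <= t <= 1 ->
  f a b s = f c d t -> [/\ a = c, b = d & s = t] \/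
   exists2 w, (w = a /\ s = 0) \/ (w = b /\ s = 1) & (w = c /\ t = 0) \/ (w = d /\ t = 1).
Proof.
move=> oab ocd s01 t01 E; have /andP[ab rab] := oab; have /andP[cd rcd] := ocd.
have [_ fi f0 f1 fE] := hf ab; have [_ gi g0 g1 gE] := hf cd.
have [[ac bd]|ne] := pselect (a = c /\ b = d).
  by left; split => //; apply: fi; rewrite ?itvP // E ac bd.
right.
have nset : ([set a; b] != [set c; d])%SET.
  apply/eqP => /setP S; apply: ne.
  have := S a; have := S b; rewrite !inE !eqxx ?orbT /=.
  move=> /esym/orP[]/eqP bE /esym/orP[]/eqP aE; move: rab; rewrite ?aE ?bE ?ltnn // => rdc.
  by have := ltn_trans rdc rcd; rewrite ltnn.
have mem1 : edge_arc a b (f a b s) by rewrite fE; exists s => //=; rewrite itvP.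
have mem2 : edge_arc c d (f a b s) by rewrite E gE; exists t => //=; rewrite itvP.
have [w fw] : exists w, f a b s = pt w.
  apply: contrapT => nw.
  have : ((edge_arc a b `\` [set pt a; pt b]) `&` edge_arc c d) (f a b s).
    by split => //; split => // -[] h; apply: nw; [exists a|exists b].
  by rewrite edge_arc_disj.
by exists w; [apply: arc_vertex fw|apply: (arc_vertex ocd t01); rewrite -E].
Qed.

(* The star of [v]: the third next to [v] of every arc at [v]. *)
Definition nearv v x : Prop := x = pt v \/ exists a b t,
  [/\ oedge a b, 0 <= t <= 1, x = f a b t & (v = a /\ t <= 3^-1) \/ (v = b /\ 2 / 3 <= t)].

Definition mid a b : set plane := f a b @` `[3^-1, 2 / 3].

Lemma nearv_disjoint u v x : nearv u x -> nearv v x -> u = v.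
Proof.
have end1 w a b t u' : oedge a b -> (w = a /\ t = 0) \/ (w = b /\ t = 1) ->
    (u' = a /\ t <= 3^-1) \/ (u' = b /\ 2 / 3 <= t) -> w = u'.
  by move=> _ [[-> ->]|[-> ->]] [[-> h]|[-> h]] //; exfalso; lra.
case=> [xu|[a [b [s [oab s01 xs hs]]]]] [xv|[c [d [t [ocd t01 xt ht]]]]].
- by apply: pt_inj; rewrite -xu xv.
- by apply: (end1 _ c d t _ ocd _ ht); apply: arc_vertex => //; rewrite -xt.
- by apply/esym; apply: (end1 _ a b s _ oab _ hs); apply: arc_vertex => //; rewrite -xs.
have E : f a b s = f c d t by rewrite -xs.
case: (arc_meet oab ocd s01 t01 E) => [[ac bd st]|[w hw hw']].
  subst c d t; case: hs ht => [[-> h]|[-> h]] [[-> h']|[-> h']] //; exfalso; lra.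
by rewrite -(end1 _ _ _ _ _ oab hw hs) (end1 _ _ _ _ _ ocd hw' ht).
Qed.

Lemma mid01 a b x : mid a b x -> exists t, [/\ 0 <= t <= 1, 3^-1 <= t, t <= 2 / 3 & x = f a b t].
Proof. by move=> [t /=]; rewrite in_itv /= => /andP[h1 h2] <-; exists t; split => //; lra. Qed.

Lemma mid_nearv a b v x : oedge a b -> mid a b x -> nearv v x -> v = a \/ v = b.
Proof.
move=> oab /mid01[s [s01 s1 s2 ->]] [xv|[c [d [t [ocd t01 xt ht]]]]].
  by case: (arc_vertex oab s01 xv) => -[_ sE]; move: s1 s2; rewrite sE; clear => *; exfalso; lra.
case: (arc_meet oab ocd s01 t01 xt) => [[-> -> _]|[w hw _]].
  by case: ht => -[-> _]; [left|right].
by case: hw => -[_ sE]; move: s1 s2; rewrite sE; clear => *; exfalso; lra.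
Qed.

Lemma mid_mid a b c d x : oedge a b -> oedge c d -> mid a b x -> mid c d x -> a = c /\ b = d.
Proof.
move=> oab ocd /mid01[s [s01 s1 s2 ->]] /mid01[t [t01 t1 t2 E]].
case: (arc_meet oab ocd s01 t01 E) => [[-> -> _]//|[w hw _]].
by case: hw => -[_ sE]; move: s1 s2; rewrite sE; clear => *; exfalso; lra.
Qed.

Lemma arc_sub_compact a b (s t : R) : oedge a b -> 0 <= s -> t <= 1 ->
  compact (f a b @` `[s, t]) /\ connected (f a b @` `[s, t]).
Proof.
move=> /andP[ab _] s0 t1; have [fc _ _ _ _] := hf ab.
have {}fc : {within `[s, t], continuous (f a b)}.
  apply: continuous_subspaceW fc => r /=; rewrite !in_itv /= => /andP[h1 h2].
  by rewrite (le_trans s0 h1) (le_trans h2 t1).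
split; first by apply: continuous_compact => //; exact: segment_compact.
by apply: connected_continuous_connected => //; exact: segment_connected.
Qed.

(** The default [[set pt v]] makes every piece compact, connected and incident with [pt v], so the
    star is a finite union over all pairs. *)
Definition piece v (p : G * G) : set plane :=
  if oedge p.1 p.2 then
    (if v == p.1 then f p.1 p.2 @` `[0, 3^-1] else
     if v == p.2 then f p.1 p.2 @` `[2 / 3, 1] else [set pt v])
  else [set pt v].

Lemma nearvE v : [set x | nearv v x] = \bigcup_(p in [set: G * G]) piece v p `|` [set pt v].
Proof.
apply/seteqP; split => x /=.
  case=> [->|[a [b [t [oab t01 -> ht]]]]]; first by right.
  have nab : a != b by case/andP: oab => ab _; apply: contraTneq ab => ->; rewrite adj_irr.
  left; exists (a, b) => //; rewrite /piece /= oab.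
  case: ht => -[-> h]; rewrite ?eqxx 1?eq_sym ?(negPf nab); exists t => //=; rewrite in_itv /=; lra.
case=> [[[a b] _]|->]; last by left.
rewrite /piece /=; case: ifP => oab; last by move=> ->; left.
case: eqP => [->|_] /=.
  move=> [t /=]; rewrite in_itv /= => /andP[h1 h2] <-; right; exists a, b, t; split => //; first by lra.
  by left.
case: eqP => [->|_] /=; last by move=> ->; left.
move=> [t /=]; rewrite in_itv /= => /andP[h1 h2] <-; right; exists a, b, t; split => //; first by lra.
by right.
Qed.

Lemma piece_ok v p : [/\ compact (piece v p), connected (piece v p) & piece v p (pt v)].
Proof.
rewrite /piece; case: ifP => oab; last by split; [exact: compact_set1|exact: connected1|].
have [_ _ f0 f1 _] := hf (proj1 (andP oab)).
case: eqP => [->|_].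
  have [] := @arc_sub_compact _ _ 0 3^-1 oab; [by []|by lra|move=> h1 h2; split => //].
  by exists 0; rewrite ?f0 //= in_itv /= lexx; lra.
case: eqP => [->|_]; last by split; [exact: compact_set1|exact: connected1|].
have [] := @arc_sub_compact _ _ (2 / 3) 1 oab; [by lra|by []|move=> h1 h2; split => //].
by exists 1; rewrite ?f1 //= in_itv /= lexx; lra.
Qed.

Lemma nearv_compact v : compact [set x | nearv v x].
Proof.
rewrite nearvE; apply: compactU; last exact: compact_set1.
by apply: compact_bigcup_fin => p; have [] := piece_ok v p.
Qed.

Lemma nearv_connected v : connected [set x | nearv v x].
Proof.
rewrite nearvE; apply: connectedU; last exact: connected1.
  exists (pt v); split => //; exists (v, v) => //; by have [] := piece_ok v (v, v).
apply: bigcup_connected => [|p _]; last by have [] := piece_ok v p.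
by exists (pt v) => p _; have [] := piece_ok v p.
Qed.

Lemma mid_ok a b : oedge a b -> compact (mid a b) /\ connected (mid a b).
Proof. by move=> oab; apply: arc_sub_compact => //; lra. Qed.

Lemma nearv_drawing v x : nearv v x -> drawing G x.
Proof.
case=> [->|[a [b [t [/andP[ab _] t01 -> _]]]]]; first by left; exists v.
by right; exists a, b; have [_ _ _ _ ->] := hf ab; split => //; exists t => //=; rewrite itvP.
Qed.

Lemma mid_drawing a b x : oedge a b -> mid a b x -> drawing G x.
Proof.
move=> /andP[ab _] /mid01[t [t01 _ _ ->]].
by right; exists a, b; have [_ _ _ _ ->] := hf ab; split => //; exists t => //=; rewrite itvP.
Qed.

Lemma drawing_closed : closed (drawing G).
Proof.
pose F (p : G * G) : set plane := if oedge p.1 p.2 then f p.1 p.2 @` `[0, 1] else set0.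
have -> : drawing G = \bigcup_(v in [set: G]) [set pt v] `|` \bigcup_(p in [set: G * G]) F p.
  apply/seteqP; split => x.
    case=> [[v _ <-]|[u [v [uv]]]]; first by left; exists v.
    move=> ex; right; case/orP: (oedge_or uv) => o.
      by exists (u, v) => //; rewrite /F /= o; have [_ _ _ _ <-] := hf uv.
    exists (v, u) => //; rewrite /F /= o; have vu : adj v u by rewrite adj_sym.
    by have [_ _ _ _ <-] := hf vu; rewrite -edge_arcC.
  case=> [[v _ ->]|[[u v] _]]; first by left; exists v.
  rewrite /F /=; case: ifP => // /andP[uv _] ex; right; exists u, v; split => //.
  by have [_ _ _ _ ->] := hf uv.
apply: compact_closed; first exact: norm_hausdorff.
apply: compactU; first by apply: compact_bigcup_fin => v; exact: compact_set1.
apply: compact_bigcup_fin => p; rewrite /F; case: ifP => [oe|_]; last exact: compact0.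
by have [] := @arc_sub_compact _ _ 0 1 oe.
Qed.

(** The room for short segments from boundary vertices into the outer face; [r + r] keeps the
    segments at two vertices disjoint. *)
Lemma vertex_room : exists2 r : R, 0 < r & forall v,
  [/\ forall w x, w != v -> nearv w x -> r <= `|x - pt v|,
      forall a b x, oedge a b -> mid a b x -> r <= `|x - pt v| &
      forall w, w != v -> r + r <= `|pt w - pt v|].
Proof.
pose P (p : G * (G * G)) (r : R) :=
  [/\ forall x, p.2.1 != p.1 -> nearv p.2.1 x -> r <= `|x - pt p.1|,
      forall x, oedge p.2.1 p.2.2 -> mid p.2.1 p.2.2 x -> r <= `|x - pt p.1| &
      p.2.1 != p.1 -> r + r <= `|pt p.2.1 - pt p.1|].
suff [r r0 hr] : exists2 e, 0 < e & forall r, 0 < r -> r <= e -> forall i, P i r.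
  exists r => // v; have {}hr := hr r r0 (lexx r); split.
  - by move=> w x wv; have [h _ _] := hr (v, (w, w)); apply: h.
  - by move=> a b x o; have [_ h _] := hr (v, (a, b)); apply: h.
  - by move=> w wv; have [_ _ h] := hr (v, (w, w)); apply: h.
apply: fin_small => -[v [a b]]; rewrite /P /=.
have sep1 K : compact K -> ~ K (pt v) -> exists2 e : R, 0 < e & forall x, K x -> e <= `|x - pt v|.
  move=> cK nK; have [|e e0 he] := compact_sep cK (@compact_set1 _ (pt v)).
    by rewrite -subset0 => x [Kx xv]; apply: nK; rewrite -xv.
  by exists e => // x Kx; apply: he.
have pv : nearv v (pt v) by left.
have [e1 e10 h1] : exists2 e : R, 0 < e & forall x, a != v -> nearv a x -> e <= `|x - pt v|.
  case: (eqVneq a v) => av; first by exists 1.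
  have [|e e0 he] := sep1 _ (@nearv_compact a); last by exists e => // x _ /he.
  by move=> h; move/eqP: av; apply; apply: nearv_disjoint h pv.
have [e2 e20 h2] : exists2 e : R, 0 < e & forall x, oedge a b -> mid a b x -> e <= `|x - pt v|.
  case: (boolP (oedge a b)) => oab; last by exists 1.
  have [|e e0 he] := sep1 _ (proj1 (mid_ok oab)); last by exists e => // x _ /he.
  move=> /mid01[t [t01 t1 t2 /esym E]]; case: (arc_vertex oab t01 E) => -[_ tE];
    by move: t1 t2; rewrite tE; clear => *; lra.
have [e3 e30 h3] : exists2 e : R, 0 < e & (a != v -> e + e <= `|pt a - pt v|).
  case: (eqVneq a v) => av; first by exists 1.
  exists (`|pt a - pt v| / 2); last by move=> _; rewrite -splitr.
  by rewrite divr_gt0 // normr_gt0 subr_eq0; apply: contraNneq av => /pt_inj ->.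
exists (Num.min e1 (Num.min e2 e3)); first by rewrite !lt_min e10 e20 e30.
move=> r r0; rewrite !le_min => /and3P[r1 r2 r3]; split.
- by move=> x av nx; apply: le_trans r1 (h1 _ av nx).
- by move=> x o mx; apply: le_trans r2 (h2 _ o mx).
- by move=> av; apply: le_trans (h3 av); apply: lerD.
Qed.

End PlaneGraph.

(** * Grids fine enough for finitely many compact sets *)

Section Grid.
Variable R : realType.
Local Notation plane := (R * R)%type.

Definition cells (h : R) (K : set plane) (c : cell) : Prop := exists2 x, K x & phi h x = c.

Lemma fine_grid (J : finType) (F : J -> set plane) : (forall j, compact (F j)) ->
  exists2 h : R, 0 < h <= 1 & forall i j, F i `&` F j = set0 ->
    forall c, cells h (F i) c -> ~ cells h (F j) c.
Proof.
move=> cF.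
have [p|e e0 he] := @fin_small R (J * J)%type (fun p h => F p.1 `&` F p.2 = set0 ->
    forall c, cells h (F p.1) c -> ~ cells h (F p.2) c).
  have [dis|ndis] := pselect (F p.1 `&` F p.2 = set0); last by exists 1.
  have [e e0 he] := compact_sep (cF p.1) (cF p.2) dis; exists e => // r r0 re _ c [x Fx xc] [y Fy yc].
  have lt := phi_dist r0 (etrans xc (esym yc)).
  by have := he x y Fx Fy; rewrite leNgt (lt_le_trans lt re).
exists (Num.min e 1); first by rewrite lt_min e0 ltr01 ge_min lexx orbT.
move=> i j; apply: (he _ _ _ (i, j)); first by rewrite lt_min e0 ltr01.
by rewrite ge_min lexx.
Qed.

(** As [h <= 1], a margin of 4 in the plane is at least 4 squares, which covers the 2 added to the
    box and the rounding. *)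
Lemma grid_box (h M : R) : 0 < h <= 1 -> 0 <= M -> exists n : nat,
  (forall x : plane, `|x| <= M -> phi h x \in box n) /\
  (forall x : plane, M + 4 < `|x| -> phi h x \notin box n).
Proof.
move=> /andP[h0 h1] M0.
have N0 : 0 <= Num.floor (M / h) by rewrite floor_ge_int divr_ge0 // ltW.
exists (`|Num.floor (M / h)|%N + 2)%N.
have nE : (`|Num.floor (M / h)|%N + 2)%N%:Z = Num.floor (M / h) + 2 by lia.
have /andP[N1 N2] := floor_itv (M / h); rewrite intrD in N2.
split => x; rewrite mem_box nE prod_normE /phi /=.
  rewrite ge_max => /andP[x1 x2].
  have key (t : R) : `|t| <= M -> - (Num.floor (M / h) + 2) <= Num.floor (t / h) <= Num.floor (M / h) + 2.
    rewrite ler_norml => /andP[t1 t2].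
    have a1 : t / h <= M / h by rewrite ler_pM2r // invr_gt0.
    have a2 : - (M / h) <= t / h by rewrite -mulNr ler_pM2r // invr_gt0.
    have b1 : - (Num.floor (M / h) + 2) <= Num.floor (t / h).
      by rewrite floor_ge_int intrN intrD; lra.
    have b2 : Num.floor (t / h) < Num.floor (M / h) + 2.
      by rewrite floor_lt_int intrD; lra.
    by rewrite b1 ltW.
  by have := key _ x1; have := key _ x2; lia.
rewrite lt_max => hx.
have key (t : R) : M + 4 < `|t| -> (Num.floor (M / h) + 2 < Num.floor (t / h)) || (Num.floor (t / h) < - (Num.floor (M / h) + 2)).
  have i1 : 1 <= h^-1 by rewrite invf_ge1.
  have i0 : 0 < h^-1 by rewrite invr_gt0.
  have m4 : M / h + 4 <= (M + 4) / h by rewrite mulrDl; nra.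
  rewrite ltr_normr => /orP[t1|t1]; apply/orP; [left|right].
    have a1 : (M + 4) / h < t / h by rewrite ltr_pM2r.
    suff : Num.floor (M / h) + 3 <= Num.floor (t / h) by lia.
    by rewrite floor_ge_int intrD; lra.
  have a1 : (M + 4) / h < - t / h by rewrite ltr_pM2r.
  rewrite floor_lt_int intrN intrD; rewrite mulNr in a1; lra.
by case/orP: hx => /key; lia.
Qed.
End Grid.

Section Discretize.
Variables (R : realType) (G : plane_graph R).
Local Notation plane := (R * R)%type.

(** The cores are the stars of the vertices and, for [None], the far cells with the sets [K v]; the
    connectors are the middle thirds of the arcs and the segments from [pt v] to [p v]. *)
Lemma plane_graph_planar : exists (W : finType) (S : {set W}) (e : rel W) (i : option G -> W),
  [/\ injective i, planar S e, forall a b : G, adj a b -> e (i (Some a)) (i (Some b)) &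
      forall v : G, boundary_vertex v -> e (i None) (i (Some v))].
Proof.
have [f hf] := arc_exists G.
have [r r0 hr] := vertex_room hf.
have exp (v : G) : exists q : plane, boundary_vertex v -> @outer_face R G q /\ `|q - pt v| < r.
  have [[cv _]|nb] := pselect (boundary_vertex v); last by exists 0.
  have [q [oq bq]] := cv _ (nbhsx_ballx (pt v) r r0).
  by exists q => _; split => //; move: bq; rewrite -ball_normE /= distrC.
have [p hp] := choice exp.
pose B (v : G) := `[< boundary_vertex v >].
pose near' v : set plane := [set x | nearv f v x].
pose mid' (q : G * G) : set plane := if oedge q.1 q.2 then mid f q.1 q.2 else set0.
pose seg v : set plane := if B v then segm (pt v) (p v) else set0.
have cnear v : compact (near' v) by apply: nearv_compact.
have cmid q : compact (mid' q).
  by rewrite /mid'; case: ifP => [oe|_]; [have [] := mid_ok hf oe|exact: compact0].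
have cseg v : compact (seg v) by rewrite /seg; case: ifP => _; [exact: segm_compact|exact: compact0].
have segr v x : seg v x -> `|x - pt v| < r.
  rewrite /seg; case: ifP => // /asboolP /hp[_ h] /segm_norm hx; exact: le_lt_trans hx h.
pose F (j : G + G * G + G) : set plane :=
  match j with inl (inl v) => near' v | inl (inr q) => mid' q | inr v => seg v end.
have cF j : compact (F j) by case: j => [[v|q]|v] /=.
have [M0 hM0] := fin_bound cF.
pose M := `|M0|.
have hM j x : F j x -> `|x| <= M by move=> /hM0 h; apply: le_trans h (ler_norm _).
(* The outer face is unbounded, so [p v] can be joined off the drawing to a point whose cell lies
   outside the box. *)
have exK (v : G) : exists Q : set plane, [/\ compact Q, Q `<=` ~` drawing G &
    boundary_vertex v -> [/\ connected Q, Q (p v) & exists2 y, Q y & M + 4 < `|y|]].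
  have [bv|nb] := pselect (boundary_vertex v); last first.
    by exists set0; split => //; exact: compact0.
  have [[_ /(not_bounded (M + 4))[y Cy My]] _] := hp v bv.
  have [K [h1 h2 h3 h4 h5]] := open_component_path (closed_openC (drawing_closed hf)) Cy.
  by exists K; split => // _; split => //; exists y.
have [K hK] := choice exK.
pose F' (j : G + G * G + G + G) : set plane := match j with inl j => F j | inr v => K v end.
have cF' j : compact (F' j) by case: j => [j|v] //=; have [] := hK v.
have [h h01 hh] := fine_grid cF'.
have [n [nin nout]] := grid_box h01 (normr_ge0 M0).
have far : M + 4 < `|(M + 5, 0) : plane|.
  have l5 : M + 4 < M + 5 by rewrite ltrD2l ltr_nat.
  by apply: lt_le_trans l5 _; rewrite prod_normE /= le_max ler_norm.
pose out (c : cell) := c \notin box n.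
have Fout j c : cells h (F j) c -> ~ out c.
  by move=> [x Fx <-]; rewrite /out => /negP; apply; apply: nin; apply: hM Fx.
have Fdraw j : (forall v, j <> inr v) -> F j `<=` drawing G.
  case: j => [[v|[a b]]|v] //= h0 x; first exact: (nearv_drawing hf).
    by rewrite /mid'; case: ifP => //= oe; apply: (mid_drawing hf).
  by case: (h0 v).
have FK j v c : (forall w, j <> inr w) -> cells h (F j) c -> ~ cells h (K v) c.
  move=> hj; apply: (hh (inl j) (inr v)); rewrite -subset0 => x [/= Fx Kx].
  by have [_ KU _] := hK v; apply: (KU _ Kx); apply: Fdraw Fx.
pose A (i : option G) (c : cell) : Prop := match i with Some v => cells h (near' v) c
  | None => out c \/ exists v : {v : G | boundary_vertex v}, cells h (K (sval v)) c end.
pose valid (k : G * G + G) : bool := match k with inl q => oedge q.1 q.2 | inr v => B v end.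
pose E := {k : (G * G + G)%type | valid k}.
pose C (k : E) : cell -> Prop := match sval k with inl q => cells h (mid' q) | inr v => cells h (seg v) end.
pose s (k : E) : option G := match sval k with inl q => Some q.1 | inr v => Some v end.
pose t (k : E) : option G := match sval k with inl q => Some q.2 | inr v => None end.
have [||||||||||W [S [e [i [ii pl he]]]]] := @assemble (option G) E A C s t None (box n).
- case=> [v|] /=; first by apply: phi_connected; apply: nearv_connected.
  apply: connT_hub; first exact: connT_out.
  + by move=> [v bv] /=; have [_ _ /(_ bv)[cK _ _]] := hK v; apply: phi_connected.
  + move=> [v bv] /=; have [_ _ /(_ bv)[_ _ [y Ky My]]] := hK v.
    by exists (phi h y); [apply: nout|exists y].
  + by exists (phi h (M + 5, 0)); apply: nout.
- have sn v c : A (Some v) c -> ~ A None c.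
    move=> Ac [oc|[w wc]]; first exact: (Fout (inl (inl v)) c).
    exact: (FK (inl (inl v)) _ _ _ Ac wc).
  case=> [v|] [w|] c // Av Aw.
  + congr Some; apply: contrapT => vw.
    apply: (hh (inl (inl (inl v))) (inl (inl (inl w))) _ c Av Aw).
    by rewrite -subset0 => x [/= h1 h2]; apply: vw; apply: nearv_disjoint h1 h2.
  + by case: (sn v c).
  + by case: (sn w c).
- case=> [[[a b]|v] vk]; rewrite /C /=; apply: phi_connected.
    by rewrite /mid' /=; have -> : oedge a b by []; have [] := mid_ok hf vk.
  by rewrite /seg; have -> : B v by []; exact: segm_connected.
- case=> [[[a b]|v] vk]; rewrite /C /s /=.
    exists (phi h (f a b 3^-1)).
      exists (f a b 3^-1) => //; rewrite /mid' /=; have -> : oedge a b by [].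
      by exists 3^-1 => //=; rewrite in_itv /= lexx; lra.
    exists (f a b 3^-1) => //; right; exists a, b, 3^-1; split => //; first by lra.
    by left.
  exists (phi h (pt v)); exists (pt v) => //; last by left.
  by rewrite /seg; have -> : B v by []; exact: segm_l.
- case=> [[[a b]|v] vk]; rewrite /C /t /=.
    exists (phi h (f a b (2 / 3))).
      exists (f a b (2 / 3)) => //; rewrite /mid' /=; have -> : oedge a b by [].
      by exists (2 / 3) => //=; rewrite in_itv /= lexx andbT; lra.
    exists (f a b (2 / 3)) => //; right; exists a, b, (2 / 3); split => //; first by lra.
    by right.
  have bv : boundary_vertex v by apply/asboolP.
  exists (phi h (p v)).
    by exists (p v) => //; rewrite /seg; have -> : B v by []; exact: segm_r.
  by right; exists (exist _ v bv); have [_ _ /(_ bv)[_ Kp _]] := hK v; exists (p v).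
- case=> [[[a b]|v] vk] j c; rewrite /C /s /t /=.
    case: j => [w|] Cc Ac; last first.
      case: Ac => [oc|[w wc]]; first by case: (Fout (inl (inr (a, b))) c).
      by case: (FK (inl (inr (a, b))) (sval w) c).
    apply: contrapT => nw; apply: (hh (inl (inl (inr (a, b)))) (inl (inl (inl w))) _ c Cc Ac).
    rewrite -subset0 => x [/=]; rewrite /mid' /=; have -> : oedge a b by [].
    by move=> h1 h2; apply: nw; case: (mid_nearv hf vk h1 h2) => ->; [left|right].
  case: j => [w|]; last by right.
  move=> Cc Ac; left; congr Some; apply: contrapT => /eqP wv.
  apply: (hh (inl (inr v)) (inl (inl (inl w))) _ c Cc Ac).
  rewrite -subset0 => x [/= /segr h1 h2]; have [h3 _ _] := hr v.
  by have := h3 w x wv h2; rewrite leNgt h1.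
- case=> [[[a b]|v] vk] [[[a' b']|v'] vk'] c; rewrite /C /= => Cc Cc'; apply/val_inj => /=.
  + congr inl; apply: contrapT => ne.
    apply: (hh (inl (inl (inr (a, b)))) (inl (inl (inr (a', b')))) _ c Cc Cc').
    rewrite -subset0 => x [/=]; rewrite /mid' /=; have -> : oedge a b by []; have -> : oedge a' b' by [].
    by move=> h1 h2; apply: ne; have [] := mid_mid hf vk vk' h1 h2; rewrite /= => -> ->.
  + exfalso; apply: (hh (inl (inl (inr (a, b)))) (inl (inr v')) _ c Cc Cc').
    rewrite -subset0 => x [/= + /segr h2]; rewrite /mid' /=; have -> : oedge a b by [].
    by move=> h1; have [_ h3 _] := hr v'; have := h3 _ _ _ vk h1; rewrite leNgt h2.
  + exfalso; apply: (hh (inl (inl (inr (a', b')))) (inl (inr v)) _ c Cc' Cc).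
    rewrite -subset0 => x [/= + /segr h2]; rewrite /mid' /=; have -> : oedge a' b' by [].
    by move=> h1; have [_ h3 _] := hr v; have := h3 _ _ _ vk' h1; rewrite leNgt h2.
  + congr inr; apply: contrapT => /eqP ne.
    apply: (hh (inl (inr v)) (inl (inr v')) _ c Cc Cc').
    rewrite -subset0 => x [/= /segr h1 /segr h2]; have [_ _ h3] := hr v'.
    have := h3 v ne; rewrite leNgt => /negP; apply.
    have -> : pt v - pt v' = (pt v - x) + (x - pt v') by rewrite addrA subrK.
    apply: le_lt_trans (ler_normD _ _) _; rewrite [`|pt v - x|]distrC; exact: ltrD.
- case=> [[[a b]|v] vk]; rewrite /s /t //= => -[E'].
  by case/andP: vk => ab _; rewrite /= E' adj_irr in ab.
- case=> [v|] /=; first by exists (phi h (pt v)); exists (pt v) => //; left.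
  by exists (phi h (M + 5, 0)); left; apply: nout.
- by move=> c hc; left.
exists W, S, e, i; split => //.
- move=> a b ab; case/orP: (oedge_or ab) => oe; last rewrite (planar_sym pl).
    exact: (he (exist _ (inl (a, b)) oe)).
  exact: (he (exist _ (inl (b, a)) oe)).
- move=> v bv; rewrite (planar_sym pl).
  have vk : valid (inr v) by apply/asboolP.
  exact: (he (exist _ (inr v) vk)).
Qed.
End Discretize.

Theorem theorem6 (R : realType) (G : plane_graph R) (v1 v2 : G)
    (he : boundary_edge v1 v2) :
  exists D : {set G * G},
    orientation (G := del_edge v1 v2) D /\
    #|EE D| <> #|OE D| /\
    (outdeg D v1 = 0%N /\ outdeg D v2 = 0%N /\
     (forall v : G, boundary_vertex v -> v <> v1 -> v <> v2 ->
        (outdeg D v <= 2)%N) /\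
     (forall v : G, interior_vertex v -> (outdeg D v <= 4)%N)).
Proof.
have [a12 fr] := he.
have [f hf] := arc_exists G; have [_ _ f0 f1 fE] := hf _ _ a12.
have b1 : boundary_vertex v1.
  by apply: fr; rewrite fE; exists 0 => //=; rewrite in_itv /= lexx ler01.
have b2 : boundary_vertex v2.
  by apply: fr; rewrite fE; exists 1 => //=; rewrite in_itv /= lexx ler01.
have [W [S [e [i [ii pl eadj ebd]]]]] := plane_graph_planar G.
pose j (v : G) := i (Some v); pose z := i None.
have jj : injective j by move=> u v /ii [].
have [m [nm m1 m2 mc]] := planar_nice_outer_edge pl (ebd v1 b1) (ebd v2 b2) (eadj v1 v2 a12).
pose eG : rel G := del_edge_adj v1 v2.
have eGs : symmetric eG := del_edge_sym v1 v2.
have eGi : irreflexive eG := del_edge_irr v1 v2.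
(* The lattice graph may have further vertices and adjacencies; [e'] is the copy of the plane graph
   without the edge [v1 v2] inside it. *)
pose e' : rel W := fun x y => [exists a, exists b, [&& x == j a, y == j b & eG a b]].
have e's : symmetric e'.
  by move=> x y; apply/existsP/existsP => -[a /existsP[b /and3P[h1 h2 h3]]]; exists b;
     apply/existsP; exists a; rewrite h1 h2 eGs.
have sub : subrel e' (rmE (rmV e z) (j v1) (j v2)).
  move=> x y /existsP[a /existsP[b /and3P[/eqP -> /eqP -> /andP[ab ne]]]].
  rewrite /rmE /rmV (eadj _ _ ab) !(inj_eq jj) /=.
  have nz' u : j u != z by apply/eqP => /ii.
  rewrite !nz' /=; apply: contra ne => /orP[]/andP[/eqP -> /eqP ->] //.
  by rewrite finset.setUC.
have [m' nm' le] := nz_sub e's sub nm.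
have e'E a b : e' (j a) (j b) = eG a b.
  apply/existsP/idP => [[a' /existsP[b' /and3P[/eqP /jj -> /eqP /jj ->]]]//|h].
  by exists a; apply/existsP; exists b; rewrite !eqxx.
have e'j x y : e' x y -> (exists x', x = j x') /\ exists y', y = j y'.
  by move=> /existsP[a /existsP[b /and3P[/eqP -> /eqP -> _]]]; split; [exists a|exists b].
have nG := nz_transfer jj eGs eGi e'E e'j nm'.
have [D [D1 D2 D3 D4]] := nz_orientation nG.
have out v : (outdeg D v)%:Z <= m (j v) by rewrite D4 ffunE.
exists D; split; first by split.
split; first exact: D3.
split; first by have := out v1; rewrite m1; lia.
split; first by have := out v2; rewrite m2; lia.
split => v.
  by move=> bv _ _; have := out v; have := mc (j v); rewrite /cap (ebd v bv); lia.
by move=> _; have := out v; have := mc (j v); rewrite /cap; case: ifP => _; lia.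
Qed.
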